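(* Let $A=\varinjlim(A_j,\phi_j)$ be the limit of an inductive sequence of $C^*$-algebras $A_1\xrightarrow{\phi_1}A_2\xrightarrow{\phi_2}\cdots$ in which each $A_j$ is a diagonal subhomogeneous (DSH) algebra and each connecting map $\phi_j:A_j\to A_{j+1}$ is a diagonal map. If $A$ is simple, then $A$ has stable rank one.
   Context: DSH algebras. Suppose given compact Hausdorff spaces $X_1,\dots,X_l$, closed subspaces $Y_i\subseteq X_i$ (with $Y_1=\varnothing$), positive integers $n_1,\dots,n_l$, $C^*$-algebras $A^{(i)}\subseteq\bigoplus_{j=1}^i C(X_j,M_{n_j})$ with $A^{(1)}=C(X_1,M_{n_1})$, and homomorphisms $\psi_i:A^{(i)}\to C(Y_{i+1},M_{n_{i+1}})$ for $1\le i\le l-1$, such that: (a) for each $y\in Y_{i+1}$ there are points $x_1,\dots,x_t$ with $x_m\in X_{i_m}$, $i_m\le i$, such that $\psi_i(f)(y)=\mathrm{diag}(f_{i_1}(x_1),\dots,f_{i_t}(x_t))$ for all $f\in A^{(i)}$, where $f_r$ denotes the summand of $f$ in $C(X_r,M_{n_r})$; (b) $A^{(i+1)}=A^{(i)}\oplus_{C(Y_{i+1},M_{n_{i+1}})}C(X_{i+1},M_{n_{i+1}})=\{(a,g)\in A^{(i)}\oplus C(X_{i+1},M_{n_{i+1}}):\psi_i(a)=g|_{Y_{i+1}}\}$. Then $A^{(l)}$ is called diagonal subhomogeneous (DSH). A DSH algebra is always considered together with such a presentation as a subalgebra of $\bigoplus_i C(X_i,M_{n_i})$. Diagonal maps.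 Let $A\subseteq\bigoplus_i C(X_i,M_{n_i})$ and $A'\subseteq\bigoplus_i C(X_i',M_{n_i'})$ be DSH algebras. A homomorphism $\phi:A\to A'$ is diagonal if for every $i$ and every $x\in X_i'$ there are points $x_1,\dots,x_t$, $x_k\in X_{i_k}$, such that $\phi(f)_i(x)=\mathrm{diag}(f_{i_1}(x_1),\dots,f_{i_t}(x_t))$ for every $f\in A$. A unital $C^*$-algebra has stable rank one if its invertible elements are norm dense. *)

(* Defs.v *)
From HB Require Import structures.
From mathcomp Require Import all_boot all_order all_algebra.
From mathcomp Require Import complex.
From mathcomp Require Import all_classical all_reals all_analysis.

Set Implicit Arguments.
Unset Strict Implicit.
Unset Printing Implicit Defensive.

Import Order.TTheory GRing.Theory Num.Theory.
Import numFieldNormedType.Exports.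
Import ComplexField.Normc.

Local Open Scope classical_set_scope.
Local Open Scope ring_scope.
Local Open Scope complex_scope.

(* Gives R[i], and hence 'M[R[i]]_n, the topology of the modulus. *)
HB.instance Definition _ (R : realType) := NormedModule.copy R[i] R[i]^o.

HB.mixin Record hasStar T := {
  star : T -> T;
  starK : involutive star
}.

#[short(type="starType")]
HB.structure Definition Star := {T of hasStar T}.

(* Unital nonzero C*-algebras: MathComp algebras satisfy 1 != 0. The norm is a
   real-valued field, as MathComp has no structure joining rings with the
   normed modules of MathComp-Analysis; so convergence, closedness and density
   are spelled out below. *)
HB.mixin Record isCStar (R : realType) A
    of GRing.Algebra R[i] A & hasStar A := {
  starD : {morph (star : A -> A) : x y / x + y};
  starM : forall x y : A, star (x * y) = star y * star x;
  starZ : forall (a : R[i]) (x : A), star (a *: x) = a^* *: star x;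
  cnorm : A -> R;
  cnormD : forall x y : A, cnorm (x + y) <= cnorm x + cnorm y;
  cnormZ : forall (a : R[i]) (x : A), cnorm (a *: x) = normc a * cnorm x;
  cnorm0_eq0 : forall x : A, cnorm x = 0 -> x = 0;
  cnormM : forall x y : A, cnorm (x * y) <= cnorm x * cnorm y;
  cnorm_star : forall x : A, cnorm (star x * x) = cnorm x ^+ 2;
  cnorm_complete : forall u : nat -> A,
    (forall e : R, 0 < e -> exists N, forall p q, (N <= p)%N -> (N <= q)%N ->
       cnorm (u p - u q) < e) ->
    exists x : A, cnorm (u k - x) @[k --> \oo] --> (0 : R)
}.

#[short(type="cstarAlgType")]
HB.structure Definition CStarAlgebra (R : realType) :=
  {A of GRing.Algebra R[i] A & hasStar A & isCStar R A}.

(* The three parts of "h is a homomorphism of *-algebras on the subalgebra S".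
   They are kept apart because MathComp has no structure joining possibly
   trivial rings with modules. Homomorphisms are not required to be unital. *)
Definition ring_hom_on (A B : pzRingType) (S : set A) (h : A -> B) :=
  {in S &, {morph h : x y / x + y}} /\ {in S &, {morph h : x y / x * y}}.

Definition scalable_on (K : pzRingType) (A B : lmodType K) (S : set A)
    (h : A -> B) := forall a : K, {in S, {morph h : x / a *: x}}.

Definition star_on (A B : starType) (S : set A) (h : A -> B) :=
  {in S, {morph h : x / star x}}.

Section StarInstances.

Definition mxstar (R : realType) n (M : 'M[R[i]]_n) : 'M[R[i]]_n :=
  (map_mx conjc M)^T.

Lemma mxstarK (R : realType) n : involutive (@mxstar R n).
Proof. by move=> M; apply/matrixP => i j; rewrite !mxE conjcK. Qed.

HB.instance Definition _ (R : realType) n :=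
  hasStar.Build 'M[R[i]]_n (@mxstarK R n).

Definition fctstar (T : Type) (A : starType) (f : T -> A) : T -> A :=
  fun x => star (f x).

Lemma fctstarK (T : Type) (A : starType) : involutive (@fctstar T A).
Proof. by move=> f; apply/funext => x; rewrite /fctstar starK. Qed.

HB.instance Definition _ (T : Type) (A : starType) :=
  hasStar.Build (T -> A) (@fctstarK T A).

End StarInstances.

(* The C*-norm of 'M[R[i]]_n: the operator norm for the Euclidean norm on
   column vectors (MathComp-Analysis's matrix norm is the entrywise maximum). *)
Definition l2norm (R : realType) n (v : 'cV[R[i]]_n) : R :=
  Num.sqrt (\sum_i (normc (v i 0)) ^+ 2).

Definition opnorm (R : realType) n (M : 'M[R[i]]_n) : R :=
  sup [set l2norm (M *m v) | v in [set v : 'cV[R[i]]_n | l2norm v <= 1]].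

Section Families.
Variables (R : realType) (X : nat -> topologicalType) (n : nat -> nat).

(* The *-algebra of all functions, continuous or not, in
   \bigoplus_(j <= m) (X j -> M_(n j)), with pointwise operations. *)
Definition mxfamily m := forall j : 'I_m.+1, X j -> 'M[R[i]]_(n j).

Variable m : nat.
Implicit Types f g h : mxfamily m.

HB.instance Definition _ := Choice.copy (mxfamily m)
  (forall j : 'I_m.+1, X j -> 'M[R[i]]_(n j)).

Let fam0 : mxfamily m := fun j => 0.
Let famN f : mxfamily m := fun j => - f j.
Let famD f g : mxfamily m := fun j => f j + g j.
Let fam1 : mxfamily m := fun j => 1.
Let famM f g : mxfamily m := fun j => f j * g j.
Let famZ (a : R[i]) f : mxfamily m := fun j => a *: f j.
Let famS f : mxfamily m := fun j => star (f j).

Let famE f g : (forall j, f j = g j) -> f = g.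
Proof. exact: functional_extensionality_dep. Qed.

Let famDA : associative famD.
Proof. by move=> f g h; apply: famE => j; exact: addrA. Qed.
Let famDC : commutative famD.
Proof. by move=> f g; apply: famE => j; exact: addrC. Qed.
Let fam0D : left_id fam0 famD.
Proof. by move=> f; apply: famE => j; exact: add0r. Qed.
Let famND : left_inverse fam0 famN famD.
Proof. by move=> f; apply: famE => j; exact: addNr. Qed.
HB.instance Definition _ :=
  GRing.isZmodule.Build (mxfamily m) famDA famDC fam0D famND.

Let famMA : associative famM.
Proof. by move=> f g h; apply: famE => j; exact: mulrA. Qed.
Let fam1M : left_id fam1 famM.
Proof. by move=> f; apply: famE => j; exact: mul1r. Qed.
Let famM1 : right_id fam1 famM.
Proof. by move=> f; apply: famE => j; exact: mulr1. Qed.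
Let famMDl : left_distributive famM +%R.
Proof. by move=> f g h; apply: famE => j; exact: mulrDl. Qed.
Let famMDr : right_distributive famM +%R.
Proof. by move=> f g h; apply: famE => j; exact: mulrDr. Qed.
HB.instance Definition _ := GRing.Zmodule_isPzRing.Build (mxfamily m)
  famMA fam1M famM1 famMDl famMDr.

Let famZA a b f : famZ a (famZ b f) = famZ (a * b) f.
Proof. by apply: famE => j; exact: scalerA. Qed.
Let fam1Z : left_id 1 famZ.
Proof. by move=> f; apply: famE => j; exact: scale1r. Qed.
Let famZDr : right_distributive famZ +%R.
Proof. by move=> a f g; apply: famE => j; exact: scalerDr. Qed.
Let famZDl f : {morph famZ^~ f : a b / a + b}.
Proof. by move=> a b; apply: famE => j; exact: scalerDl. Qed.
HB.instance Definition _ := GRing.Zmodule_isLmodule.Build R[i] (mxfamily m)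
  famZA fam1Z famZDr famZDl.

Let famSK : involutive famS.
Proof. by move=> f; apply: famE => j; exact: starK. Qed.
HB.instance Definition _ := hasStar.Build (mxfamily m) famSK.

(* The norm of \bigoplus_(j <= m) C(X j, M_(n j)). *)
Definition mxfamily_norm f : R :=
  sup [set r | exists (j : 'I_m.+1) (x : X j), r = opnorm (f j x)].

(* ev f = diag (f_(i_1) (x_1), ..., f_(i_t) (x_t)) for all f in S, with points
   x_k of X (i_k) that do not depend on f; e says that the block sizes add up
   to the size of ev f. *)
Definition diagonal_on (S : set (mxfamily m)) N
    (ev : mxfamily m -> 'M[R[i]]_N) :=
  exists (t : nat) (i_ : 'I_t -> 'I_m.+1) (x_ : forall k, X (i_ k))
      (e : (\sum_k n (i_ k))%N = N),
    forall f, S f -> ev f = castmx (e, e) (\mxdiag_k f (i_ k) (x_ k)).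

End Families.

Definition mxfamily_trunc (R : realType) (X : nat -> topologicalType)
    (n : nat -> nat) m (f : mxfamily R X n m.+1) : mxfamily R X n m :=
  fun j => f (widen_ord (leqnSn m.+1) j).

(* Indices start at 0, so pullback_alg m is A^(m+1). The map psi m goes from
   families to functions on the subspace Y m.+1; its values outside of
   pullback_alg m are irrelevant. *)
Fixpoint pullback_alg (R : realType) (X : nat -> topologicalType)
    (Y : forall i, set (X i)) (n : nat -> nat)
    (psi : forall m, mxfamily R X n m -> Y m.+1 -> 'M[R[i]]_(n m.+1))
    m {struct m} : set (mxfamily R X n m) :=
  match m with
  | 0 => [set f | continuous (f ord0)]
  | m'.+1 => [set f | [/\ pullback_alg psi (mxfamily_trunc f),
                          continuous (f ord_max)
                        & psi m' (mxfamily_trunc f) = f ord_max \o \val]]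
  end.

Arguments pullback_alg {R X Y n} psi m.

(* A DSH algebra of length dsh_last.+1, given by its presentation. Fields
   indexed by nat carry information only at the indices 0, ..., dsh_last of the
   summands. *)
Record dsh_algebra (R : realType) := DSHAlgebra {
  dsh_last : nat;
  dsh_space : nat -> topologicalType;
  dsh_sub : forall i, set (dsh_space i);
  dsh_size : nat -> nat;
  dsh_psi : forall m, mxfamily R dsh_space dsh_size m ->
    @dsh_sub m.+1 -> 'M[R[i]]_(dsh_size m.+1);
  dsh_compact : forall i, (i <= dsh_last)%N -> compact [set: dsh_space i];
  dsh_hausdorff : forall i, (i <= dsh_last)%N -> hausdorff_space (dsh_space i);
  dsh_sub_closed : forall i, (i <= dsh_last)%N -> closed (@dsh_sub i);
  dsh_sub0 : @dsh_sub 0 = set0;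
  dsh_size_gt0 : forall i, (i <= dsh_last)%N -> (0 < dsh_size i)%N;
  dsh_psi_continuous : forall m, (m < dsh_last)%N ->
    forall f, pullback_alg dsh_psi m f -> continuous (@dsh_psi m f);
  dsh_psi_hom : forall m, (m < dsh_last)%N ->
    [/\ ring_hom_on (pullback_alg dsh_psi m) (@dsh_psi m),
        scalable_on (pullback_alg dsh_psi m) (@dsh_psi m)
      & star_on (pullback_alg dsh_psi m) (@dsh_psi m)];
  dsh_psi_diagonal : forall m, (m < dsh_last)%N ->
    forall y, diagonal_on (pullback_alg dsh_psi m) (fun f => @dsh_psi m f y)
}.

Section DSH.
Variable R : realType.

(* The elements of D are the families in dsh_carrier D. *)
Definition dsh_family (D : dsh_algebra R) :=
  mxfamily R (dsh_space D) (@dsh_size R D) (dsh_last D).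

Definition dsh_carrier (D : dsh_algebra R) : set (dsh_family D) :=
  pullback_alg (@dsh_psi R D) (dsh_last D).

(* Outside of dsh_carrier D the values of phi are irrelevant. *)
Definition diagonal_hom (D D' : dsh_algebra R)
    (phi : dsh_family D -> dsh_family D') :=
  [/\ forall f, dsh_carrier f -> dsh_carrier (phi f),
      ring_hom_on (@dsh_carrier D) phi,
      scalable_on (@dsh_carrier D) phi,
      star_on (@dsh_carrier D) phi
    & forall (i : 'I_(dsh_last D').+1) (x : dsh_space D' i),
        diagonal_on (@dsh_carrier D) (fun f => phi f i x)].

Section Limit.
Variables (D : nat -> dsh_algebra R).
Variable phi : forall j, dsh_family (D j) -> dsh_family (D j.+1).

Fixpoint connecting j k : dsh_family (D j) -> dsh_family (D (k + j)%N) :=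
  match k return dsh_family (D j) -> dsh_family (D (k + j)%N) with
  | 0 => fun f => f
  | k'.+1 => fun f => phi (@connecting j k' f)
  end.

(* (A, mu) is the completion of the algebraic limit of the sequence (D, phi)
   with respect to the seminorm lim_k |connecting k f|. *)
Definition inductive_limit (A : cstarAlgType R)
    (mu : forall j, dsh_family (D j) -> A) :=
  [/\ forall j, [/\ ring_hom_on (@dsh_carrier (D j)) (mu j),
                    scalable_on (@dsh_carrier (D j)) (mu j)
                  & star_on (@dsh_carrier (D j)) (mu j)],
      forall j f, @dsh_carrier (D j) f -> mu j.+1 (phi f) = mu j f,
      forall j f, @dsh_carrier (D j) f ->
        mxfamily_norm (@connecting j k f) @[k --> \oo] --> cnorm (mu j f)
    & forall (a : A) (e : R), 0 < e ->
        exists j, exists2 f, @dsh_carrier (D j) f & cnorm (a - mu j f) < e].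

End Limit.
End DSH.

Section CStar.
Variables (R : realType) (A : cstarAlgType R).

Definition closed_ideal (I : set A) :=
  [/\ I 0,
      forall x y, I x -> I y -> I (x + y),
      forall (a : R[i]) x, I x -> I (a *: x),
      forall a x, I x -> I (a * x) /\ I (x * a)
    & forall x, (forall e : R, 0 < e -> exists2 y, I y & cnorm (x - y) < e) ->
        I x].

Definition simple_cstar := forall I, closed_ideal I -> I = [set 0] \/ I = setT.

Definition invertible (x : A) := exists y, x * y = 1 /\ y * x = 1.

Definition stable_rank_one := forall (a : A) (e : R), 0 < e ->
  exists2 b, invertible b & cnorm (a - b) < e.

End CStar.

(* Main.v *)
Require Import Defs.
From mathcomp Require Import all_boot all_order all_algebra.
From mathcomp Require Import complex.
From mathcomp Require Import all_classical all_reals all_analysis.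
From mathcomp Require Import zify ring lra.

(** The elements of a DSH algebra are the continuous families of matrices whose
value at a point of a gluing subspace is block diagonal, the blocks being the
values at lower points. Hence a matrix construction that is continuous and
commutes with the formation of block-diagonal matrices preserves the algebra
([carrier_nat]), and a relation between matrices that passes from blocks to
block-diagonal matrices, and whose solutions extend continuously from closed
subspaces, can be solved inside the algebra ([carrier_ext]): one goes from level
to level with the theorem of Tietze. In the same way a property of matrices that
passes from blocks to block-diagonal matrices is inherited by the images under
diagonal maps ([transfer_pred]). The whole proof is carried by such natural
constructions on single matrices.

Let [f] be an element of stage [j] whose image [mu j f] is not a limit of
invertible elements; the proof derives a contradiction. Let [B] bound the matrix
sizes of stage [j].

Zero crosses. An invertibility argument with [f^* f] shows that a non-invertible
image is caused by a singular value of [f] at a point that survives in the limit,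
in the sense that every element of the kernel of [mu j] vanishes there
([singular_surviving]). Elementary operations, lifted to invertible elements of
the algebra, turn this singularity into a row and a column of zeros at that
point, and a small perturbation then makes the row and the column vanish
wherever a certain diagonal element [d] with entries in [0, 1] has a nonzero
entry: [d] marks a zero cross of [f]. None of these operations makes the image a
limit of invertibles. If a small multiple of the marks found so far is added
before one looks for the singular point, then the new cross lies outside the old
ones, so that the step can be repeated ([many_crosses]) until there are [B]
pairwise orthogonal marks, each of which is nonzero in the limit.

Simplicity. The elements that vanish, at some stage, wherever the image of a
given mark vanishes generate a closed ideal. It is nonzero, hence everything, and
therefore the mark is nonzero at every point of some later stage and from there
on ([full_everywhere]). At that stage each value of [f] is a matrix with at
least [B] zero crosses in which a nonzero entry [(r, c)] satisfies [c < r + B],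
because the blocks coming from stage [j] have size at most [B].

Rotations. Carrying the zero row [p] to the top by successive rotations of
neighbouring rows pushes every row above it down by one, and carrying a zero
column to the far right pushes every column beyond it to the left by one. If
[r <= c], then each zero cross [p] satisfies [r < p] or [p < c], so that all [B]
crosses together move the nonzero entry [(r, c)] strictly below the diagonal. The
rotations depend continuously on parameters that must vanish outside the crosses
and must not carry a row or column out of its block. Such parameters exist
([steers_ext]) once the entries of [f] below some size have been replaced by [0],
which is again a small perturbation. The result is a pair of invertible elements
[U], [V] such that [U * f * V] is strictly lower triangular at every point
([lower_conjugate]). Adding to it any nonzero scalar makes it invertible, so the
image of the truncated [f] is a limit of invertibles: a contradiction, because
the truncation can be chosen so small that this is impossible. *)

Set Implicit Arguments.
Unset Strict Implicit.
Unset Printing Implicit Defensive.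
Import Order.TTheory GRing.Theory Num.Theory.
Import numFieldNormedType.Exports.
Import ComplexField.Normc.
Local Open Scope classical_set_scope.
Local Open Scope ring_scope.
Local Open Scope complex_scope.

(** * Nonzero sums and matrices *)

Lemma sum_neq0 (V : nmodType) (I : finType) (F : I -> V) :
  \sum_i F i != 0 -> exists i, F i != 0.
Proof.
move=> S0; have [i Fi|F0] := pickP (fun i => F i != 0); first by exists i.
by case/eqP: S0; apply: big1 => i _; apply/eqP; rewrite -[_ == _]negbK F0.
Qed.

Lemma mx_neq0 (V : nmodType) m n (M : 'M[V]_(m, n)) :
  M != 0 -> exists p q, M p q != 0.
Proof.
move=> M0; have [[p q] Mpq|M00] := pickP (fun pq => M pq.1 pq.2 != 0).
  by exists p, q.
case/eqP: M0; apply/matrixP => p q; rewrite mxE.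
by apply/eqP; rewrite -[_ == _]negbK (M00 (p, q)).
Qed.

Lemma mulmx_neq0 (K : pzSemiRingType) m n k (M : 'M[K]_(m, n)) (N : 'M[K]_(n, k)) p q :
  (M *m N) p q != 0 -> exists2 r, M p r != 0 & N r q != 0.
Proof.
rewrite mxE => /sum_neq0[r MNr].
by exists r; apply: contraNneq MNr => ->; rewrite ?mul0r ?mulr0.
Qed.

(** * Continuity of scalar- and matrix-valued functions *)

Section Continuity.
Variable R : realType.
Implicit Types X : topologicalType.
Local Notation C := R[i].

Lemma Re_continuous : continuous (@complex.Re R : C -> R).
Proof.
move=> z; apply/(@cvgrPdist_lt R R^o C (nbhs z) (nbhs_filter z) (@complex.Re R)
  (complex.Re z)) => e e0.
have h : nbhs z [set w : C | `|z - w| < e%:C].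
  by apply: (@nbhsx_ballx _ C z e%:C); rewrite ltcR.
apply: filterS h => w /= h.
by rewrite -raddfB -ltcR; apply: le_lt_trans h; exact: normc_ge_Re.
Qed.

Lemma continuous_real_complex X (f : X -> R) :
  continuous f -> continuous (fun x => (f x)%:C : C).
Proof.
move=> cf x; apply/(@cvgrPdist_lt C C^o X (nbhs x) (nbhs_filter x)) => e e0.
have [Ie0 Re0] : complex.Im e = 0 /\ 0 < complex.Re e.
  by move: e0; rewrite ltcE /= => /andP[/eqP -> ->].
have h := cf x; move/(@cvgrPdist_lt R R^o X (nbhs x) (nbhs_filter x)) in h.
apply: filterS (h _ Re0) => y /= hy.
have -> : e = (complex.Re e)%:C by rewrite [LHS]complexE Ie0 mulr0 addr0.
rewrite -rmorphB normc_def /= expr0n addr0 ltcR.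
by rewrite sqrtr_sqr.
Qed.

Lemma continuousC_cst X (c : C) : continuous (fun _ : X => c).
Proof. by move=> x; exact: cvg_cst. Qed.

Lemma continuousC_D X (f g : X -> C) :
  continuous f -> continuous g -> continuous (fun x => f x + g x).
Proof. by move=> cf cg x; apply: cvgD; [exact: cf|exact: cg]. Qed.

Lemma continuousC_M X (f g : X -> C) :
  continuous f -> continuous g -> continuous (fun x => f x * g x).
Proof. by move=> cf cg x; apply: cvgM; [exact: cf|exact: cg]. Qed.

Lemma continuousC_V X (f : X -> C) :
  continuous f -> (forall x, f x != 0) -> continuous (fun x => (f x)^-1).
Proof. by move=> cf h x; apply: cvgV; [exact: h|exact: cf]. Qed.

Lemma continuous_comp_fun (X Y Z : topologicalType) (f : X -> Y) (g : Y -> Z) :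
  continuous f -> continuous g -> continuous (fun x => g (f x)).
Proof. by move=> cf cg x; apply: continuous_comp; [exact: cf|exact: cg]. Qed.

Lemma continuousR_cst X (c : R) : continuous (fun _ : X => c).
Proof. by move=> x; exact: cvg_cst. Qed.

Lemma continuousR_D X (f g : X -> R) :
  continuous f -> continuous g -> continuous (fun x => f x + g x).
Proof. by move=> cf cg x; apply: (@cvgD R R^o); [exact: cf|exact: cg]. Qed.

Lemma continuousR_M X (f g : X -> R) :
  continuous f -> continuous g -> continuous (fun x => f x * g x).
Proof. by move=> cf cg x; apply: cvgM; [exact: cf|exact: cg]. Qed.

Lemma continuousR_N X (f : X -> R) :
  continuous f -> continuous (fun x => - f x).
Proof. by move=> cf x; apply: (@cvgN R R^o); exact: cf. Qed.

Lemma continuousR_max X (f g : X -> R) :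
  continuous f -> continuous g -> continuous (fun x => Num.max (f x) (g x)).
Proof. by move=> cf cg x; apply: continuous_max; [exact: cf|exact: cg]. Qed.

Lemma continuousR_min X (f g : X -> R) :
  continuous f -> continuous g -> continuous (fun x => Num.min (f x) (g x)).
Proof. by move=> cf cg x; apply: continuous_min; [exact: cf|exact: cg]. Qed.

Lemma continuous_bigop X (T : topologicalType) (op : T -> T -> T) (x0 : T)
    (I : Type) (r : seq I) (P : pred I) (f : I -> X -> T) :
  (forall g h : X -> T, continuous g -> continuous h -> continuous (fun x => op (g x) (h x))) ->
  (forall i, continuous (f i)) ->
  continuous (fun x => \big[op/x0]_(i <- r | P i) f i x).
Proof.
move=> cop cf; elim: r => [|i r IH].
  by under eq_fun do rewrite big_nil; move=> x; exact: cvg_cst.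
under eq_fun do rewrite big_cons.
by case: (P i); [exact: cop (cf i) IH|exact: IH].
Qed.

Lemma continuousC_sum X (I : Type) (r : seq I) (P : pred I) (f : I -> X -> C) :
  (forall i, continuous (f i)) ->
  continuous (fun x => \sum_(i <- r | P i) f i x).
Proof. exact: continuous_bigop (@continuousC_D X). Qed.

Lemma continuousC_prod X (I : Type) (r : seq I) (P : pred I) (f : I -> X -> C) :
  (forall i, continuous (f i)) ->
  continuous (fun x => \prod_(i <- r | P i) f i x).
Proof. exact: continuous_bigop (@continuousC_M X). Qed.

Lemma continuousR_sum X (I : Type) (r : seq I) (P : pred I) (f : I -> X -> R) :
  (forall i, continuous (f i)) ->
  continuous (fun x => \sum_(i <- r | P i) f i x).
Proof. exact: continuous_bigop (@continuousR_D X). Qed.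

Lemma continuous_complex X (f g : X -> R) :
  continuous f -> continuous g -> continuous (fun x => f x +i* g x : C).
Proof.
move=> cf cg.
have -> : (fun x => f x +i* g x) = (fun x => (f x)%:C + 'i%C * (g x)%:C :> C).
  by apply: funext => x; rewrite {1}[f x +i* g x]complexE.
apply: continuousC_D; first exact: continuous_real_complex.
by apply: continuousC_M; [exact: continuousC_cst|exact: continuous_real_complex].
Qed.

Lemma Im_continuous : continuous (@complex.Im R : C -> R).
Proof.
have -> : @complex.Im R = (fun z => - complex.Re (z * 'i%C)).
  by apply: funext => z; rewrite ReiNIm opprK.
apply: continuousR_N; apply: continuous_comp_fun; last exact: Re_continuous.
by apply: continuousC_M; [move=> x; exact: cvg_id|exact: continuousC_cst].
Qed.

Lemma continuousC_conj X (f : X -> C) :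
  continuous f -> continuous (fun x => (f x)^*).
Proof.
move=> cf.
have -> : (fun x => (f x)^*) = (fun x => complex.Re (f x) +i* (- complex.Im (f x))).
  by apply: funext => x; case: (f x).
apply: continuous_complex; first exact: continuous_comp_fun cf Re_continuous.
by apply: continuousR_N; exact: continuous_comp_fun cf Im_continuous.
Qed.

Lemma continuousR_sqrt X (f : X -> R) :
  continuous f -> continuous (fun x => Num.sqrt (f x)).
Proof. move=> cf; apply: (continuous_comp_fun cf); exact: sqrt_continuous. Qed.

Lemma continuous_normc X (f : X -> C) :
  continuous f -> continuous (fun x => normc (f x)).
Proof.
move=> cf.
have -> : (fun x => normc (f x)) =
    (fun x => Num.sqrt (complex.Re (f x) * complex.Re (f x)
                      + complex.Im (f x) * complex.Im (f x))).
  by apply: funext => x; case: (f x) => a b /=; rewrite !expr2.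
have cR := continuous_comp_fun cf Re_continuous.
have cI := continuous_comp_fun cf Im_continuous.
by apply/continuousR_sqrt/continuousR_D; exact: continuousR_M.
Qed.

(** The topology of matrices is the product topology of their entries. *)
Lemma mx_continuousP X m n (F : X -> 'M[C]_(m, n)) :
  continuous F <-> forall i j, continuous (fun x => F x i j).
Proof.
split=> [cF i j x A /= hA|cF x A [P hP sPA]].
  apply: (cF x [set M | A (M i j)]).
  exists (fun i' j' => [set z | i' = i -> j' = j -> A z]) => [i' j'|M /(_ i j)/=]; last exact.
  have [->|ni] := eqVneq i' i; last by apply: filterS filterT => z _ /= /eqP; rewrite (negbTE ni).
  have [->|nj] := eqVneq j' j; last by apply: filterS filterT => z _ /= _ /eqP; rewrite (negbTE nj).
  by apply: filterS hA => z Az _ _.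
have hh (ij : 'I_m * 'I_n) : \forall y \near x, P ij.1 ij.2 (F y ij.1 ij.2).
  exact: (cF ij.1 ij.2 x _ (hP ij.1 ij.2)).
have h : \forall y \near x, forall ij : 'I_m * 'I_n, P ij.1 ij.2 (F y ij.1 ij.2).
  exact: (@filter_forall _ _ _ _ _ hh).
by apply: filterS h => y hy; apply: sPA => i j; exact: (hy (i,j)).
Qed.

Lemma mx_continuous X m n (F : X -> 'M[C]_(m, n)) :
  (forall i j, continuous (fun x => F x i j)) -> continuous F.
Proof. by move/mx_continuousP. Qed.

Lemma continuous_mxE X m n (F : X -> 'M[C]_(m, n)) i j :
  continuous F -> continuous (fun x => F x i j).
Proof. by move/mx_continuousP; exact. Qed.

Lemma continuous_mulmx X m n p (F : X -> 'M[C]_(m, n)) (G : X -> 'M[C]_(n, p)) :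
  continuous F -> continuous G -> continuous (fun x => F x *m G x).
Proof.
move=> cF cG; apply: mx_continuous => i j; under eq_fun do rewrite mxE.
by apply: continuousC_sum => k; apply: continuousC_M; exact: continuous_mxE.
Qed.

Lemma continuous_addmx X m n (F G : X -> 'M[C]_(m, n)) :
  continuous F -> continuous G -> continuous (fun x => F x + G x).
Proof.
move=> cF cG; apply: mx_continuous => i j; under eq_fun do rewrite mxE.
by apply: continuousC_D; exact: continuous_mxE.
Qed.

Lemma continuous_scalemx X m n (a : X -> C) (F : X -> 'M[C]_(m, n)) :
  continuous a -> continuous F -> continuous (fun x => a x *: F x).
Proof.
move=> ca cF; apply: mx_continuous => i j; under eq_fun do rewrite mxE.
exact: (continuousC_M ca (continuous_mxE (i := i) (j := j) cF)).
Qed.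

Lemma continuous_mxstar X n (F : X -> 'M[C]_n) :
  continuous F -> continuous (fun x => star (F x)).
Proof.
move=> cF; apply: mx_continuous => i j; under eq_fun do rewrite !mxE.
by apply: continuousC_conj; exact: continuous_mxE.
Qed.

Lemma continuous_det X n (F : X -> 'M[C]_n) :
  continuous F -> continuous (fun x => \det (F x)).
Proof.
move=> cF; apply: continuousC_sum => s; apply: continuousC_M.
  exact: continuousC_cst.
by apply: continuousC_prod => i; exact: continuous_mxE.
Qed.

Lemma continuous_invmx X n (F : X -> 'M[C]_n) :
  continuous F -> (forall x, F x \in unitmx) -> continuous (fun x => invmx (F x)).
Proof.
move=> cF uF.
have -> : (fun x => invmx (F x)) = (fun x => (\det (F x))^-1 *: \adj (F x)).
  by apply: funext => x; rewrite /invmx uF.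
apply: continuous_scalemx.
  apply: continuousC_V; first exact: continuous_det.
  by move=> x; have := uF x; rewrite unitmxE unitfE.
apply: mx_continuous => i j; under eq_fun do rewrite !mxE.
apply: continuousC_M; first exact: continuousC_cst.
apply: continuous_det; apply: mx_continuous => k l.
by under eq_fun do rewrite !mxE; exact: continuous_mxE.
Qed.

End Continuity.

(** * Block-diagonal matrices *)

Section Layout.
Variable R : realType.
Local Notation C := R[i].

(** The positions of the diagonal blocks of an [N x N] matrix: [iota k] embeds the
indices of the [k]-th block as an interval, and the intervals partition ['I_N].
These embeddings replace casts along [\sum_k n k = N] by statements on indices. *)
Definition layout N t (n : 'I_t -> nat) (iota : forall k, 'I_(n k) -> 'I_N) :=
  [/\ exists o : 'I_t -> nat, forall k a, iota k a = (o k + a)%N :> nat,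
      forall p, exists k a, p = iota k a
    & forall k k' a a', iota k a = iota k' a' -> k = k'].

Definition block_diag N t (n : 'I_t -> nat) (iota : forall k, 'I_(n k) -> 'I_N)
    (M : 'M[C]_N) (Mk : forall k, 'M[C]_(n k)) :=
  (forall k a b, M (iota k a) (iota k b) = Mk k a b) /\
  (forall k k' a b, k <> k' -> M (iota k a) (iota k' b) = 0).

Lemma mxdiag_layout N t (n : 'I_t -> nat) (e : (\sum_k n k)%N = N) :
  exists iota : forall k, 'I_(n k) -> 'I_N, layout iota /\
    forall Mk : forall k, 'M[C]_(n k),
      block_diag iota (castmx (e, e) (\mxdiag_k Mk k)) Mk.
Proof.
case: N / e; exists (fun k a => @tagnat.Rank t n k a); split; first split.
- exists (fun k => \sum_(i < t | (i < k)%N) n i)%N => k a.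
  by rewrite tagnat.RankEsum.
- move=> p; exists (tagnat.sig1 p), (tagnat.sig2 p).
  by rewrite tagnat.sig2K.
- move=> k k' a a' /(congr1 val)/eqP; rewrite /= tagnat.eq_Rank.
  by case/andP => /eqP.
move=> Mk; split=> [k a b|k k' a b kk']; rewrite castmx_id.
  have := submxblock_diag Mk k.
  by move/matrixP/(_ a b); rewrite mxE.
have := @mxblockK C t t n n (fun j k => if j == k then conform_mx 0 (Mk j) else 0) k k'.
by move/matrixP/(_ a b); rewrite mxE => ->; case: eqP => // _; rewrite mxE.
Qed.

Section Ops.
Variables (N t : nat) (n : 'I_t -> nat) (iota : forall k, 'I_(n k) -> 'I_N).
Arguments iota : clear implicits.
Hypothesis L : layout iota.
Implicit Types (M : 'M[C]_N) (Mk : forall k, 'M[C]_(n k)).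

Lemma layout_inj k : injective (iota k).
Proof.
have [[s sE] _ _] := L; move=> a b /(congr1 val) /=; rewrite !sE => /addnI.
exact: val_inj.
Qed.

Lemma layout_ind (P : 'I_N -> Prop) : (forall k a, P (iota k a)) -> forall p, P p.
Proof. by case: L => _ cov _ h p; have [k [a ->]] := cov p. Qed.

Lemma block_diag_uniq M M' Mk :
  block_diag iota M Mk -> block_diag iota M' Mk -> M = M'.
Proof.
move=> [h1 h2] [h1' h2']; apply/matrixP.
apply: layout_ind => k a; apply: layout_ind => k' b.
have [e|/eqP ne] := eqVneq k k'; last by rewrite h2 // h2'.
by case: _ / e b => b; rewrite h1 h1'.
Qed.

Lemma layout_sum k (F : 'I_N -> C) :
  (forall k' b, k <> k' -> F (iota k' b) = 0) ->
  \sum_p F p = \sum_b F (iota k b).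
Proof.
move=> F0; rewrite (bigID (mem (iota k @: 'I_(n k)))%SET) /= [X in _ + X]big1.
  rewrite addr0 big_imset /=; last by move=> a b _ _; exact: layout_inj.
  by [].
apply: layout_ind => k' b; have [e|/eqP ne] := eqVneq k k'; last by rewrite F0.
by case: _ / e b => b; rewrite imset_f.
Qed.

Lemma block_diag0 : block_diag iota 0 (fun k => 0).
Proof. by split=> *; rewrite !mxE. Qed.

Lemma block_diag1 : block_diag iota 1%:M (fun k => 1%:M).
Proof.
split=> [k a b|k k' a b ne]; rewrite !mxE.
  by rewrite (inj_eq (@layout_inj k)).
case: eqP => // e; case: ne; case: L => _ _ inj; exact: (inj _ _ _ _ e).
Qed.

Lemma block_diagD M M' Mk Mk' : block_diag iota M Mk -> block_diag iota M' Mk' ->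
  block_diag iota (M + M') (fun k => Mk k + Mk' k).
Proof.
move=> [h1 h2] [h1' h2']; split=> [k a b|k k' a b ne]; rewrite !mxE.
  by rewrite h1 h1'.
by rewrite h2 // h2' // addr0.
Qed.

Lemma block_diagZ (c : C) M Mk : block_diag iota M Mk ->
  block_diag iota (c *: M) (fun k => c *: Mk k).
Proof.
move=> [h1 h2]; split=> [k a b|k k' a b ne]; rewrite !mxE ?h1 //.
by rewrite h2 // mulr0.
Qed.

Lemma block_diagM M M' Mk Mk' : block_diag iota M Mk -> block_diag iota M' Mk' ->
  block_diag iota (M *m M') (fun k => Mk k *m Mk' k).
Proof.
move=> [h1 h2] [h1' h2']; split=> [k a b|k k' a b ne]; rewrite !mxE.
  rewrite (layout_sum (k := k)) => [|k' c ne]; last by rewrite h2 // mul0r.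
  by apply: eq_bigr => c _; rewrite h1 h1'.
rewrite (layout_sum (k := k)) => [|k'' c ne']; last by rewrite h2 // mul0r.
by rewrite big1 // => c _; rewrite h2' // mulr0.
Qed.

Lemma block_diag_star M Mk : block_diag iota M Mk ->
  block_diag iota (star M) (fun k => star (Mk k)).
Proof.
move=> [h1 h2]; split=> [k a b|k k' a b ne]; rewrite !mxE ?h1 //.
by rewrite h2 ?conjc0 // => e; apply: ne.
Qed.

Definition block_col (v : 'cV[C]_N) k : 'cV[C]_(n k) := \col_a v (iota k a) 0.

Lemma block_diag_col M Mk v k a : block_diag iota M Mk ->
  (M *m v) (iota k a) 0 = (Mk k *m block_col v k) a 0.
Proof.
move=> [h1 h2]; rewrite !mxE (layout_sum (k := k)) => [|k' b ne].
  by apply: eq_bigr => b _; rewrite h1 mxE.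
by rewrite h2 // mul0r.
Qed.

(** Each pair of indices determines its block and its place in the block, so the
entries can be chosen one by one; this avoids the casts of [\mxdiag]. *)
Lemma block_diag_build Mk : exists M, block_diag iota M Mk.
Proof.
have [_ cov inj] := L.
pose P (p q : 'I_N) z := (forall k a b, p = iota k a -> q = iota k b -> z = Mk k a b) /\
  (forall k k' a b, k <> k' -> p = iota k a -> q = iota k' b -> z = 0).
have ex p q : exists z, P p q z.
  have [k [a ->]] := cov p; have [k' [b ->]] := cov q.
  have [e|/eqP ne] := eqVneq k k'.
    case: _ / e b => b; exists (Mk k a b); split=> [k2 a2 b2 e1 e2|].
      have ek := inj _ _ _ _ e1; case: _ / ek a2 b2 e1 e2 => a2 b2.
      by move=> /layout_inj -> /layout_inj ->.
    by move=> k2 k3 a2 b2 ne e1 e2; case: ne; rewrite -(inj _ _ _ _ e1) (inj _ _ _ _ e2).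
  exists 0; split=> // k2 a2 b2 e1 e2; case: ne.
  by rewrite (inj _ _ _ _ e1) (inj _ _ _ _ e2).
exists (\matrix_(p, q) projT1 (cid (ex p q))).
split=> [k a b|k k' a b ne]; rewrite mxE; case: cid => z [h1 h2] /=.
  exact: h1.
exact: (h2 _ _ _ _ ne).
Qed.

(** The block matrix of the inverses is an inverse, and inverses are unique. *)
Lemma block_diag_inv M Mk : block_diag iota M Mk ->
  (forall k, Mk k \in unitmx) ->
  M \in unitmx /\ block_diag iota (invmx M) (fun k => invmx (Mk k)).
Proof.
move=> bM uM; have [M' bM'] := block_diag_build (fun k => invmx (Mk k)).
have MM' : M *m M' = 1%:M.
  apply: block_diag_uniq block_diag1.
  have := block_diagM bM bM'; congr block_diag.
  by apply: functional_extensionality_dep => k; rewrite mulmxV.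
have [uM1 _] := mulmx1_unit MM'; split=> //.
by rewrite -[invmx M]mulmx1 -MM' mulmxA mulVmx // mul1mx.
Qed.

End Ops.
End Layout.

(** * Extension of continuous functions from closed subspaces *)

Section Tietze.
Variable R : realType.
Local Notation C := R[i].
Variable X : topologicalType.
Hypotheses (cX : compact [set: X]) (hX : hausdorff_space X).
Variable Y : set X.
Hypothesis clY : closed Y.

(** On a compact subspace a continuous function is bounded, which reduces the claim
to the theorem of Tietze for bounded functions. *)
Lemma tietze_real (g : Y -> R) : continuous g ->
  exists G : X -> R, continuous G /\ forall y : Y, G (val y) = g y.
Proof.
move=> cg; have nX := compact_normal hX cX.
have cY : compact Y by apply: subclosed_compact clY cX _.
have [Y0|Yn0] := eqVneq Y set0.
  exists (fun=> 0); split; first exact: continuousR_cst.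
  by move=> [y yY]; exfalso; move: (set_mem yY); rewrite Y0.
pose f (x : X) : R := if pselect (x \in Y) is left h then g (exist _ x h) else 0.
have fg (y : Y) : f (val y) = g y.
  rewrite /f; case: pselect => [h|]; last by case: y.
  by congr g; exact: val_inj.
have cf : {within Y, continuous f}.
  apply/subspace_sigL_continuousP.
  by have -> : sigL Y f = g by apply: funext => y; rewrite -fg.
have cnf : {within Y, continuous (fun x => `|f x| : R)}.
  move=> x; apply: continuous_comp; [exact: cf|exact: norm_continuous].
have Yne : Y !=set0 by apply/set0P.
have [c /= cYc hc] := compact_EVT_max Yne cY cnf.
have hb x : Y x -> `|f x| <= `|f c| + 1.
  by move=> /mem_set/hc /le_trans; apply; rewrite lerDl.
have M0 : 0 < `|f c| + 1 by rewrite ltr_wpDl.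
have [G [GE cG _]] := continuous_bounded_extension nX clY M0 cf hb.
exists G; split=> // y; rewrite -fg -GE //; exact: (valP y).
Qed.

Lemma tietze_mx n (g : Y -> 'M[C]_n) : continuous g ->
  exists G : X -> 'M[C]_n, continuous G /\ forall y : Y, G (val y) = g y.
Proof.
move=> cg.
have h (ij : 'I_n * 'I_n) : exists G : X -> C, continuous G /\
    forall y : Y, G (val y) = g y ij.1 ij.2.
  have cgij : continuous (fun y => g y ij.1 ij.2) by exact: continuous_mxE.
  have [G1 [cG1 G1E]] := tietze_real (continuous_comp_fun cgij (@Re_continuous R)).
  have [G2 [cG2 G2E]] := tietze_real (continuous_comp_fun cgij (@Im_continuous R)).
  exists (fun x => G1 x +i* G2 x); split; first exact: continuous_complex.
  by move=> y; rewrite G1E G2E; case: (g y _ _).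
pose G x := \matrix_(i, j) projT1 (cid (h (i, j))) x.
exists G; split.
  apply: mx_continuous => i j; rewrite /G.
  under eq_fun do rewrite mxE.
  by case: cid => f [].
by move=> y; apply/matrixP => i j; rewrite mxE; case: cid => f /= [_ ->].
Qed.

Lemma urysohn_closed (A : set X) : closed A -> A `&` Y = set0 ->
  exists f : X -> R, [/\ continuous f, forall x, 0 <= f x <= 1,
    forall x, Y x -> f x = 0 & forall x, A x -> f x = 1].
Proof.
move=> clA AY; have nX := compact_normal hX cX.
have [] := @urysohn_ext_itv X R nX Y A 0 1 clY clA _ ltr01.
  by rewrite setIC.
move=> f [cf f0 f1 fr]; exists f; split=> //.
- by move=> x; have /fr : range f (f x) by []; rewrite /= in_itv.
- by move=> x Yx; apply: f0; exists x.
- by move=> x Yx; apply: f1; exists x.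
Qed.

End Tietze.

(** * Elements of a DSH algebra, level by level *)

Section Levels.
Variable R : realType.
Local Notation C := R[i].
Variable D : dsh_algebra R.
Local Notation l := (dsh_last D).
Local Notation X := (dsh_space D).
Local Notation Y i := (@dsh_sub R D i).
Local Notation n := (@dsh_size R D).
Local Notation psi := (@dsh_psi R D).

(** Families indexed by all naturals: an element of a lower level is a restriction of
the same object, and adding a summand is an update at one index. This keeps the
level-by-level constructions free from casts between ordinal types. *)
Definition nfamily := forall j, X j -> 'M[C]_(n j).

Definition restrict_level m (F : nfamily) : mxfamily R X n m := fun j => F j.

Arguments restrict_level : clear implicits.

Definition in_level m (F : nfamily) := pullback_alg psi m (restrict_level m F).

Definition nat_family (f : dsh_family D) : nfamily := fun i =>
  match ltnP i l.+1 with
  | LtnNotGeq h => f (Ordinal h)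
  | _ => fun=> 0
  end.

Arguments nat_family : clear implicits.

Lemma nat_familyE f (i : 'I_l.+1) : nat_family f i = f i.
Proof.
rewrite /nat_family; case: ltnP => [h|]; last by rewrite leqNgt ltn_ord.
case: i h => i h h'; by rewrite (bool_irrelevance h' h).
Qed.

Lemma restrict_level_nat_family f : restrict_level l (nat_family f) = f.
Proof. by apply: functional_extensionality_dep => i; rewrite /restrict_level nat_familyE. Qed.

Lemma in_levelS m F : in_level m.+1 F <->
  [/\ in_level m F, continuous (F m.+1) & psi (restrict_level m F) = F m.+1 \o \val].
Proof. by []. Qed.

Lemma in_level_le m p F : (m <= p)%N -> in_level p F -> in_level m F.
Proof.
elim: p => [|p IH]; first by rewrite leqn0 => /eqP ->.
rewrite leq_eqVlt => /orP[/eqP -> //|]; rewrite ltnS => mp.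
by move=> /in_levelS[h _ _]; exact: IH.
Qed.

Lemma in_level_continuous m F i : (i <= m)%N -> in_level m F -> continuous (F i).
Proof.
move=> im /(in_level_le im); case: i im => [|i] _; first exact.
by move=> /in_levelS[].
Qed.

(** The gluing condition at the point [y], detached from [psi]: the value at [y] of
every element of level [m.+1] is the block sum of its values at [x_]. *)
Definition decomp m (y : X m.+1) t (i_ : 'I_t -> 'I_m.+1) (x_ : forall k, X (i_ k))
    (iota : forall k, 'I_(n (i_ k)) -> 'I_(n m.+1)) :=
  layout iota /\ forall F, in_level m.+1 F ->
    block_diag iota (F m.+1 y) (fun k => F (i_ k) (x_ k)).

Lemma psi_decomp m (y : Y m.+1) : (m < l)%N ->
  exists t i_ x_ iota, @decomp m (val y) t i_ x_ iota /\
    forall F, in_level m F -> block_diag iota (psi (restrict_level m F) y) (fun k => F (i_ k) (x_ k)).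
Proof.
move=> ml; have [t [i_ [x_ [e h]]]] := dsh_psi_diagonal ml y.
have [iota [L bd]] := mxdiag_layout R e.
have hF F : in_level m F -> block_diag iota (psi (restrict_level m F) y) (fun k => F (i_ k) (x_ k)).
  by move=> /h ->; exact: bd.
exists t, i_, x_, iota; split=> //; split=> // F /in_levelS[hF1 _ /(congr1 (fun f => f y))/= <-].
exact: hF.
Qed.

(** Membership only asks for continuity and for the right values on the gluing
subspaces, where a block sum is determined by its blocks. *)
Lemma in_level_intro m G : (m <= l)%N -> (forall i, (i <= m)%N -> continuous (G i)) ->
  (forall i (y : X i.+1), (i < m)%N -> Y i.+1 y ->
     forall t i_ x_ iota, @decomp i y t i_ x_ iota ->
     block_diag iota (G i.+1 y) (fun k => G (i_ k) (x_ k))) ->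
  in_level m G.
Proof.
elim: m => [|m IH] ml cG nG; first by apply: (cG 0%N).
have Gm : in_level m G.
  apply: IH => [|i im|i y im]; first exact: ltnW.
    by apply: cG; exact: leqW.
  by apply: nG; exact: leqW.
apply/in_levelS; split=> //; first exact: cG.
apply: funext => y /=; have [t [i_ [x_ [iota [dec h]]]]] := psi_decomp y ml.
have Yy : Y m.+1 (val y) by exact: (set_mem (valP y)).
have q := nG m _ (ltnSn m) Yy _ _ _ _ dec.
have q2 := h _ Gm.
exact: (block_diag_uniq dec.1 q2 q).
Qed.

Definition upd (F : nfamily) m (G : X m -> 'M[C]_(n m)) : nfamily :=
  @dfwith nat (fun j => X j -> 'M[C]_(n j)) F m G.

Lemma in_level_upd m F G : in_level m F -> (m < l)%N -> continuous G ->
  (forall y : Y m.+1, G (val y) = psi (restrict_level m F) y) ->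
  in_level m.+1 (upd F G).
Proof.
move=> Fm ml cG GE.
have rE : restrict_level m (upd F G) = restrict_level m F.
  apply: functional_extensionality_dep => j; rewrite /restrict_level /upd dfwithout //.
  by rewrite eq_sym neq_ltn ltn_ord.
apply/in_levelS; split; first by rewrite /in_level rE.
  by rewrite /upd dfwithin.
by rewrite rE /upd dfwithin; apply: funext => y /=; rewrite GE.
Qed.

(** The level-by-level construction. On the gluing subspace of the next level the
values are forced to be block sums of those already constructed, so they satisfy
[Q]; a Tietze extension [G0] of them is then corrected to a solution [G] of [Q] on
the whole space by the last hypothesis. *)
Lemma in_level_ext (Q : forall i, X i -> 'M[C]_(n i) -> Prop) m0 F0 :
  (m0 <= l)%N -> in_level m0 F0 ->
  (forall i, (i <= m0)%N -> forall x, Q i x (F0 i x)) ->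
  (forall i (y : X i.+1), (i < l)%N -> Y i.+1 y ->
     forall t i_ x_ iota, @decomp i y t i_ x_ iota -> forall M Mk,
     (forall k, Q (i_ k) (x_ k) (Mk k)) -> block_diag iota M Mk -> Q i.+1 y M) ->
  (forall i, (m0 < i <= l)%N -> forall G0 : X i -> 'M[C]_(n i), continuous G0 ->
     (forall y, Y i y -> Q i y (G0 y)) ->
     exists G : X i -> 'M[C]_(n i), [/\ continuous G,
       forall y, Y i y -> G y = G0 y & forall x, Q i x (G x)]) ->
  exists F, [/\ in_level l F, forall i, (i <= m0)%N -> F i = F0 i
    & forall i, (i <= l)%N -> forall x, Q i x (F i x)].
Proof.
move=> m0l F0in QF0 natQ step.
suff h m : (m0 <= m <= l)%N -> exists F, [/\ in_level m F, forall i, (i <= m0)%N -> F i = F0 i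
    & forall i, (i <= m)%N -> forall x, Q i x (F i x)].
  by apply: h; rewrite m0l leqnn.
elim: m => [|m IH] /andP[m0m ml].
  by exists F0; move: m0m; rewrite leqn0 => /eqP <-.
have [->|ne] := eqVneq m.+1 m0; first by exists F0.
have m0m' : (m0 < m.+1)%N by rewrite ltn_neqAle eq_sym ne.
have [|F [Fin FF0 QF]] := IH; first by rewrite -ltnS m0m' ltnW.
have cl := dsh_sub_closed ml.
have [G0 [cG0 G0E]] := tietze_mx (dsh_compact ml) (dsh_hausdorff ml) cl
  (dsh_psi_continuous ml Fin).
have QG0 y : Y m.+1 y -> Q m.+1 y (G0 y).
  move=> Yy; pose y' : Y m.+1 := exist _ y (mem_set Yy).
  have [t [i_ [x_ [iota [dec h]]]]] := psi_decomp y' ml.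
  have := h _ Fin; rewrite -G0E => bd.
  apply: (natQ m y ml Yy _ _ _ _ dec _ _ _ bd) => k; apply: QF.
  by rewrite -ltnS ltn_ord.
have [|G [cG GE QG]] := step m.+1 _ G0 cG0 QG0; first by rewrite m0m' ml.
exists (upd F G); split.
- apply: in_level_upd => // y; rewrite -G0E; apply: GE.
  exact: (set_mem (valP y)).
- move=> i im0; rewrite /upd dfwithout ?FF0 // neq_ltn.
  by rewrite (leq_ltn_trans im0 m0m') orbT.
move=> i; rewrite leq_eqVlt => /orP[/eqP -> x|]; first by rewrite /upd dfwithin.
rewrite ltnS => im x; rewrite /upd dfwithout; first exact: QF.
by rewrite neq_ltn ltnS im orbT.
Qed.

End Levels.
Arguments nat_family {R D} f j _.
Arguments restrict_level {R D} m F j _.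

(** * Elements from natural constructions *)

Section NaturalConstructions.
Variable R : realType.
Local Notation C := R[i].

Definition tuple_block_diag I N t (n : 'I_t -> nat) (iota : forall k, 'I_(n k) -> 'I_N)
  (M : I -> 'M[C]_N) (Mk : forall k, I -> 'M[C]_(n k)) :=
  layout iota /\ forall a, block_diag iota (M a) (fun k => Mk k a).

Variable D : dsh_algebra R.
Local Notation l := (dsh_last D).
Local Notation X := (dsh_space D).
Local Notation Y i := (@dsh_sub R D i).
Local Notation n := (@dsh_size R D).
Local Notation fam := (dsh_family D).
Local Notation carrier := (@dsh_carrier R D).

Lemma carrier_in_level f : carrier f -> in_level l (nat_family f).
Proof. by rewrite /in_level restrict_level_nat_family. Qed.

Lemma carrier_continuous f (i : 'I_l.+1) : carrier f -> continuous (f i).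
Proof.
move=> /carrier_in_level fA; rewrite -nat_familyE; apply: in_level_continuous fA.
by rewrite -ltnS ltn_ord.
Qed.

Lemma carrier_decomp (i : 'I_l.+1) y : Y i y ->
  exists t (i_ : 'I_t -> 'I_l.+1) (x_ : forall k, X (i_ k))
    (iota : forall k, 'I_(n (i_ k)) -> 'I_(n i)),
  [/\ forall k, (i_ k < i)%N, layout iota
    & forall f, carrier f -> block_diag iota (f i y) (fun k => f (i_ k) (x_ k))].
Proof.
case: i y => -[|m] ml y Yy; first by rewrite dsh_sub0 in Yy.
have [t [i_ [x_ [iota [dec _]]]]] := psi_decomp (exist _ y (mem_set Yy)) ml.
exists t, (fun k => widen_ord (ltnW ml) (i_ k)), x_, iota; split.
- by move=> k /=; exact: ltn_ord.
- exact: dec.1.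
move=> f /carrier_in_level fA; have := dec.2 _ (in_level_le (ml : (m.+1 <= l)%N) fA).
rewrite (nat_familyE f (Ordinal ml)); congr block_diag.
apply: functional_extensionality_dep => k.
exact: (congr1 (fun h => h (x_ k)) (nat_familyE f (widen_ord (ltnW ml) (i_ k)))).
Qed.

Lemma nat_family_decomp I (g : I -> fam) : (forall a, carrier (g a)) ->
  forall i (y : X i.+1), (i < l)%N ->
  forall t i_ x_ iota, @decomp R D i y t i_ x_ iota ->
  tuple_block_diag iota (fun a => nat_family (g a) i.+1 y)
    (fun k a => nat_family (g a) (i_ k) (x_ k)).
Proof.
move=> gc i y il t i_ x_ iota [L h]; split=> // a; apply: h.
exact: in_level_le il (carrier_in_level (gc a)).
Qed.

(** A construction [Omega] on tuples of matrices that commutes with block sums maps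
tuples of elements to elements. The side condition [P] allows for constructions,
such as inversion, that behave well only on part of the tuples. *)
Lemma carrier_nat I (g : I -> fam) (P : forall N, (I -> 'M[C]_N) -> Prop)
    (Omega : forall N, (I -> 'M[C]_N) -> 'M[C]_N) (h : fam) :
  (forall a, carrier (g a)) ->
  (forall (i : 'I_l.+1) x, P _ (fun a => g a i x)) ->
  (forall N t (n : 'I_t -> nat) (iota : forall k, 'I_(n k) -> 'I_N) M Mk,
    tuple_block_diag iota M Mk -> P N M -> (forall k, P (n k) (Mk k)) ->
    block_diag iota (Omega N M) (fun k => Omega (n k) (Mk k))) ->
  (forall i x, h i x = Omega _ (fun a => g a i x)) ->
  (forall i, continuous (h i)) ->
  carrier h.
Proof.
move=> gc Pg nat hE ch; rewrite -[h]restrict_level_nat_family; apply: in_level_intro => //.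
  move=> i il; rewrite (nat_familyE h (Ordinal (il : (i < l.+1)%N))); exact: (ch (Ordinal (il : (i < l.+1)%N))).
have E i (il : (i < l.+1)%N) x :
    nat_family h i x = Omega _ (fun a => nat_family (g a) i x).
  rewrite (nat_familyE h (Ordinal il)) hE; congr Omega.
  by apply: funext => a; rewrite (nat_familyE (g a) (Ordinal il)).
have P' i (il : (i < l.+1)%N) x : P _ (fun a => nat_family (g a) i x).
  have -> : (fun a => nat_family (g a) i x) = (fun a => g a (Ordinal il) x).
    by apply: funext => a; rewrite (nat_familyE (g a) (Ordinal il)).
  exact: (Pg (Ordinal il) x).
move=> i y il Yy t i_ x_ iota dec.
have lt k : (i_ k < l.+1)%N by apply: leq_trans (ltn_ord _) (leqW il).
rewrite E //.
have -> : (fun k => nat_family h (i_ k) (x_ k)) =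
    (fun k => Omega _ (fun a => nat_family (g a) (i_ k) (x_ k))).
  by apply: functional_extensionality_dep => k; rewrite E.
apply: nat; first exact: nat_family_decomp.
  exact: P'.
by move=> k; exact: P'.
Qed.

Section Extension.
Variables (I : Type) (g : I -> fam).
Arguments g : clear implicits.
Variable P : forall N, (I -> 'M[C]_N) -> Prop.
Variable Q : forall N, (I -> 'M[C]_N) -> 'M[C]_N -> Prop.

(** The relation passes from blocks to block sums: the part of solvability that
concerns the gluing subspaces. *)
Definition natural_rel :=
  forall N t (n : 'I_t -> nat) (iota : forall k, 'I_(n k) -> 'I_N) M Mk H Hk,
    tuple_block_diag iota M Mk -> block_diag iota H Hk ->
    (forall k, Q (Mk k) (Hk k)) -> Q M H.

(** A continuous [G0] that solves the relation on the closed subspace [Z] only can be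
corrected off [Z] to a solution everywhere. *)
Definition extendable_rel :=
  forall (T : topologicalType) (Z : set T), compact [set: T] -> hausdorff_space T ->
    closed Z -> forall N (G : I -> T -> 'M[C]_N) (G0 : T -> 'M[C]_N),
    (forall a, continuous (G a)) -> (forall x, P (G^~ x)) ->
    continuous G0 -> (forall y, Z y -> Q (G^~ y) (G0 y)) ->
    exists G' : T -> 'M[C]_N, [/\ continuous G', forall y, Z y -> G' y = G0 y
      & forall x, Q (G^~ x) (G' x)].

Hypothesis gc : forall a, carrier (g a).
Hypothesis Pg : forall (i : 'I_l.+1) x, P (fun a => g a i x).
Hypothesis natQ : natural_rel.
Hypothesis extQ : extendable_rel.

Let g' := fun i x (a : I) => nat_family (g a) i x.

Arguments g' : clear implicits.

Let g'E (i : 'I_l.+1) x : g' i x = (fun a => g a i x).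
Proof. by apply: funext => a; rewrite /g' nat_familyE. Qed.

Arguments g'E : clear implicits.

Let step i : (i <= l)%N -> forall G0 : X i -> 'M[C]_(n i), continuous G0 ->
     (forall y, Y i y -> Q (g' i y) (G0 y)) ->
     exists G : X i -> 'M[C]_(n i), [/\ continuous G,
       forall y, Y i y -> G y = G0 y & forall x, Q (g' i x) (G x)].
Proof.
move=> il G0 cG0 QG0.
have cg a : continuous (nat_family (g a) i).
  exact: in_level_continuous il (carrier_in_level (gc a)).
have Pi x : P (fun a => nat_family (g a) i x).
  have := g'E (Ordinal (il : i < l.+1)%N) x; rewrite /g' => ->.
  exact: (Pg (i := Ordinal (il : i < l.+1)%N)).
exact: (@extQ (X i) (Y i) (dsh_compact il) (dsh_hausdorff il) (dsh_sub_closed il)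
  _ (fun a => nat_family (g a) i) G0 cg Pi cG0 QG0).
Qed.

Let finish m0 F0 : (m0 <= l)%N -> in_level m0 F0 ->
  (forall i, (i <= m0)%N -> forall x, Q (g' i x) (F0 i x)) ->
  exists f, [/\ carrier f, forall i : 'I_l.+1, (i <= m0)%N -> f i = F0 i
    & forall i x, Q (fun a => g a i x) (f i x)].
Proof.
move=> m0l F0A QF0.
have [||F [Fin FE QF]] := @in_level_ext R D (fun i x M => Q (g' i x) M) m0 F0 m0l F0A QF0.
- move=> i y il Yy t i_ x_ iota dec M Mk Qk bd.
  exact: natQ (nat_family_decomp gc il dec) bd Qk.
- by move=> i /andP[_ il]; exact: step.
exists (restrict_level l F); split=> //; first by move=> i im0; rewrite /restrict_level FE.
by move=> i x; rewrite -g'E; apply: QF; rewrite -ltnS ltn_ord.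
Qed.

Lemma carrier_ext : exists f, carrier f /\ forall i x, Q (fun a => g a i x) (f i x).
Proof.
have [||G [cG _ QG]] := @step 0 (leq0n _) (fun=> 0).
- by move=> x; exact: cvg_cst.
- by move=> y; rewrite dsh_sub0.
have [||f [fc _ Qf]] := @finish 0 (upd (fun=> fun=> 0) G) (leq0n _); last by exists f.
  by rewrite /in_level /= /restrict_level /upd dfwithin.
by move=> i; rewrite leqn0 => /eqP -> x; rewrite /upd dfwithin.
Qed.

(** A solution with a prescribed summand [b] at the index [i0]. As [b] vanishes on the
gluing subspace, [0] on the lower levels together with [b] is an element of level
[i0], and it is extended to the higher levels only. *)
Lemma carrier_ext_bump (i0 : 'I_l.+1) (b : X i0 -> 'M[C]_(n i0)) :
  (forall N M, @Q N M 0) -> continuous b -> (forall y, Y i0 y -> b y = 0) ->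
  (forall x, Q (fun a => g a i0 x) (b x)) ->
  exists f, [/\ carrier f, f i0 = b & forall i x, Q (fun a => g a i x) (f i x)].
Proof.
move=> Q0 cb bY Qb; have i0l : (i0 <= l)%N by rewrite -ltnS ltn_ord.
pose F0 : nfamily D := upd (fun=> fun=> 0) b.
have F0i0 : F0 i0 = b by rewrite /F0 /upd dfwithin.
have F0ne (i : nat) : i <> i0 -> F0 i = fun=> 0.
  by move=> /eqP ne; rewrite /F0 /upd dfwithout // eq_sym.
have F0A : in_level i0 F0.
  apply: in_level_intro => //.
    move=> i ii0; have [->|/eqP ne] := eqVneq i i0; first by rewrite F0i0.
    by rewrite (F0ne _ ne) => x; exact: cvg_cst.
  move=> i y ii0 Yy t i_ x_ iota dec.
  have -> : F0 i.+1 y = 0.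
    have [e|/eqP ne] := eqVneq i.+1 i0; last by rewrite (F0ne _ ne).
    suff : forall z : X i.+1, Y i.+1 z -> F0 i.+1 z = 0 by exact.
    by rewrite e => z Yz; rewrite F0i0 bY.
  have -> : (fun k => F0 (i_ k) (x_ k)) = (fun k => 0).
    apply: functional_extensionality_dep => k; rewrite F0ne // => e.
    by have := ltn_ord (i_ k); rewrite e ltnNge ii0.
  exact: block_diag0.
have F0Q i : (i <= i0)%N -> forall x, Q (g' i x) (F0 i x).
  move=> ii0 x; have [e|/eqP ne] := eqVneq i i0; last by rewrite (F0ne _ ne).
  by case: _ / (esym e) x => x; rewrite F0i0 g'E.
have [f [fc fE Qf]] := finish i0l F0A F0Q.
by exists f; split=> //; rewrite fE.
Qed.

End Extension.
End NaturalConstructions.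

(** * Algebra operations and bounds *)

Lemma normc_ge0 (R : realType) (z : R[i]) : 0 <= normc z.
Proof. by case: z => a b; exact: sqrtr_ge0. Qed.

Section CarrierAlgebra.
Variable R : realType.
Local Notation C := R[i].
Variable D : dsh_algebra R.
Local Notation l := (dsh_last D).
Local Notation X := (dsh_space D).
Local Notation n := (@dsh_size R D).
Local Notation fam := (dsh_family D).
Local Notation carrier := (@dsh_carrier R D).
Implicit Types f g : fam.

Let T (N : nat) (M : unit -> 'M[C]_N) := True.
Let T2 (N : nat) (M : bool -> 'M[C]_N) := True.

Lemma carrierD f g : carrier f -> carrier g -> carrier (f + g).
Proof.
move=> fc gc; apply: (@carrier_nat R D bool (fun b => if b then f else g) T2
  (fun N M => M true + M false)) => //.
- by case.
- by move=> N t m iota M Mk [L bd] _ _; exact: (block_diagD (bd true) (bd false)).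
by move=> i; apply: continuous_addmx; exact: carrier_continuous.
Qed.

Lemma carrierM f g : carrier f -> carrier g -> carrier (f * g).
Proof.
move=> fc gc; apply: (@carrier_nat R D bool (fun b => if b then f else g) T2
  (fun N M => M true *m M false)) => //.
- by case.
- by move=> N t m iota M Mk [L bd] _ _; exact: (block_diagM L (bd true) (bd false)).
by move=> i; apply: continuous_mulmx; exact: carrier_continuous.
Qed.

Lemma carrierZ (a : C) f : carrier f -> carrier (a *: f).
Proof.
move=> fc; apply: (@carrier_nat R D unit (fun=> f) T (fun N M => a *: M tt)) => //.
- by move=> N t m iota M Mk [L bd] _ _; exact: (block_diagZ a (bd tt)).
move=> i; apply: continuous_scalemx; first exact: continuousC_cst.
exact: carrier_continuous.
Qed.

Lemma carrier_star f : carrier f -> carrier (star f).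
Proof.
move=> fc; apply: (@carrier_nat R D unit (fun=> f) T (fun N M => star (M tt))) => //.
- by move=> N t m iota M Mk [L bd] _ _; exact: (block_diag_star (bd tt)).
by move=> i; apply: continuous_mxstar; exact: carrier_continuous.
Qed.

Lemma carrier0 : carrier 0.
Proof.
apply: (@carrier_nat R D void (fun v => match v with end) (fun _ _ => True)
  (fun N M => 0)) => //.
- by move=> N t m iota M Mk [L bd] _ _; exact: block_diag0.
by move=> i x; exact: cvg_cst.
Qed.

Lemma carrier1 : carrier 1.
Proof.
apply: (@carrier_nat R D void (fun v => match v with end) (fun _ _ => True)
  (fun N M => 1%:M)) => //.
- by move=> N t m iota M Mk [L bd] _ _; exact: block_diag1.
by move=> i x; exact: cvg_cst.
Qed.

Lemma carrierN f : carrier f -> carrier (- f).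
Proof. by move=> fc; rewrite -scaleN1r; exact: carrierZ. Qed.

Lemma carrierB f g : carrier f -> carrier g -> carrier (f - g).
Proof. by move=> fc gc; apply: carrierD => //; exact: carrierN. Qed.

(** Inversion commutes with block sums, so a pointwise inverse stays in the algebra. *)
Lemma carrier_inv f : carrier f -> (forall i x, f i x \in unitmx) ->
  exists g, [/\ carrier g, f * g = 1 & g * f = 1].
Proof.
move=> fc uf; exists (fun i x => invmx (f i x)); split.
- apply: (@carrier_nat R D unit (fun=> f) (fun N M => M tt \in unitmx)
    (fun N M => invmx (M tt))) => //.
  + by move=> N t m iota M Mk [L bd] _ uk; exact: (block_diag_inv L (bd tt) uk).2.
  by move=> i; apply: continuous_invmx => // x; exact: carrier_continuous.
- apply: functional_extensionality_dep => i; apply: funext => x.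
  exact: mulmxV.
- apply: functional_extensionality_dep => i; apply: funext => x.
  exact: mulVmx.
Qed.

Lemma carrier_entrywise I (g : I -> fam) (phi : (I -> C) -> C) :
  (forall a, carrier (g a)) -> phi (fun=> 0) = 0 ->
  (forall (Z : topologicalType) (F : I -> Z -> C), (forall a, continuous (F a)) ->
     continuous (fun z => phi (F^~ z))) ->
  carrier (fun i x => \matrix_(p, q) phi (fun a => g a i x p q)).
Proof.
move=> gc phi0 cphi.
apply: (@carrier_nat R D I g (fun _ _ => True)
  (fun N M => \matrix_(p, q) phi (fun a => M a p q))) => //.
  move=> N t m iota M Mk [L bd] _ _; split=> [k a b|k k' a b ne]; rewrite !mxE.
    by congr phi; apply: funext => c; have [-> _] := bd c.
  rewrite -phi0; congr phi; apply: funext => c; have [_ h] := bd c.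
  exact: h.
move=> i; apply: mx_continuous => p q; under eq_fun do rewrite mxE.
by apply: cphi => a; apply: continuous_mxE; exact: carrier_continuous.
Qed.

Lemma continuous_bounded (Z : topologicalType) (f : Z -> R) :
  compact [set: Z] -> continuous f -> exists M, forall z, f z <= M.
Proof.
move=> cZ cf; have [[z _]|Z0] := pselect ([set: Z] !=set0).
  have [|||c _ hc] := @compact_EVT_max Z R f setT => //.
  - by exists z.
  - exact: continuous_subspaceT.
  by exists (f c) => y; apply: hc; rewrite inE.
by exists 0 => z; exfalso; apply: Z0; exists z.
Qed.

Lemma size_bounded : exists B, forall i : 'I_l.+1, (n i <= B)%N.
Proof.
exists (\max_(i < l.+1) n i)%N => i; exact: (leq_bigmax i).
Qed.

Lemma carrier_bounded f : carrier f ->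
  exists M, forall i x p q, normc (f i x p q) <= M.
Proof.
move=> fc.
have h (i : 'I_l.+1) : exists M, forall x p q, normc (f i x p q) <= M.
  have ci : compact [set: X i] by apply: dsh_compact; rewrite -ltnS ltn_ord.
  have cf : continuous (fun x => \sum_(p < n i) \sum_(q < n i) normc (f i x p q)).
    apply: continuousR_sum => p; apply: continuousR_sum => q.
    by apply: continuous_normc; apply: continuous_mxE; exact: carrier_continuous.
  have [M hM] := continuous_bounded ci cf.
  exists M => x p q; apply: le_trans (hM x).
  rewrite (bigD1 p) //= (bigD1 q) //= -addrA lerDl addr_ge0 //.
    by apply: sumr_ge0 => *; exact: normc_ge0.
  by apply: sumr_ge0 => *; apply: sumr_ge0 => *; exact: normc_ge0.
exists (\sum_(i < l.+1) `|projT1 (cid (h i))|) => i x p q.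
apply: le_trans (projT2 (cid (h i)) x p q) _.
apply: le_trans (ler_norm _) _.
by rewrite (bigD1 i) //= lerDl; apply: sumr_ge0.
Qed.

End CarrierAlgebra.

(** * Operator norms *)

Section OpNorm.
Variable R : realType.
Local Notation C := R[i].

Lemma l2norm_ge0 N (v : 'cV[C]_N) : 0 <= l2norm v.
Proof. exact: sqrtr_ge0. Qed.

Lemma l2norm_sqr N (v : 'cV[C]_N) : l2norm v ^+ 2 = \sum_i normc (v i 0) ^+ 2.
Proof. by rewrite sqr_sqrtr //; apply: sumr_ge0 => i _; exact: sqr_ge0. Qed.

Lemma l2norm_le N N' (v : 'cV[C]_N) (w : 'cV[C]_N') K : 0 <= K ->
  \sum_i normc (v i 0) ^+ 2 <= K ^+ 2 * \sum_i normc (w i 0) ^+ 2 ->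
  l2norm v <= K * l2norm w.
Proof.
move=> K0 h; rewrite -(ler_pXn2r (n := 2)) // ?nnegrE ?l2norm_ge0 //; last first.
  by rewrite mulr_ge0 // l2norm_ge0.
by rewrite exprMn !l2norm_sqr.
Qed.

(** A bound on the operator norm as a family of inequalities: unlike a supremum it
passes from blocks to block sums without any computation. *)
Definition opbound (K : R) N (M : 'M[C]_N) := forall v, l2norm (M *m v) <= K * l2norm v.

Lemma normc_sum I (r : seq I) (F : I -> C) :
  normc (\sum_(i <- r) F i) <= \sum_(i <- r) normc (F i).
Proof.
elim: r => [|i r IH]; first by rewrite !big_nil normc0.
by rewrite !big_cons; apply: le_trans (le_normcD _ _) _; rewrite lerD2l.
Qed.

Lemma opbound_entries (eta : R) N B (M : 'M[C]_N) : 0 <= eta -> (N <= B)%N ->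
  (forall p q, normc (M p q) <= eta) -> opbound (B%:R ^+ 2 * eta) M.
Proof.
move=> eta0 NB hM v; apply: (@le_trans _ _ (N%:R ^+ 2 * eta * l2norm v)); last first.
  rewrite ler_wpM2r ?l2norm_ge0 // ler_wpM2r //.
  by rewrite lerXn2r ?nnegrE ?ler0n // ler_nat.
apply: l2norm_le; first by rewrite mulr_ge0 // sqr_ge0.
rewrite -(l2norm_sqr v).
have h p : normc ((M *m v) p 0) <= N%:R * eta * l2norm v.
  rewrite mxE; apply: le_trans (normc_sum _ _) _.
  apply: (@le_trans _ _ (\sum_(q < N) eta * l2norm v)).
    apply: ler_sum => q _; rewrite normcM; apply: ler_pM => //; try exact: normc_ge0.
    rewrite -(ler_pXn2r (n := 2)) // ?nnegrE ?l2norm_ge0 ?normc_ge0 // l2norm_sqr.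
    by rewrite (bigD1 q) //= lerDl; apply: sumr_ge0 => i _; exact: sqr_ge0.
  by rewrite sumr_const card_ord -mulrA mulr_natl.
apply: (@le_trans _ _ (\sum_(p < N) (N%:R * eta * l2norm v) ^+ 2)).
  apply: ler_sum => p _; rewrite lerXn2r ?nnegrE ?normc_ge0 //.
  by rewrite !mulr_ge0 // ?ler0n // l2norm_ge0.
rewrite sumr_const card_ord -[leLHS]mulr_natl.
case: N M v h hM NB => [|N] M v h hM NB.
  by rewrite mul0r !expr2; rewrite !mul0r.
have -> : (N.+1%:R ^+ 2 * eta) ^+ 2 * l2norm v ^+ 2 = N.+1%:R ^+ 2 * (N.+1%:R * eta * l2norm v) ^+ 2.
  by ring.
rewrite ler_wpM2r ?sqr_ge0 //.
by rewrite -natrX ler_nat expnS leq_pmulr.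
Qed.

Lemma layout_sum_all N t (n : 'I_t -> nat) (iota : forall k, 'I_(n k) -> 'I_N)
    (F : 'I_N -> R) : layout iota ->
  \sum_p F p = \sum_k \sum_a F (iota k a).
Proof.
move=> L; have [_ cov inj] := L.
have E k : \sum_a F (iota k a) =
    \sum_p (if p \in (iota k @: 'I_(n k))%SET then F p else 0).
  rewrite -big_mkcond /= big_imset //= => a b _ _.
  exact: (layout_inj L).
under [RHS]eq_bigr => k _ do rewrite E.
rewrite exchange_big /=; apply: eq_bigr => p _.
have [k [a ->]] := cov p; rewrite (bigD1 k) //= imset_f // big1 ?addr0 // => k' nk.
case: ifP => // /imsetP[b _ /inj e]; by rewrite e eqxx in nk.
Qed.

(** The property passes from blocks to block sums. Positive sizes are assumed because
being nonzero does not pass to empty matrices. *)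
Definition natural_pred I (P : forall N, (I -> 'M[C]_N) -> Prop) :=
  forall N t (n : 'I_t -> nat) (iota : forall k, 'I_(n k) -> 'I_N) M Mk,
    (0 < N)%N -> (forall k, 0 < n k)%N -> tuple_block_diag iota M Mk ->
    (forall k, P (n k) (Mk k)) -> P N M.

Lemma opbound_natural K : 0 <= K ->
  @natural_pred unit (fun N M => opbound K (M tt)).
Proof.
move=> K0 N t n iota M Mk _ _ [L /(_ tt) bd] hk v; apply: l2norm_le => //.
rewrite (layout_sum_all _ L) (layout_sum_all (fun p => _ ^+ 2) L) mulr_sumr.
apply: ler_sum => k _.
have -> : \sum_a normc ((M tt *m v) (iota k a) 0) ^+ 2
  = \sum_a normc ((Mk k tt *m block_col iota v k) a 0) ^+ 2.
  by apply: eq_bigr => a _; rewrite (block_diag_col L v a bd).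
have -> : \sum_a normc (v (iota k a) 0) ^+ 2 = \sum_a normc (block_col iota v k a 0) ^+ 2.
  by apply: eq_bigr => a _; rewrite mxE.
rewrite -!l2norm_sqr -exprMn lerXn2r ?nnegrE ?l2norm_ge0 //.
  by rewrite mulr_ge0 // l2norm_ge0.
exact: hk.
Qed.

Lemma opnorm_le K N (M : 'M[C]_N) : 0 <= K -> opbound K M -> opnorm M <= K.
Proof.
move=> K0 hM; apply: ge_sup.
  exists (l2norm (M *m 0)); exists 0 => //=.
  rewrite /l2norm big1 ?sqrtr0 // => i _; by rewrite mxE normc0 expr0n.
move=> _ [v /= v1 <-]; apply: le_trans (hM v) _.
by rewrite -[leRHS]mulr1 ler_wpM2l.
Qed.

Lemma opnorm_ge K N (M : 'M[C]_N) v : 0 <= K -> opbound K M -> l2norm v <= 1 ->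
  l2norm (M *m v) <= opnorm M.
Proof.
move=> K0 hM v1; apply: ub_le_sup; last by exists v.
exists K => _ [w /= w1 <-]; apply: le_trans (hM w) _.
by rewrite -[leRHS]mulr1 ler_wpM2l.
Qed.

Lemma mxfamily_norm_le (D : dsh_algebra R) (f : dsh_family D) K : 0 <= K ->
  (forall i x, opbound K (f i x)) -> mxfamily_norm f <= K.
Proof.
move=> K0 hf; rewrite /mxfamily_norm; set S := [set _ | _].
have [S0|Sn0] := pselect (S !=set0).
  by apply: ge_sup => // _ [j [x ->]]; exact: opnorm_le.
by rewrite sup_out // => -[].
Qed.

Lemma mxfamily_norm_ge (D : dsh_algebra R) (f : dsh_family D) i x v : dsh_carrier f ->
  l2norm v <= 1 -> l2norm (f i x *m v) <= mxfamily_norm f.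
Proof.
move=> fc v1; have [M hM] := carrier_bounded fc; have [B hB] := size_bounded D.
have h j y : opbound (B%:R ^+ 2 * `|M|) (f j y).
  apply: opbound_entries => // p q; apply: le_trans (hM _ _ _ _) (ler_norm _).
have K0 : 0 <= B%:R ^+ 2 * `|M| by rewrite mulr_ge0 // sqr_ge0.
apply: le_trans (opnorm_ge K0 (h i x) v1) _.
apply: ub_le_sup; last by exists i, x.
by exists (B%:R ^+ 2 * `|M|) => _ [j [y ->]]; exact: opnorm_le.
Qed.

End OpNorm.

(** * Pointwise properties along diagonal maps *)

Section Transfer.
Variable R : realType.
Local Notation C := R[i].

(** What is used of a diagonal homomorphism. In contrast to diagonality itself, this
is visibly closed under composition, since no lists of points are mentioned. *)
Definition transfers (D D' : dsh_algebra R) (Phi : dsh_family D -> dsh_family D') :=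
  [/\ forall f, dsh_carrier f -> dsh_carrier (Phi f),
      ring_hom_on (@dsh_carrier R D) Phi,
      scalable_on (@dsh_carrier R D) Phi
    & forall I (g : I -> dsh_family D) P, (forall a, dsh_carrier (g a)) ->
      natural_pred P -> (forall i x, P _ (fun a => g a i x)) ->
      forall i x, P _ (fun a => Phi (g a) i x)].

Lemma diagonal_hom_transfers D D' (Phi : dsh_family D -> dsh_family D') :
  diagonal_hom Phi -> transfers Phi.
Proof.
move=> [h1 h2 h3 _ h4]; split=> // I g P gc nP Pg i x.
have [t [i_ [x_ [e h]]]] := h4 i x.
have [iota [L bd]] := mxdiag_layout R e.
apply: (nP _ _ _ iota _ (fun k a => g a (i_ k) (x_ k))).
- by apply: dsh_size_gt0; rewrite -ltnS.
- by move=> k; apply: dsh_size_gt0; rewrite -ltnS.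
- by split=> // a; rewrite h //; exact: gc.
- by move=> k; exact: Pg.
Qed.

Lemma transfers_id D : transfers (@id (dsh_family D)).
Proof. by []. Qed.

Lemma transfers_comp D D' D'' (Phi : dsh_family D -> dsh_family D')
    (Psi : dsh_family D' -> dsh_family D'') :
  transfers Phi -> transfers Psi -> transfers (Psi \o Phi).
Proof.
move=> [a1 [a2 a2'] a3 a4] [b1 [b2 b2'] b3 b4].
have mm f : f \in @dsh_carrier R D -> Phi f \in @dsh_carrier R D'.
  by move=> /set_mem/a1/mem_set.
split.
- by move=> f /a1 /b1.
- by split=> f g fc gc /=; rewrite ?a2 ?b2 ?a2' ?b2' ?mm.
- by move=> a f fc /=; rewrite a3 // b3 // mm.
move=> I g P gc nP Pg i x /=.
apply: (b4 I (fun a => Phi (g a))) => //; first by move=> a; exact: a1.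
exact: a4.
Qed.

Section TransferFacts.
Variables (D D' : dsh_algebra R) (Phi : dsh_family D -> dsh_family D').
Arguments Phi : clear implicits.
Hypothesis tP : transfers Phi.

Lemma transfer_carrier f : dsh_carrier f -> dsh_carrier (Phi f).
Proof. by case: tP => h _ _ _; exact: h. Qed.

Lemma transferD f g : dsh_carrier f -> dsh_carrier g -> Phi (f + g) = Phi f + Phi g.
Proof. by case: tP => _ [h _] _ _ fc gc; apply: h; rewrite inE. Qed.

Lemma transferZ (a : C) f : dsh_carrier f -> Phi (a *: f) = a *: Phi f.
Proof. by case: tP => _ _ h _ fc; apply: h; rewrite inE. Qed.

Lemma transferN f : dsh_carrier f -> Phi (- f) = - Phi f.
Proof. by move=> fc; rewrite -scaleN1r transferZ // scaleN1r. Qed.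

Lemma transfer_pred I (g : I -> dsh_family D) P : (forall a, dsh_carrier (g a)) ->
  natural_pred P -> (forall i x, P _ (fun a => g a i x)) ->
  forall i x, P _ (fun a => Phi (g a) i x).
Proof. by case: tP => _ _ _; exact. Qed.

Lemma transfer1 : Phi 1 = 1.
Proof.
apply: functional_extensionality_dep => i; apply: funext => x.
apply: (@transfer_pred unit (fun=> 1) (fun N M => M tt = 1%:M)) => //.
  by move=> a; exact: carrier1.
move=> N t n iota M Mk _ _ [L bd] hk; apply: (block_diag_uniq L (bd tt)).
have := block_diag1 R L; congr block_diag.
by apply: functional_extensionality_dep => k; rewrite hk.
Qed.

End TransferFacts.
End Transfer.

(** * Limits of invertible elements *)

Section CStarFacts.
Variables (R : realType) (A : cstarAlgType R).
Implicit Types a b : A.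

Lemma cnorm0 : cnorm (0 : A) = 0.
Proof. by rewrite -(scale0r (0 : A)) cnormZ normc0 mul0r. Qed.

Lemma cnormN a : cnorm (- a) = cnorm a.
Proof. by rewrite -scaleN1r cnormZ normcN normc1 mul1r. Qed.

Lemma cnorm_ge0 a : 0 <= cnorm a.
Proof.
have : 0 <= cnorm a + cnorm a.
  by rewrite -{2}(cnormN a) -cnorm0 -(subrr a); exact: cnormD.
by lra.
Qed.

Lemma cnormB a b : cnorm (a - b) <= cnorm a + cnorm b.
Proof. by rewrite -(cnormN b); exact: cnormD. Qed.

Lemma cnorm_dist a b c : cnorm (a - c) <= cnorm (a - b) + cnorm (b - c).
Proof. by rewrite -[a - c](subrKA b); exact: cnormD. Qed.

Lemma invertibleM a b : invertible a -> invertible b -> invertible (a * b).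
Proof.
move=> [a' [h1 h2]] [b' [h3 h4]]; exists (b' * a'); split.
  by rewrite mulrA -(mulrA a) h3 mulr1.
by rewrite mulrA -(mulrA b') h2 mulr1.
Qed.

Definition near_invertible a := forall e : R, 0 < e ->
  exists2 b, invertible b & cnorm (a - b) < e.

Lemma near_invertible_closed a :
  (forall e : R, 0 < e -> exists2 b, near_invertible b & cnorm (a - b) < e) ->
  near_invertible a.
Proof.
move=> h e e0; have e2 : 0 < e / 2 by rewrite divr_gt0.
have [b nb ab] := h _ e2; have [c ic bc] := nb _ e2.
exists c => //; apply: le_lt_trans (cnorm_dist _ b _) _.
by rewrite (splitr e) ltrD.
Qed.

(** Undoing the multiplications by [u] and [v] multiplies distances at most by the
product of the norms of the inverses. *)
Lemma near_invertibleM u a v : invertible u -> invertible v ->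
  near_invertible (u * a * v) -> near_invertible a.
Proof.
move=> [u' [uu' u'u]] [v' [vv' v'v]] h e e0.
pose K := cnorm u' * cnorm v' + 1.
have K0 : 0 < K by rewrite ltr_wpDl // mulr_ge0 // cnorm_ge0.
have [|b ib hb] := h (e / K); first by rewrite divr_gt0.
exists (u' * b * v').
  by apply: invertibleM; [apply: invertibleM => //|]; [exists u|exists v].
have -> : a - u' * b * v' = u' * (u * a * v - b) * v'.
  rewrite mulrBr mulrBl; congr (_ - _).
  by rewrite !mulrA u'u mul1r -mulrA vv' mulr1.
apply: le_lt_trans (cnormM _ _) _.
apply: (@le_lt_trans _ _ (cnorm u' * cnorm (u * a * v - b) * cnorm v')).
  by rewrite ler_wpM2r ?cnorm_ge0 // cnormM.
apply: (@le_lt_trans _ _ (K * cnorm (u * a * v - b))).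
  rewrite mulrAC ler_wpM2r ?cnorm_ge0 // /K lerDl //.
by rewrite mulrC -ltr_pdivlMr.
Qed.

End CStarFacts.

(** * The maps into the inductive limit *)

Section Limit.
Variable R : realType.
Local Notation C := R[i].
Variable D : nat -> dsh_algebra R.
Variable phi : forall j, dsh_family (D j) -> dsh_family (D j.+1).
Arguments phi : clear implicits.
Variables (A : cstarAlgType R) (mu : forall j, dsh_family (D j) -> A).
Arguments mu : clear implicits.
Hypothesis phi_diag : forall j, diagonal_hom (phi j).
Hypothesis A_lim : inductive_limit phi mu.

Lemma muD j f g : dsh_carrier f -> dsh_carrier g -> mu j (f + g) = mu j f + mu j g.
Proof. by case: A_lim => /(_ j)[[h _] _ _] _ _ _ fc gc; apply: h; rewrite inE. Qed.

Lemma muM j f g : dsh_carrier f -> dsh_carrier g -> mu j (f * g) = mu j f * mu j g.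
Proof. by case: A_lim => /(_ j)[[_ h] _ _] _ _ _ fc gc; apply: h; rewrite inE. Qed.

Lemma muZ j (a : C) f : dsh_carrier f -> mu j (a *: f) = a *: mu j f.
Proof. by case: A_lim => /(_ j)[_ h _] _ _ _ fc; apply: h; rewrite inE. Qed.

Lemma mu_star j f : dsh_carrier f -> mu j (star f) = star (mu j f).
Proof. by case: A_lim => /(_ j)[_ _ h] _ _ _ fc; apply: h; rewrite inE. Qed.

Lemma muN j f : dsh_carrier f -> mu j (- f) = - mu j f.
Proof. by move=> fc; rewrite -scaleN1r muZ // scaleN1r. Qed.

Lemma muB j f g : dsh_carrier f -> dsh_carrier g -> mu j (f - g) = mu j f - mu j g.
Proof. by move=> fc gc; rewrite muD ?muN //; exact: carrierN. Qed.

Lemma mu0 j : mu j 0 = 0.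
Proof. by rewrite -(scale0r 0) muZ ?scale0r //; exact: carrier0. Qed.

Lemma phi_transfers j : transfers (phi j).
Proof. exact: diagonal_hom_transfers. Qed.

Lemma mu_phi j f : dsh_carrier f -> mu j.+1 (phi j f) = mu j f.
Proof. by case: A_lim => _ h _ _; exact: h. Qed.

(** The orbit of an element under the connecting maps, as one sequence; equalities
between its terms need no casts between stages. *)
Definition coherent j (s : forall q, dsh_family (D q)) :=
  forall q, (j <= q)%N -> s q.+1 = phi q (s q).

Lemma coherent_ex j (d : dsh_family (D j)) : exists s, coherent j s /\ s j = d.
Proof.
(* Up to stage [j] the sequence takes the values of [w], that is [d] at [j]. *)
pose w := @dfwith nat (fun q => dsh_family (D q)) (fun _ => 0) j d.
have wj : w j = d by rewrite /w dfwithin.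
pose s := fix s q : dsh_family (D q) := match q with
  | 0 => w 0%N
  | q'.+1 => if (q'.+1 <= j)%N then w q'.+1 else phi q' (s q')
  end.
exists s; split=> [q jq|].
  by rewrite [LHS]/= leqNgt ltnS jq.
rewrite -wj /s; clear s wj; clearbody w; clear d.
by case: j w => [|j] w //=; rewrite leqnn.
Qed.

Lemma coherent_le j k s : (j <= k)%N -> coherent j s -> coherent k s.
Proof. by move=> jk h q kq; apply: h; exact: leq_trans kq. Qed.

Lemma stage_map m q : (m <= q)%N ->
  exists Phi : dsh_family (D m) -> dsh_family (D q), [/\ transfers Phi,
    forall f, dsh_carrier f -> mu q (Phi f) = mu m f
    & forall s, coherent m s -> Phi (s m) = s q].
Proof.
elim: q => [|q IH].
  by rewrite leqn0 => /eqP ->; exists id; split=> //; exact: transfers_id.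
rewrite leq_eqVlt => /orP[/eqP <-|]; first by exists id; split=> //; exact: transfers_id.
rewrite ltnS => mq; have [Phi [tP mP cP]] := IH mq.
exists (phi q \o Phi); split.
- exact: transfers_comp tP (phi_transfers q).
- by move=> f fc /=; rewrite mu_phi ?mP //; exact: (transfer_carrier tP).
- by move=> s cs /=; rewrite cP // cs.
Qed.

Lemma connecting_stage_map m k : [/\ transfers (@connecting R D phi m k),
    forall f, dsh_carrier f -> mu (k + m)%N (@connecting R D phi m k f) = mu m f
    & forall s, coherent m s -> @connecting R D phi m k (s m) = s (k + m)%N].
Proof.
elim: k => [|k [tP mP cP]]; first by split=> //; exact: transfers_id.
split.
- exact: transfers_comp tP (phi_transfers _).
- by move=> f fc /=; rewrite mu_phi ?mP //; exact: (transfer_carrier tP).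
- by move=> s cs /=; rewrite cP // cs // leq_addl.
Qed.

Lemma coherent_carrier j s q : coherent j s -> dsh_carrier (s j) -> (j <= q)%N ->
  dsh_carrier (s q) /\ mu q (s q) = mu j (s j).
Proof.
move=> cs sj jq; have [Phi [tP mP cP]] := stage_map jq.
by rewrite -(cP _ cs) mP //; split=> //; exact: (transfer_carrier tP).
Qed.

Lemma mu_dense a e : 0 < e ->
  exists j, exists2 f, dsh_carrier f & cnorm (a - mu j f) < e.
Proof. by case: A_lim => _ _ _ h; exact: h. Qed.

(** The image of the unit does not depend on the stage, and it acts as a unit on the
dense set of images. *)
Lemma mu1 j : mu j 1 = 1.
Proof.
have E m : mu m 1 = mu 0%N 1.
  elim: m => // m <-; rewrite -(mu_phi (carrier1 (D m))).
  by rewrite (transfer1 (phi_transfers m)).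
have e1 a : mu 0%N 1 * a = a.
  apply/eqP; rewrite -subr_eq0; apply/eqP; apply: cnorm0_eq0.
  apply/eqP; rewrite eq_le cnorm_ge0 andbT; apply/ler_addgt0Pr => e e0; rewrite add0r.
  pose K := cnorm (mu 0%N 1) + 1.
  have K0 : 0 < K by rewrite ltr_wpDl // cnorm_ge0.
  have [|m [f fc hf]] := @mu_dense a (e / K); first by rewrite divr_gt0.
  have ef : mu 0%N 1 * mu m f = mu m f.
    by rewrite -(E m) -muM ?mul1r //; exact: carrier1.
  have -> : mu 0%N 1 * a - a = mu 0%N 1 * (a - mu m f) - (a - mu m f).
    by rewrite mulrBr ef opprB addrA subrK.
  apply: le_trans (cnormB _ _) _.
  apply: (@le_trans _ _ (K * cnorm (a - mu m f))).
    by rewrite /K mulrDl mul1r lerD2r cnormM.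
  by rewrite mulrC -ler_pdivlMr // ltW.
by rewrite E -[LHS]mulr1 e1.
Qed.

Lemma mu_norm_le j h K : 0 <= K -> dsh_carrier h ->
  (forall i x, opbound K (h i x)) -> cnorm (mu j h) <= K.
Proof.
move=> K0 hc hK; rewrite leNgt; apply/negP => lt.
case: A_lim => _ _ /(_ j h hc) cv _.
have [N _ /(_ N (leqnn N)) /=] := cvgr_gt _ cv _ lt.
apply/negP; rewrite -leNgt; apply: mxfamily_norm_le => // i x.
have [tP _ _] := connecting_stage_map j N.
have q := @transfer_pred _ _ _ _ tP unit (fun _ => h) _ (fun=> hc) (opbound_natural K0)
   (fun i x => hK i x).
exact: q.
Qed.

Lemma mu_norm_small j h e : dsh_carrier h -> cnorm (mu j h) < e ->
  exists k, mxfamily_norm (@connecting R D phi j k h) < e.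
Proof.
move=> hc lt; case: A_lim => _ _ /(_ j h hc) cv _.
by have [N _ /(_ N (leqnn N)) /=] := cvgr_lt _ cv _ lt; exists N.
Qed.

End Limit.

(** * Simplicity: nonzero elements become nowhere zero *)

Section Simple.
Variable R : realType.
Local Notation C := R[i].
Variable D : nat -> dsh_algebra R.
Variable phi : forall j, dsh_family (D j) -> dsh_family (D j.+1).
Arguments phi : clear implicits.
Variables (A : cstarAlgType R) (mu : forall j, dsh_family (D j) -> A).
Arguments mu : clear implicits.
Hypothesis phi_diag : forall j, diagonal_hom (phi j).
Hypothesis A_lim : inductive_limit phi mu.
Hypothesis A_simple : simple_cstar A.

Local Notation coherent := (coherent phi).

Lemma l2norm_delta N (p : 'I_N) : l2norm (delta_mx p 0 : 'cV[C]_N) = 1.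
Proof.
rewrite /l2norm (bigD1 p) //= big1 => [|q qp].
  by rewrite mxE !eqxx mulr1n normc1 expr1n addr0 sqrtr1.
by rewrite mxE (negbTE qp) mulr0n normc0 expr0n.
Qed.

Lemma zero_natural :
  @natural_pred R bool (fun N M => M true = 0 -> M false = 0).
Proof.
move=> N t n iota M Mk _ _ [L bd] hk M0; apply: (block_diag_uniq L (bd false)).
have -> : (fun k => Mk k false) = (fun k => 0); last exact: block_diag0.
apply: functional_extensionality_dep => k; apply: hk; apply/matrixP => a b.
by rewrite mxE -(bd true).1 M0 mxE.
Qed.

Lemma nonzero_natural : @natural_pred R unit (fun N M => M tt != 0).
Proof.
move=> N t n iota M Mk N0 _ [L bd] hk; apply/eqP => M0.
have [_ cov _] := L; have [k _] := cov (Ordinal N0).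
have /eqP := hk k; apply; apply/matrixP => a b.
by rewrite mxE -(bd tt).1 M0 mxE.
Qed.

(** The images of the elements that vanish wherever the orbit [s] does form an ideal
[J], whose closure [I] is nonzero and hence contains [1]. Therefore [J] has an
element at distance less than [1 / 2] from [1], and at some stage this distance is
witnessed by the norms of the matrices. At a zero of [s] the matrix of that
element would vanish, and the distance would be [1]. *)
Lemma full_everywhere j s : coherent j s -> dsh_carrier (s j) -> mu j (s j) != 0 ->
  exists K, forall q, (K <= q)%N -> (j <= q)%N /\ forall i x, s q i x != 0.
Proof.
move=> cs sj mu_ne.
have sc q : (j <= q)%N -> dsh_carrier (s q).
  by move=> jq; have [] := coherent_carrier phi_diag A_lim cs sj jq.
pose vanish q (g : dsh_family (D q)) := forall i x, s q i x = 0 -> g i x = 0.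
pose J a := exists q, exists2 g : dsh_family (D q), (j <= q)%N &
   [/\ dsh_carrier g, vanish q g & a = mu q g].
pose I := [set a : A | forall e : R, 0 < e -> exists2 b, J b & cnorm (a - b) < e].
have lift q q' (g : dsh_family (D q)) : (j <= q)%N -> (q <= q')%N -> dsh_carrier g ->
    vanish q g -> exists g' : dsh_family (D q'),
    [/\ dsh_carrier g', vanish q' g' & mu q' g' = mu q g].
  move=> jq qq' gc vg; have [Phi [tP mP cP]] := stage_map phi_diag A_lim qq'.
  exists (Phi g); split; [exact: (transfer_carrier tP) | | exact: mP].
  move=> i x; rewrite -(cP _ (coherent_le jq cs)).
  have q1 := @transfer_pred _ _ _ _ tP bool (fun b => if b then s q else g) _ _ zero_natural _ i x.
  by apply: q1 => // -[] //; exact: sc.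
have JI b : J b -> I b.
  by move=> Jb e e0; exists b => //; rewrite subrr cnorm0.
have JD a b : J a -> J b -> J (a + b).
  move=> [q1 [g1 jq1 [gc1 v1 ->]]] [q2 [g2 jq2 [gc2 v2 ->]]].
  have [g1' [gc1' v1' <-]] := lift q1 (maxn q1 q2) g1 jq1 (leq_maxl _ _) gc1 v1.
  have [g2' [gc2' v2' <-]] := lift q2 (maxn q1 q2) g2 jq2 (leq_maxr _ _) gc2 v2.
  exists (maxn q1 q2), (g1' + g2'); first exact: leq_trans jq1 (leq_maxl _ _).
  split; first exact: carrierD.
    by move=> i x sx; rewrite /= -[LHS]/(g1' i x + g2' i x) v1' // v2' // addr0.
  by rewrite (muD A_lim).
have JM m (f : dsh_family (D m)) b : dsh_carrier f -> J b -> J (mu m f * b) /\ J (b * mu m f).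
  move=> fc [q [g jq [gc vg ->]]].
  have [Phi [tP mP _]] := stage_map phi_diag A_lim (leq_maxl m q).
  have [g' [gc' vg' <-]] := lift q (maxn m q) g jq (leq_maxr _ _) gc vg.
  rewrite -mP //; have fc' := transfer_carrier tP fc.
  have jmq : (j <= maxn m q)%N by exact: leq_trans jq (leq_maxr _ _).
  split; exists (maxn m q).
    exists (Phi f * g') => //; split; first exact: carrierM.
      by move=> i x sx; rewrite -[LHS]/(Phi f i x *m g' i x) vg' // mulmx0.
    by rewrite (muM A_lim).
  exists (g' * Phi f) => //; split; first exact: carrierM.
    by move=> i x sx; rewrite -[LHS]/(g' i x *m Phi f i x) vg' // mul0mx.
  by rewrite (muM A_lim).
have JZ (a : C) b : J b -> J (a *: b).
  move=> [q [g jq [gc vg ->]]]; exists q, (a *: g) => //; split; first exact: carrierZ.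
    by move=> i x sx; rewrite -[LHS]/(a *: g i x) vg // scaler0.
  by rewrite (muZ A_lim).
have II : closed_ideal I.
  split.
  - apply: JI; exists j, 0 => //; split=> //; first exact: carrier0.
    by rewrite (mu0 A_lim).
  - move=> x y Ix Iy e e0; have e2 : 0 < e / 2 by rewrite divr_gt0.
    have [b1 J1 h1] := Ix _ e2; have [b2 J2 h2] := Iy _ e2.
    exists (b1 + b2); first exact: JD.
    rewrite opprD addrACA; apply: le_lt_trans (cnormD _ _) _.
    by rewrite (splitr e) ltrD.
  - move=> a x Ix e e0; pose K := normc a + 1.
    have K0 : 0 < K by rewrite ltr_wpDl // normc_ge0.
    have [|b Jb hb] := Ix (e / K); first by rewrite divr_gt0.
    exists (a *: b); first exact: JZ.
    rewrite -scalerBr cnormZ; apply: (@le_lt_trans _ _ (K * cnorm (x - b))).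
      by rewrite ler_wpM2r ?cnorm_ge0 // lerDl.
    by rewrite mulrC -ltr_pdivlMr.
  - move=> a x Ix.
    have aux e : 0 < e -> exists m (f : dsh_family (D m)) b, [/\ dsh_carrier f, J b,
        cnorm a * cnorm (x - b) < e / 2 & cnorm (a - mu m f) * cnorm b < e / 2].
      move=> e0; pose K := cnorm a + 1.
      have K0 : 0 < K by rewrite ltr_wpDl // cnorm_ge0.
      have [|b Jb hb] := Ix (e / 2 / K); first by rewrite !divr_gt0.
      pose K' := cnorm b + 1.
      have K'0 : 0 < K' by rewrite ltr_wpDl // cnorm_ge0.
      have [|m [f fc hf]] := @mu_dense _ _ _ _ _ A_lim a (e / 2 / K'); first by rewrite !divr_gt0.
      exists m, f, b; split=> //.
        apply: (@le_lt_trans _ _ (K * cnorm (x - b))).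
          by rewrite ler_wpM2r ?cnorm_ge0 // lerDl.
        by rewrite mulrC -ltr_pdivlMr.
      apply: (@le_lt_trans _ _ (cnorm (a - mu m f) * K')).
        by rewrite ler_wpM2l ?cnorm_ge0 // lerDl.
      by rewrite -ltr_pdivlMr.
    split=> e /aux[m [f [b [fc Jb h1 h2]]]].
      exists (mu m f * b); first by case: (JM m f b fc Jb).
      have -> : a * x - mu m f * b = a * (x - b) + (a - mu m f) * b.
        by rewrite mulrBr mulrBl addrA subrK.
      apply: le_lt_trans (cnormD _ _) _; rewrite (splitr e) ltrD //.
        exact: le_lt_trans (cnormM _ _) h1.
      exact: le_lt_trans (cnormM _ _) h2.
    exists (b * mu m f); first by case: (JM m f b fc Jb).
    have -> : x * a - b * mu m f = (x - b) * a + b * (a - mu m f).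
      by rewrite mulrBr mulrBl addrA subrK.
    apply: le_lt_trans (cnormD _ _) _; rewrite (splitr e) ltrD //.
      by rewrite mulrC in h1; exact: le_lt_trans (cnormM _ _) h1.
    by rewrite mulrC in h2; exact: le_lt_trans (cnormM _ _) h2.
  - move=> x h e e0; have e2 : 0 < e / 2 by rewrite divr_gt0.
    have [y Iy xy] := h _ e2; have [b Jb yb] := Iy _ e2.
    exists b => //; apply: le_lt_trans (cnorm_dist _ y _) _.
    by rewrite (splitr e) ltrD.
have Is : I (mu j (s j)).
  by apply: JI; exists j, (s j) => //; split=> //; exact: sc.
have I1 : I 1.
  have [I0|->//] := A_simple II.
  by move: Is; rewrite I0 /= => /eqP; rewrite (negbTE mu_ne).
have [|b [q [g jq [gc vg ->]]] hb] := I1 (1 / 2); first by rewrite divr_gt0.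
have c1 : dsh_carrier (1 : dsh_family (D q)) by exact: carrier1.
have hc : dsh_carrier (1 - g) by exact: carrierB.
rewrite -(mu1 phi_diag A_lim q) -(muB A_lim) // in hb.
have [k hk] := mu_norm_small A_lim hc hb.
have [tP mP cP] := connecting_stage_map phi_diag A_lim q k.
set Phi := @connecting R D phi q k in tP mP cP hk.
have ne i x : s (k + q)%N i x != 0.
  apply/eqP => s0.
  have g0 : Phi g i x = 0.
    have q1 := @transfer_pred _ _ _ _ tP bool (fun b => if b then s q else g) _ _ zero_natural _ i x.
    apply: q1 => //.
    - by case=> //; exact: sc.
    - by rewrite cP //; exact: coherent_le jq cs.
  have E : Phi (1 - g) i x = 1.
    rewrite (transferD tP) ?(transferN tP) //; last exact: carrierN.
    by rewrite (transfer1 tP) -[LHS]/(1 - Phi g i x) g0 subr0.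
  have N0 : (0 < dsh_size (D (k + q)%N) i)%N by apply: dsh_size_gt0; rewrite -ltnS.
  have := mxfamily_norm_ge x (v := delta_mx (Ordinal N0) 0) (transfer_carrier tP hc).
  rewrite E mul1mx l2norm_delta => /(_ (lexx _)) /le_lt_trans /(_ hk).
  by lra.
exists (k + q)%N => r kqr; split; first exact: leq_trans jq (leq_trans (leq_addl _ _) kqr).
have [Psi [tPsi _ cPsi]] := stage_map phi_diag A_lim kqr.
move=> i x; have jkq : (j <= k + q)%N by exact: leq_trans jq (leq_addl _ _).
rewrite -(cPsi _ (coherent_le jkq cs)).
have q1 := @transfer_pred _ _ _ _ tPsi unit (fun=> s (k + q)%N) _ _ nonzero_natural _ i x.
by apply: q1 => // _; exact: sc.
Qed.

End Simple.

(** * Elements with a prescribed value at a point *)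

Section Bumps.
Variable R : realType.
Local Notation C := R[i].
Variable D : dsh_algebra R.
Local Notation l := (dsh_last D).
Local Notation X := (dsh_space D).
Local Notation Y i := (@dsh_sub R D i).
Local Notation n := (@dsh_size R D).
Local Notation fam := (dsh_family D).
Local Notation carrier := (@dsh_carrier R D).

Lemma urysohn_point (i : 'I_l.+1) (x0 : X i) : ~ Y i x0 ->
  exists f : X i -> R, [/\ continuous f, forall x, 0 <= f x <= 1,
    forall x, Y i x -> f x = 0 & f x0 = 1].
Proof.
move=> nY; have il : (i <= l)%N by rewrite -ltnS.
have cl : closed [set x0].
  by apply: accessible_closed_set1; apply: hausdorff_accessible; exact: dsh_hausdorff.
have [|f [cf f01 f0 f1]] := @urysohn_closed R _ (dsh_compact il) (dsh_hausdorff il) _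
   (dsh_sub_closed il) _ cl.
  by rewrite -subset0 => x [/= ->].
by exists f; split=> //; exact: f1.
Qed.

Lemma carrier_at (i : 'I_l.+1) (x0 : X i) (M : 'M[C]_(n i)) : ~ Y i x0 ->
  exists2 f, carrier f & f i x0 = M.
Proof.
move=> /urysohn_point[f [cf f01 f0 f1]].
pose g (v : void) : fam := match v with end.
pose P N (_ : void -> 'M[C]_N) := True.
pose Q N (_ : void -> 'M[C]_N) (_ : 'M[C]_N) := True.
have ext : extendable_rel P Q by move=> T Z _ _ _ N G G0 _ _ cG0 _; exists G0.
have cb : continuous (fun x => (f x)%:C *: M).
  apply: continuous_scalemx; first exact: continuous_real_complex.
  by move=> x; exact: cvg_cst.
have bY y : Y i y -> (f y)%:C *: M = 0 by move=> Yy; rewrite f0 // scale0r.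
have gc a : carrier (g a) by case: a.
have Pg (k : 'I_l.+1) (x : X k) : P _ (fun a => g a k x) by [].
have natQ : natural_rel Q by [].
have Q0 N m : Q N m 0 by [].
have [f' [fc fE _]] := carrier_ext_bump gc Pg natQ ext Q0 cb bY (fun=> Logic.I).
by exists f' => //; rewrite fE f1 scale1r.
Qed.

Lemma sum_famE I (s : seq I) (F : I -> fam) i x :
  (\sum_(a <- s) F a) i x = \sum_(a <- s) F a i x.
Proof.
by elim: s => [|a s IH]; rewrite ?big_nil ?big_cons // -IH.
Qed.

Lemma carrier_sum (I : eqType) (s : seq I) (F : I -> fam) :
  (forall a, a \in s -> carrier (F a)) -> carrier (\sum_(a <- s) F a).
Proof.
elim: s => [|a s IH] Fc; first by rewrite big_nil; exact: carrier0.
rewrite big_cons; apply: carrierD; first by apply: Fc; rewrite mem_head.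
by apply: IH => b bs; apply: Fc; rewrite inE bs orbT.
Qed.

End Bumps.

(** * Singular points that survive in the limit *)

Section Positivity.
Variable R : realType.
Local Notation C := R[i].

Lemma star_mulE n (M : 'M[C]_n) (v : 'cV[C]_n) :
  ((map_mx conjc v)^T *m (star M *m M) *m v) 0 0 = (l2norm (M *m v) ^+ 2)%:C.
Proof.
have -> : (map_mx conjc v)^T *m (star M *m M) *m v = (map_mx conjc (M *m v))^T *m (M *m v).
  by rewrite -[star M]/((map_mx conjc M)^T) map_mxM trmx_mul !mulmxA.
rewrite l2norm_sqr mxE rmorph_sum /=; apply: eq_bigr => a _.
rewrite !mxE; set z := \sum_i _; case: z => a1 a2 /=.
rewrite sqr_sqrtr ?addr_ge0 ?sqr_ge0 //.
by apply/eqP; rewrite eq_complex /=; apply/andP; split; apply/eqP; ring.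
Qed.

Lemma l2norm_eq0 n (v : 'cV[C]_n) : l2norm v = 0 -> v = 0.
Proof.
move=> /(congr1 (fun r => r ^+ 2)); rewrite l2norm_sqr expr0n /= => /eqP.
rewrite psumr_eq0 => [/allP h|i _]; last exact: sqr_ge0.
apply/matrixP => a b; rewrite ord1 mxE.
have := h a (mem_index_enum _); rewrite sqrf_eq0 => /eqP; exact: eq0_normc.
Qed.

(** A sum of positive matrices kills only the common kernel of its terms. *)
Lemma sum_star_unit n (I : eqType) (s : seq I) (F : I -> 'M[C]_n) :
  (forall v : 'cV[C]_n, (forall a, a \in s -> F a *m v = 0) -> v = 0) ->
  \sum_(a <- s) star (F a) *m F a \in unitmx.
Proof.
move=> inj; set P := \sum_(a <- s) _; rewrite unitmxE unitfE -det_tr.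
apply/det0P => -[w w0 wP]; case/eqP: w0; apply: trmx_inj; rewrite trmx0.
have Pv : P *m w^T = 0 by rewrite -[P]trmxK -trmx_mul wP trmx0.
apply: inj => a ais; apply: l2norm_eq0.
have : \sum_(b <- s) l2norm (F b *m w^T) ^+ 2 = 0.
  apply: (@complexI R); rewrite rmorph_sum /=.
  transitivity (((map_mx conjc w^T)^T *m P *m w^T) 0 0); last first.
    by rewrite -mulmxA Pv mulmx0 mxE.
  rewrite /P mulmx_sumr mulmx_suml summxE.
  by apply: eq_bigr => b _; rewrite star_mulE.
move=> /eqP; rewrite psumr_eq0 => [/allP/(_ a ais)|b _]; last exact: sqr_ge0.
by rewrite sqrf_eq0 => /eqP.
Qed.

End Positivity.

Section Survival.
Variable R : realType.
Local Notation C := R[i].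
Variable D : nat -> dsh_algebra R.
Variable phi : forall j, dsh_family (D j) -> dsh_family (D j.+1).
Arguments phi : clear implicits.
Variables (A : cstarAlgType R) (mu : forall j, dsh_family (D j) -> A).
Arguments mu : clear implicits.
Hypothesis phi_diag : forall j, diagonal_hom (phi j).
Hypothesis A_lim : inductive_limit phi mu.

Variable j : nat.
Local Notation l := (dsh_last (D j)).
Local Notation X := (dsh_space (D j)).
Local Notation Y i := (@dsh_sub R (D j) i).
Local Notation n := (@dsh_size R (D j)).
Local Notation fam := (dsh_family (D j)).
Local Notation carrier := (@dsh_carrier R (D j)).

Definition in_kernel (d : fam) := carrier d /\ mu j d = 0.

(** No nonzero vector is killed by [f] and by all the elements of [s]. With [s] taken
from the kernel of [mu j], this is a left invertibility of [f] at [x] up to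
elements that do not matter in the limit. *)
Definition separated (f : fam) (s : seq fam) (i : 'I_l.+1) (x : X i) :=
  forall v : 'cV[C]_(n i), f i x *m v = 0 ->
    (forall d : fam, d \in s -> d i x *m v = 0) -> v = 0.

Lemma separated_mono (f : fam) s s' (i : 'I_l.+1) (x : X i) : {subset s <= s'} ->
  @separated f s i x -> @separated f s' i x.
Proof. by move=> ss h v fv sv; apply: h => // d /ss; exact: sv. Qed.

(** If [d] has the entry [(p, q)] at [x], then its products with elements that take
the matrix units [(q, a)] at [x] detect all coordinates of a vector. *)
Lemma separated_dead (f d : fam) (i : 'I_l.+1) (x : X i) : ~ Y i x -> in_kernel d -> d i x <> 0 ->
  exists2 s : seq fam, (forall d', d' \in s -> in_kernel d') & @separated f s i x.
Proof.
move=> nY [dc d0] dx.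
have /mx_neq0[p [q dpq]] : d i x != 0 by apply/eqP.
pose L a := projT1 (cid2 (carrier_at (delta_mx q a) nY)).
have Lc a : carrier (L a) by rewrite /L; case: cid2.
have LE a : L a i x = delta_mx q a by rewrite /L; case: cid2.
exists [seq d * L a | a <- enum 'I_(n i)].
  move=> _ /mapP[a _ ->]; split; first exact: carrierM.
  by rewrite (muM A_lim) // d0 mul0r.
move=> v _ h; apply/matrixP => a b; rewrite ord1 mxE.
have := h (d * L a) (map_f (fun a => d * L a) (etrans (mem_enum _ a) isT)).
rewrite -[(d * L a) i x]/(d i x *m L a i x) LE -mulmxA.
move=> /matrixP/(_ p 0); rewrite !mxE (bigD1 q) //= big1 ?addr0.
  rewrite mxE (bigD1 a) //= big1 ?addr0.
    by rewrite mxE !eqxx mul1r => /eqP; rewrite mulf_eq0 (negbTE dpq) => /eqP.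
  by move=> c ca; rewrite mxE (negbTE ca) andbF mul0r.
by move=> c cq; rewrite mxE big1 ?mulr0 // => e _; rewrite mxE (negbTE cq) mul0r.
Qed.

(** Induction on the level: at a point of a gluing subspace a vector splits into its
blocks, and each block is separated by elements found at a lower point. *)
Lemma separated_everywhere (f : fam) : carrier f ->
  (forall (i : 'I_l.+1) (x : X i), ~ Y i x -> f i x \in unitmx \/ exists2 d, in_kernel d & d i x <> 0) ->
  forall i x, exists2 s : seq fam, (forall d', d' \in s -> in_kernel d') & @separated f s i x.
Proof.
move=> fc H.
suff h m (i : 'I_l.+1) : (i < m)%N -> forall x, exists2 s : seq fam,
    (forall d', d' \in s -> in_kernel d') & @separated f s i x.
  by move=> i x; exact: (h i.+1).
elim: m i => // m IH i im x.
have [Yx|nY] := pselect (Y i x); last first.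
  have [ux|[d kd dx]] := H i x nY; last exact: separated_dead nY kd dx.
  exists [::] => // v fv _.
  by rewrite -[v]mul1mx -(mulVmx ux) -mulmxA fv mulmx0.
have [t [i_ [x_ [iota [lt L bd]]]]] := carrier_decomp Yx.
have IHk k := IH (i_ k) (leq_trans (lt k) im) (x_ k).
pose sk k := projT1 (cid2 (IHk k)).
have sker k d : d \in sk k -> in_kernel d by rewrite /sk; case: cid2 => s /= h _; exact: h.
have ssep k : @separated f (sk k) (i_ k) (x_ k) by rewrite /sk; case: cid2.
exists (flatten [seq sk k | k <- enum 'I_t]).
  by move=> d /flatten_mapP[k _]; exact: sker.
move=> v fv dv.
have blk (d : fam) : carrier d -> d i x *m v = 0 ->
    forall k, d (i_ k) (x_ k) *m block_col iota v k = 0.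
  move=> dc d0 k; apply/matrixP => a b; rewrite ord1.
  by rewrite -(block_diag_col L v a (bd d dc)) d0 !mxE.
have vk k : block_col iota v k = 0.
  apply: (ssep k); first exact: blk.
  move=> d ds; apply: blk; first by case: (sker _ _ ds).
  by apply: dv; apply/flatten_mapP; exists k; rewrite ?mem_enum.
apply/matrixP => p b; rewrite ord1 mxE.
have [_ cov _] := L; have [k [a ->]] := cov p.
by have /matrixP/(_ a 0) := vk k; rewrite !mxE.
Qed.

(** At a separated point the sum of the [d^* d] is invertible, hence so it is nearby;
compactness of the spaces then leaves finitely many elements to be collected. *)
Lemma separated_uniformly (f : fam) : carrier f ->
  (forall i x, exists2 s : seq fam, (forall d', d' \in s -> in_kernel d') & @separated f s i x) ->
  exists2 s : seq fam, (forall d', d' \in s -> in_kernel d') & forall i x, @separated f s i x.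
Proof.
move=> fc H.
have Hi (i : 'I_l.+1) : exists2 s : seq fam, (forall d', d' \in s -> in_kernel d') &
    forall x, @separated f s i x.
  have : compact [set: X i] by apply: dsh_compact; rewrite -ltnS.
  move=> /compact_near_coveringP nc.
  pose kers (s : seq fam) := forall d, d \in s -> in_kernel d.
  (* The filter of the finite lists of kernel elements that are large enough: the
     form of compactness for a nearness parameter then yields one list for all
     points. *)
  pose F : set_system (seq fam) := [set S |
    exists2 s0, kers s0 & forall s, kers s -> {subset s0 <= s} -> S s].
  have FF : Filter F.
    split.
    - by exists [::].
    - move=> S S' [s0 k0 h0] [s1 k1 h1]; exists (s0 ++ s1).
        by move=> d; rewrite mem_cat => /orP[/k0|/k1].
      by move=> s ks sub; split; [apply: h0|apply: h1] => // d ds; apply: sub;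
        rewrite mem_cat ds ?orbT.
    - by move=> S S' SS' [s0 k0 h0]; exists s0 => // s ks sub; apply/SS'/h0.
  pose P (s : seq fam) : fam := \sum_(d <- f :: s) star d * d.
  have PE s y : P s i y = \sum_(d <- f :: s) star (d i y) *m d i y.
    by rewrite /P sum_famE.
  have [|s0 k0 h0] := nc _ F (fun s y => kers s -> @separated f s i y) FF; last first.
    by exists s0 => // x; exact: h0.
  move=> x _; have [s0 sker ssep] := H i x.
  have cP : continuous (P s0 i).
    apply: carrier_continuous; apply: carrier_sum => d ds.
    have dc : carrier d by move: ds; rewrite inE => /orP[/eqP -> //|/sker[]].
    by apply: carrierM => //; exact: carrier_star.
  exists ([set y | \det (P s0 i y) != 0], [set s : seq fam | {subset s0 <= s}]) => /=.
    split; last by exists s0.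
    have dx : \det (P s0 i x) != 0.
      rewrite -unitfE -unitmxE PE; apply: sum_star_unit => v h.
      apply: ssep; first by apply: h; rewrite mem_head.
      by move=> d ds; apply: h; rewrite inE ds orbT.
    have rx : 0 < normc (\det (P s0 i x)).
      rewrite lt_neqAle normc_ge0 andbT eq_sym; apply: contra dx => /eqP.
      by move=> /eq0_normc ->.
    have q := cvgr_gt _ (continuous_normc (continuous_det cP) (x := x)) _ rx.
    apply: (@filterS _ (nbhs x) (nbhs_filter x) _ _ _ (q (nbhs_filter x))) => y /=.
    by apply: contraTneq => ->; rewrite normc0 ltxx.
  move=> [y s] /= [u sub] _; apply: (separated_mono sub).
  rewrite -unitfE -unitmxE PE in u.
  move=> v fv sv; rewrite -[v]mul1mx -(mulVmx u) -mulmxA.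
  suff -> : (\sum_(d <- f :: s0) star (d i y) *m d i y) *m v = 0 by rewrite mulmx0.
  rewrite mulmx_suml big1_seq // => d /andP[_].
  by rewrite inE => /orP[/eqP -> |ds]; rewrite -mulmxA ?fv ?sv // mulmx0.
pose si i := projT1 (cid2 (Hi i)).
have sker i d : d \in si i -> in_kernel d by rewrite /si; case: cid2 => s /= h _; exact: h.
have ssep i x : @separated f (si i) i x by rewrite /si; case: cid2.
exists (flatten [seq si i | i <- enum 'I_l.+1]).
  by move=> d /flatten_mapP[k _]; exact: sker.
move=> i x; apply: separated_mono (ssep i x) => d ds.
by apply/flatten_mapP; exists i; rewrite ?mem_enum.
Qed.

(** The element [f^* f + \sum_d d^* d], with the [d] in the kernel of [mu j], is
invertible, and its image is that of [f^* f]. *)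
Lemma mu_left_inverse (f : fam) : carrier f ->
  (forall (i : 'I_l.+1) (x : X i), ~ Y i x -> f i x \in unitmx \/ exists2 d, in_kernel d & d i x <> 0) ->
  exists y, y * mu j f = 1.
Proof.
move=> fc H; have [s sker ssep] := separated_uniformly fc (separated_everywhere fc H).
pose P : fam := star f * f + \sum_(d <- s) star d * d.
have sc : carrier (\sum_(d <- s) star d * d).
  apply: carrier_sum => d /sker[dc _].
  by apply: carrierM => //; exact: carrier_star.
have Pc : carrier P.
  by apply: carrierD => //; apply: carrierM => //; exact: carrier_star.
have Pu i x : P i x \in unitmx.
  have -> : P i x = \sum_(d <- f :: s) star (d i x) *m d i x.
    by rewrite big_cons; congr (_ + _); exact: sum_famE.
  apply: sum_star_unit => v h; apply: (ssep i x).
    by apply: h; rewrite mem_head.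
  by move=> d ds; apply: h; rewrite inE ds orbT.
have [g [gc _ gP]] := carrier_inv Pc Pu.
have ker0 : mu j (\sum_(d <- s) star d * d) = 0.
  elim: s sker {ssep P sc Pc Pu g gc gP} => [|d s IH] sker.
    by rewrite big_nil (mu0 A_lim).
  have [dc d0] := sker d (mem_head _ _).
  have sker' d' : d' \in s -> in_kernel d' by move=> ds; apply: sker; rewrite inE ds orbT.
  rewrite big_cons (muD A_lim).
  - rewrite (muM A_lim) //; last exact: carrier_star.
    by rewrite d0 mulr0 add0r IH.
  - by apply: carrierM => //; exact: carrier_star.
  - apply: carrier_sum => d' /sker'[dc' _].
    by apply: carrierM => //; exact: carrier_star.
have sfc := carrier_star fc.
exists (mu j g * mu j (star f)); rewrite -mulrA -(muM A_lim) //.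
have -> : mu j (star f * f) = mu j P.
  by rewrite [RHS](muD A_lim) ?ker0 ?addr0 //; exact: carrierM.
by rewrite -(muM A_lim) // gP (mu1 phi_diag A_lim).
Qed.

Lemma star1 : star (1 : A) = 1.
Proof. by rewrite -[LHS]mulr1 -[X in _ * X](starK (1 : A)) -starM mulr1 starK. Qed.

(** Otherwise [f] and [f^*] would both be separated, and [mu j f] would have a left
and a right inverse. *)
Lemma singular_surviving (f : fam) : carrier f -> ~ invertible (mu j f) ->
  exists (i : 'I_l.+1) (x : X i), [/\ ~ Y i x, f i x \notin unitmx & forall d, in_kernel d -> d i x = 0].
Proof.
move=> fc ninv; apply: contrapT => h; apply: ninv.
have H (i : 'I_l.+1) (x : X i) : ~ Y i x -> f i x \in unitmx \/ exists2 d, in_kernel d & d i x <> 0.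
  move=> nY; have [u|nu] := boolP (f i x \in unitmx); [by left|right].
  apply: contrapT => hd; apply: h; exists i, x; split=> // d kd.
  by apply: contrapT => dx; apply: hd; exists d.
have [y yf] := mu_left_inverse fc H.
have [|y' yf'] := mu_left_inverse (carrier_star fc).
  move=> i x nY; have [u|] := H i x nY; [left|by right].
  move: u; rewrite !unitmxE !unitfE -[star f i x]/((map_mx conjc (f i x))^T).
  by rewrite det_tr det_map_mx conjc_eq0.
have fy' : mu j f * star y' = 1.
  by rewrite -[mu j f]starK -starM -(mu_star A_lim) // yf' star1.
exists y; split=> //.
have -> : y = star y' by rewrite -[y]mulr1 -fy' mulrA yf mul1r.
exact: fy'.
Qed.

End Survival.

(** * Diagonal matrices with entries in [0, 1] *)

Section Diag01.
Variable R : realType.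
Local Notation C := R[i].
Local Notation re := (@complex.Re R).

Definition diag01 N (M : 'M[C]_N) :=
  (forall p q, M p q = if p == q then (re (M p p))%:C else 0) /\
  (forall p, 0 <= re (M p p) <= 1).

(** Two piecewise linear functions such that [sat] equals [1] wherever [trim] is
nonzero: passing from a mark [d] to [trim d] leaves room for [sat d] as a
continuous cutoff that is equal to [1] on the support of the new mark. *)
Definition sat (z : C) : C := (Num.min 1 (Num.max 0 (re z *+ 2)))%:C.
Definition trim (z : C) : C := (Num.max 0 (re z *+ 2 - 1))%:C.

Lemma sat0 : sat 0 = 0.
Proof. by rewrite /sat /= mul0rn maxxx minEle ler10. Qed.

Lemma trim0 : trim 0 = 0.
Proof. by rewrite /trim /= mul0rn maxEle sub0r ler0N1. Qed.

Lemma trim1 : trim 1 = 1.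
Proof. by rewrite /trim /= maxEle (_ : 1 *+ 2 - 1 = 1) ?ler01 //; ring. Qed.

Lemma continuous_sat (X : topologicalType) (f : X -> C) :
  continuous f -> continuous (fun x => sat (f x)).
Proof.
move=> cf; apply: continuous_real_complex; apply: continuousR_min.
  exact: continuousR_cst.
apply: continuousR_max; first exact: continuousR_cst.
have cr := continuous_comp_fun cf (@Re_continuous R).
exact: (continuousR_D cr cr).
Qed.

Lemma continuous_trim (X : topologicalType) (f : X -> C) :
  continuous f -> continuous (fun x => trim (f x)).
Proof.
move=> cf; apply: continuous_real_complex; apply: continuousR_max.
  exact: continuousR_cst.
have cr := continuous_comp_fun cf (@Re_continuous R).
apply: continuousR_D; first exact: (continuousR_D cr cr).
exact: continuousR_cst.
Qed.

Lemma sat_range z : 0 <= re (sat z) <= 1.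
Proof. by rewrite /sat /= ge_min lexx /= le_min ler01 le_max lexx. Qed.

Lemma trim_range z : re z <= 1 -> 0 <= re (trim z) <= 1.
Proof. by move=> z1; rewrite /trim /= le_max lexx /= ge_max ler01 /=; lra. Qed.

Lemma trim_sat z : trim z != 0 -> sat z = 1.
Proof.
rewrite /trim /sat; have [h|h] := leP (re z *+ 2) 1.
  by rewrite (_ : Num.max 0 _ = 0) ?eqxx // maxEge ifT //; lra.
by move=> _; rewrite maxEle ifT ?minEle ?ltW //; lra.
Qed.

Lemma sat_neq0 z : sat z != 0 -> 0 < re z.
Proof.
apply: contraNT; rewrite -leNgt => z0; rewrite /sat (_ : Num.max 0 _ = 0).
  by rewrite minEle ler10.
by rewrite maxEge ifT //; lra.
Qed.

Lemma trim_neq0 z : trim z != 0 -> 0 < re z.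
Proof.
by move=> /trim_sat sz; apply: sat_neq0; rewrite sz oner_eq0.
Qed.

Lemma map_diag01 N (M : 'M[C]_N) (phi : C -> C) : diag01 M -> phi 0 = 0 ->
  (forall z, re z <= 1 -> phi z = (re (phi z))%:C /\ 0 <= re (phi z) <= 1) ->
  diag01 (\matrix_(p, q) phi (M p q)).
Proof.
move=> [h1 h2] p0 hp; split=> [p q|p]; rewrite !mxE.
  case: eqP => [<-|/eqP pq]; last by rewrite h1 (negbTE pq).
  by case: (hp (M p p)) => //; case/andP: (h2 p).
by case: (hp (M p p)) => //; case/andP: (h2 p).
Qed.

Lemma diag01_sat N (M : 'M[C]_N) : diag01 M -> diag01 (\matrix_(p, q) sat (M p q)).
Proof. by move=> dM; apply: map_diag01 sat0 _ => // z _; split=> //; exact: sat_range. Qed.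

Lemma diag01_trim N (M : 'M[C]_N) : diag01 M -> diag01 (\matrix_(p, q) trim (M p q)).
Proof. by move=> dM; apply: map_diag01 trim0 _ => // z z1; split=> //; exact: trim_range. Qed.

Lemma diag01E N (M : 'M[C]_N) p q : diag01 M -> p != q -> M p q = 0.
Proof. by move=> [-> _] /negbTE ->. Qed.

Lemma diag01_real N (M : 'M[C]_N) p : diag01 M -> M p p = (re (M p p))%:C.
Proof. by move=> [h _]; rewrite {1}h eqxx. Qed.

Lemma mul_diag_l N (E M : 'M[C]_N) p q : (forall a b, a != b -> E a b = 0) ->
  (E *m M) p q = E p p * M p q.
Proof.
move=> dE; rewrite mxE (bigD1 p) //= big1 ?addr0 // => r rp.
by rewrite dE ?mul0r // eq_sym.
Qed.

Lemma mul_diag_r N (E M : 'M[C]_N) p q : (forall a b, a != b -> E a b = 0) ->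
  (M *m E) p q = M p q * E q q.
Proof.
move=> dE; rewrite mxE (bigD1 q) //= big1 ?addr0 // => r rq.
by rewrite dE ?mulr0.
Qed.

Definition cutoff N (E M : 'M[C]_N) : 'M[C]_N := (1%:M - E) *m M *m (1%:M - E).

Lemma cutoffE N (E M : 'M[C]_N) p q : (forall a b, a != b -> E a b = 0) ->
  cutoff E M p q = (1 - E p p) * M p q * (1 - E q q).
Proof.
move=> dE; have d1 a b : a != b -> (1%:M - E) a b = 0.
  by move=> ab; rewrite !mxE (negbTE ab) dE // subr0.
rewrite /cutoff mul_diag_r // mul_diag_l //.
by rewrite !mxE !eqxx.
Qed.

End Diag01.

(** * Elimination of a row and a column *)

Section KillRowCol.
Variable R : realType.
Local Notation C := R[i].

Definition strict (up : bool) n (p q : 'I_n) := if up then (p < q)%N else (q < p)%N.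

(** [L] stands for the matrices that are values at one point of invertible elements,
and [free] for the indices outside the existing crosses. Only unitriangular
matrices lift directly, see [liftable_triangular], hence the form of [LT]. *)
Variables (n : nat) (free : 'I_n -> Prop) (L : 'M[C]_n -> Prop).
Hypothesis LM : forall u v, L u -> L v -> L (u *m v).
Hypothesis LT : forall up (N : 'M[C]_n),
  (forall p q, N p q != 0 -> [/\ strict up p q, free p & free q]) -> L (1%:M + N).

(** When no product of two entries goes through a smaller index, [1 + N] is the
product of its lower and its upper unitriangular parts. *)
Lemma lift_split (N : 'M[C]_n) :
  (forall p q, N p q != 0 -> [/\ p != q, free p & free q]) ->
  (forall p q r : 'I_n, (q < p)%N -> (q < r)%N -> N p q * N q r = 0) -> L (1%:M + N).
Proof.
move=> hN LU.
pose Lo := \matrix_(p, q) if (q < p)%N then N p q else 0.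
pose Up := \matrix_(p, q) if (p < q)%N then N p q else 0.
have -> : 1%:M + N = (1%:M + Lo) *m (1%:M + Up).
  have LU0 : Lo *m Up = 0.
    apply/matrixP => p q; rewrite !mxE big1 // => r _; rewrite !mxE.
    by do 2 case: ifP => ?; rewrite ?mulr0 ?mul0r // LU.
  rewrite mulmxDl mul1mx mulmxDr mulmx1 LU0 addr0 -addrA; congr (_ + _).
  apply/matrixP => p q; rewrite !mxE.
  case: (ltngtP p q) => [_|_|/val_inj e]; rewrite ?add0r ?addr0 //.
  by apply/eqP; apply: contraT => /hN[/eqP]; rewrite e.
apply: LM.
  apply: (LT (up := false)) => p q; rewrite mxE; case: ifP => [qp /hN[]|_]; first by split.
  by rewrite eqxx.
apply: (LT (up := true)) => p q; rewrite mxE; case: ifP => [qp /hN[]|_]; first by split.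
by rewrite eqxx.
Qed.

Definition with_row (b : 'I_n) (r : 'rV[C]_n) : 'M[C]_n :=
  \matrix_(p, q) if p == b then r 0 q else (p == q)%:R.
Definition with_col (b : 'I_n) (c : 'cV[C]_n) : 'M[C]_n :=
  \matrix_(p, q) if q == b then c p 0 else (p == q)%:R.

Lemma lift_with_row (b : 'I_n) (r : 'rV[C]_n) : free b -> r 0 b = 1 -> (forall q, r 0 q != 0 -> free q) ->
  L (with_row b r).
Proof.
move=> fb rb fr.
have -> : with_row b r = 1%:M + (with_row b r - 1%:M) by rewrite addrC subrK.
have NE p q : (with_row b r - 1%:M) p q = if (p == b) && (q != b) then r 0 q else 0.
  rewrite !mxE; case: eqP => [->|_] /=; last by rewrite subrr.
  by rewrite [b == q]eq_sym; case: eqP => [->|_] /=; rewrite ?rb ?subrr ?subr0.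
apply: lift_split => [p q|p q s qp qs]; rewrite !NE.
  case: ifP => [/andP[/eqP -> qb] /fr fq|]; last by rewrite eqxx.
  by split=> //; rewrite eq_sym.
case: (p == b) => /=; last by rewrite mul0r.
by case: (q == b) => /=; rewrite ?mul0r ?mulr0.
Qed.

Lemma lift_with_col (b : 'I_n) (c : 'cV[C]_n) : free b -> c b 0 = 1 -> (forall q, c q 0 != 0 -> free q) ->
  L (with_col b c).
Proof.
move=> fb cb fc.
have -> : with_col b c = 1%:M + (with_col b c - 1%:M) by rewrite addrC subrK.
have NE p q : (with_col b c - 1%:M) p q = if (q == b) && (p != b) then c p 0 else 0.
  rewrite !mxE; case: (q =P b) => [->|_] /=; last by rewrite subrr.
  by case: eqP => [->|_] /=; rewrite ?cb ?subrr ?subr0.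
apply: lift_split => [p q|p q s qp qs]; rewrite !NE.
  case: ifP => [/andP[/eqP -> qb] /fc fq|]; last by rewrite eqxx.
  by split.
by case: (q == b) => /=; rewrite ?andbF ?mul0r ?mulr0.
Qed.

Lemma with_row_mul (b : 'I_n) (r : 'rV[C]_n) (h : 'M[C]_n) q : (with_row b r *m h) b q = (r *m h) 0 q.
Proof. by rewrite !mxE; apply: eq_bigr => p _; rewrite mxE eqxx. Qed.

Lemma mul_with_col (b : 'I_n) (c : 'cV[C]_n) (h : 'M[C]_n) p : (h *m with_col b c) p b = (h *m c) p 0.
Proof. by rewrite !mxE; apply: eq_bigr => q _; rewrite mxE eqxx. Qed.

(** Multiplying [f] on the left by the identity matrix with its [b]-th row replaced by
a multiple of the null vector [w] makes the [b]-th row zero, and similarly for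
columns with [v]. This needs an index at which both null vectors are nonzero; a
preliminary elementary operation provides one. *)
Lemma kill_row_col (f : 'M[C]_n) (v : 'cV[C]_n) (w : 'rV[C]_n) : L 1%:M ->
  v != 0 -> w != 0 -> f *m v = 0 -> w *m f = 0 ->
  (forall p, v p 0 != 0 -> free p) -> (forall p, w 0 p != 0 -> free p) ->
  exists u u' b, [/\ L u, L u', free b
    & forall q, (u *m f *m u') b q = 0 /\ (u *m f *m u') q b = 0].
Proof.
move=> L1 v0 w0 fv wf vfree wfree.
have [b [z]] := mx_neq0 v0; rewrite (ord1 z) => vb {z}.
have [z [a]] := mx_neq0 w0; rewrite (ord1 z) => wa {z}.
have fb := vfree b vb.
have [u0 [w' [Lu0 w'b w'f w'free]]] : exists (u0 : 'M[C]_n) (w' : 'rV[C]_n), [/\ L u0, w' 0 b != 0,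
    w' *m (u0 *m f) = 0 & forall p, w' 0 p != 0 -> free p].
  have [wb|wb] := eqVneq (w 0 b) 0; last by exists 1%:M, w; rewrite mul1mx.
  have ab : a != b by apply: contra wa => /eqP ->; rewrite wb.
  pose E : 'M[C]_n := delta_mx a b.
  have EE : E *m E = 0 by rewrite mul_delta_mx_0 // eq_sym.
  have wE q : (w *m E) 0 q = if q == b then w 0 a else 0.
    rewrite mxE (bigD1 a) //= big1 ?addr0 => [|p pa]; rewrite mxE ?eqxx /=.
      by case: eqP => _; rewrite ?mulr1 ?mulr0.
    by rewrite (negbTE pa) mulr0.
  exists (1%:M + E), (w *m (1%:M - E)); split.
  - apply: (LT (up := (a < b)%N)) => p q; rewrite mxE.
    have [-> |_] := eqVneq p a; last by rewrite eqxx.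
    have [-> |_] := eqVneq q b; last by rewrite eqxx.
    move=> _; split=> //; last exact: wfree.
    rewrite /strict; case: ifP => // /negbT; rewrite -leqNgt leq_eqVlt.
    by case/orP => // /eqP/val_inj e; rewrite e eqxx in ab.
  - rewrite mulmxBr mulmx1 !mxE; have := wE b; rewrite mxE => ->.
    by rewrite wb eqxx sub0r oppr_eq0.
  - rewrite mulmxA (_ : w *m (1%:M - E) *m (1%:M + E) = w) //.
    have E1 : (1%:M - E) *m (1%:M + E) = 1%:M.
      by rewrite mulmxBl !mul1mx mulmxDr mulmx1 EE addr0 addrK.
    by rewrite -mulmxA E1 mulmx1.
  - move=> p; rewrite mulmxBr mulmx1 !mxE; have := wE p; rewrite mxE => ->.
    by have [-> //|pb] := eqVneq p b; rewrite subr0; exact: wfree.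
pose r := (w' 0 b)^-1 *: w'; pose c := (v b 0)^-1 *: v.
have Lr : L (with_row b r).
  apply: lift_with_row => // [|q]; first by rewrite mxE mulVf.
  by rewrite mxE mulf_eq0 negb_or => /andP[_ /w'free].
have Lc : L (with_col b c).
  apply: lift_with_col => // [|q]; first by rewrite mxE mulVf.
  by rewrite mxE mulf_eq0 negb_or => /andP[_ /vfree].
exists (with_row b r *m u0), (with_col b c), b; split=> //; first exact: LM.
move=> q; split.
  rewrite mxE big1 // => p _; rewrite -mulmxA with_row_mul /r -scalemxAl w'f scaler0 mxE.
  by rewrite mul0r.
by rewrite mul_with_col /c -scalemxAr -!mulmxA fv !mulmx0 scaler0 mxE.
Qed.

End KillRowCol.

(** * Lifting unitriangular matrices to invertible elements *)

Section Lifting.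
Variable R : realType.
Local Notation C := R[i].
Local Notation re := (@complex.Re R).
Variable D : dsh_algebra R.
Local Notation l := (dsh_last D).
Local Notation X := (dsh_space D).
Local Notation Y i := (@dsh_sub R D i).
Local Notation n := (@dsh_size R D).
Local Notation fam := (dsh_family D).
Local Notation carrier := (@dsh_carrier R D).

Definition unit_family (U : fam) :=
  carrier U /\ exists U', [/\ carrier U', U * U' = 1 & U' * U = 1].

(** [U] acts as the identity on the rows and columns where [e] equals [1]; so
multiplication by [U] preserves the zero crosses supported there. *)
Definition trivial_on (e U : fam) := forall k y p, e k y p p = 1 ->
  forall q, U k y p q = (p == q)%:R /\ U k y q p = (q == p)%:R.

Definition liftable (e : fam) (i : 'I_l.+1) (x : X i) (u : 'M[C]_(n i)) :=
  exists U, [/\ unit_family U, trivial_on e U & U i x = u].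

Lemma unitriangular_unit up N (M : 'M[C]_N) :
  (forall p q, M p q != 0 -> p = q \/ strict up p q) -> (forall p, M p p = 1) ->
  M \in unitmx.
Proof.
move=> hM M1; wlog: up M hM M1 / up = false.
  move=> h; case: up hM => hM; last exact: (h false).
  rewrite -unitmx_tr; apply: (h false) => // [p q|p]; rewrite mxE //.
  by move=> /hM[->|]; [left|right].
move=> upF; rewrite upF in hM; rewrite unitmxE unitfE det_trig.
  by rewrite big1 ?oner_eq0.
apply/is_trig_mxP => p q pq; apply/eqP; apply: contraT => /hM[e|].
  by rewrite e ltnn in pq.
by rewrite /strict ltnNge ltnW.
Qed.

Lemma liftableM (e : fam) (i : 'I_l.+1) (x : X i) u v : liftable e x u -> liftable e x v ->
  liftable e x (u *m v).
Proof.
move=> [U [[Uc [U' [U'c UU' U'U]]] Ut <-]] [V [[Vc [V' [V'c VV' V'V]]] Vt <-]].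
exists (U * V); split=> //; [split|].
- exact: carrierM.
- exists (V' * U'); split; first exact: carrierM.
    by rewrite mulrA -(mulrA U) VV' mulr1.
  by rewrite mulrA -(mulrA V') U'U mulr1.
move=> k y p ep q; have Up := Ut k y p ep; have Vp := Vt k y p ep.
rewrite -[(U * V) k y]/(U k y *m V k y) !mxE; split.
  rewrite (bigD1 p) //= big1 ?addr0 => [|r rp].
    by rewrite (Up p).1 eqxx mul1r (Vp q).1.
  by rewrite (Up r).1 eq_sym (negbTE rp) mul0r.
rewrite (bigD1 p) //= big1 ?addr0 => [|r rp].
  by rewrite (Vp p).2 eqxx mulr1 (Up q).2.
by rewrite (Vp r).2 (negbTE rp) mulr0.
Qed.

Lemma liftable1 (e : fam) (i : 'I_l.+1) (x : X i) : liftable e x 1%:M.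
Proof.
exists 1; split=> //.
  by split; [exact: carrier1|exists 1; rewrite mulr1; split=> //; exact: carrier1].
move=> k y p _ q; have E : (1 : fam) k y = 1%:M by [].
by rewrite E !mxE.
Qed.

(** Strict triangularity passes to block sums, because a layout preserves the order
inside each block. So [N] times a bump function extends to a strictly triangular
element, which is then compressed by [1 - e]; adding [1] gives an element with
unitriangular and therefore invertible values. *)
Lemma liftable_triangular (e : fam) (i : 'I_l.+1) (x : X i) up (N : 'M[C]_(n i)) :
  carrier e -> (forall k y, diag01 (e k y)) -> ~ Y i x ->
  (forall p q, N p q != 0 -> [/\ strict up p q, e i x p p = 0 & e i x q q = 0]) ->
  liftable e x (1%:M + N).
Proof.
move=> ec de nY hN.
have [f [cf f01 f0 f1]] := urysohn_point nY.
pose g (v : void) : fam := match v with end.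
pose P m (_ : void -> 'M[C]_m) := True.
pose Q m (_ : void -> 'M[C]_m) (M : 'M[C]_m) := forall p q, M p q != 0 -> strict up p q.
have gc a : carrier (g a) by case: a.
have Pg (k : 'I_l.+1) (y : X k) : P _ (fun a => g a k y) by [].
have natQ : natural_rel Q.
  move=> m t mk iota M Mk H Hk [L _] [h1 h2] hk.
  apply: (layout_ind L) => k a; apply: (layout_ind L) => k' b.
  have [e1|/eqP ne] := eqVneq k k'; last by rewrite h2 // eqxx.
  case: _ / e1 b => b; rewrite h1 => /hk; rewrite /strict.
  by have [[s sE] _ _] := L; rewrite !sE !ltn_add2l.
have ext : extendable_rel P Q.
  move=> T Z _ _ _ m G G0 _ _ cG0 QG0.
  exists (fun y => \matrix_(p, q) if strict up p q then G0 y p q else 0); split.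
  - apply: mx_continuous => p q; under eq_fun do rewrite mxE.
    by case: (strict up p q); [exact: continuous_mxE|exact: continuousC_cst].
  - move=> y Zy; apply/matrixP => p q; rewrite mxE; case: ifP => // nst.
    by apply/eqP; rewrite eq_sym; apply: contraT => /(QG0 y Zy); rewrite nst.
  - by move=> y p q; rewrite mxE; case: ifP => //; rewrite eqxx.
have Q0 m M : Q m M 0 by move=> p q; rewrite mxE eqxx.
have cb : continuous (fun y => (f y)%:C *: N).
  apply: continuous_scalemx; first exact: continuous_real_complex.
  by move=> y; exact: cvg_cst.
have bY y : Y i y -> (f y)%:C *: N = 0 by move=> Yy; rewrite f0 // scale0r.
have Qb y : Q _ (fun a => g a i y) ((f y)%:C *: N).
  by move=> p q; rewrite mxE mulf_eq0 negb_or => /andP[_ /hN[]].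
have [n0 [n0c n0E n0Q]] := carrier_ext_bump gc Pg natQ ext Q0 cb bY Qb.
pose n1 : fam := (1 - e) * n0 * (1 - e).
have n1c : carrier n1.
  by do 2?apply: carrierM => //; apply: carrierB => //; exact: carrier1.
have n1E k y p q : n1 k y p q = (1 - e k y p p) * n0 k y p q * (1 - e k y q q).
  by rewrite -cutoffE // => a b ab; exact: diag01E.
have Uc : carrier (1 + n1) by apply: carrierD => //; exact: carrier1.
have UE k y p q : (1 + n1) k y p q = (p == q)%:R + n1 k y p q.
  have E : (1 + n1) k y = 1%:M + n1 k y by [].
  by rewrite E !mxE.
have n1up k y p q : n1 k y p q != 0 -> strict up p q.
  rewrite n1E !mulf_eq0 !negb_or => /andP[/andP[_ h] _]; exact: n0Q h.
exists (1 + n1); split.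
- split=> //; apply: carrier_inv => // k y.
  apply: (@unitriangular_unit up) => [p q|p]; rewrite UE.
    by have [-> _|pq] := eqVneq p q; [left|rewrite add0r => /n1up; right].
  rewrite eqxx (_ : n1 _ _ _ _ = 0) ?addr0 //; apply/eqP; apply: contraT => /n1up.
  by rewrite /strict; case: (up); rewrite ltnn.
- move=> k y p ep q; rewrite !UE !n1E ep subrr !mul0r !mulr0 !addr0.
  by split.
apply/matrixP => p q; rewrite UE n1E mxE; congr (_ + _); first by rewrite mxE.
rewrite n0E f1 mxE mul1r.
have [->|/hN[_ -> ->]] := eqVneq (N p q) 0; first by rewrite mulr0 mul0r.
by rewrite subr0 mul1r mulr1.
Qed.

End Lifting.

(** * Bumps supported where a row and a column are small *)

Section SmallBump.
Variable R : realType.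
Local Notation C := R[i].
Local Notation re := (@complex.Re R).

Lemma le_foldr_min (x : R) (s : seq R) :
  (x <= foldr Num.min 1 s) = (x <= 1) && all (fun y => x <= y) s.
Proof. by elim: s => [|y s IH] /=; rewrite ?andbT // le_min IH andbCA. Qed.

Lemma continuous_foldr_min (X : topologicalType) (I : Type) (s : seq I) (F : I -> X -> R) :
  (forall a, continuous (F a)) ->
  continuous (fun x => foldr Num.min 1 [seq F a x | a <- s]).
Proof.
move=> cF; elim: s => [|a s IH] /=; first exact: continuousR_cst.
exact: (continuousR_min (cF a) IH).
Qed.

Variable eta : R.
Hypothesis eta0 : 0 < eta.

Definition room (r : R) : R := Num.max 0 (1 - r).

Lemma room0 : room 0 = 1.
Proof. by rewrite /room subr0 maxEle ler01. Qed.

Lemma continuous_room (X : topologicalType) (f : X -> R) :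
  continuous f -> continuous (fun x => room (f x)).
Proof.
move=> cf; apply: continuousR_max; first exact: continuousR_cst.
by apply: continuousR_D; [exact: continuousR_cst|exact: continuousR_N].
Qed.

Lemma room_ge0 r : 0 <= room r.
Proof. by rewrite /room le_max lexx. Qed.

Lemma room_gt0 r : 0 < room r -> r < 1.
Proof. by rewrite /room lt_max ltxx /= subr_gt0. Qed.

(** The value is [1] when [E p p] and the [p]-th row and column of [M] vanish, and it is
positive only if [E p p < 1] and the entries of that row and column are smaller
than [eta]. *)
Definition cross_room N (M E : 'M[C]_N) p : R := Num.min (room (re (E p p)))
  (foldr Num.min 1 [seq Num.min (room (normc (M p q) / eta)) (room (normc (M q p) / eta))
                   | q <- enum 'I_N]).

Lemma le_cross_room N (M E : 'M[C]_N) p x : x <= cross_room M E p <->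
  [/\ x <= 1, x <= room (re (E p p)), forall q, x <= room (normc (M p q) / eta)
    & forall q, x <= room (normc (M q p) / eta)].
Proof.
rewrite /cross_room le_min le_foldr_min; split.
  move=> /andP[h1 /andP[h2 /allP h3]]; split=> // q.
    have /h3 : Num.min (room (normc (M p q) / eta)) (room (normc (M q p) / eta)) \in
      [seq Num.min (room (normc (M p q) / eta)) (room (normc (M q p) / eta)) | q <- enum 'I_N].
      by apply: map_f; rewrite mem_enum.
    by rewrite le_min => /andP[].
  have /h3 : Num.min (room (normc (M p q) / eta)) (room (normc (M q p) / eta)) \in
    [seq Num.min (room (normc (M p q) / eta)) (room (normc (M q p) / eta)) | q <- enum 'I_N].
    by apply: map_f; rewrite mem_enum.
  by rewrite le_min => /andP[].
move=> [-> -> h1 h2] /=; apply/allP => _ /mapP[q _ ->].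
by rewrite le_min h1 h2.
Qed.

Lemma cross_room_ge0 N (M E : 'M[C]_N) p : 0 <= cross_room M E p.
Proof. by apply/le_cross_room; split; rewrite ?ler01 ?room_ge0 // => q; exact: room_ge0. Qed.

Lemma continuous_cross_room (X : topologicalType) N (M E : X -> 'M[C]_N) p :
  continuous M -> continuous E -> continuous (fun x => cross_room (M x) (E x) p).
Proof.
move=> cM cE; apply: continuousR_min.
  apply: continuous_room; apply: continuous_comp_fun (@Re_continuous R).
  exact: continuous_mxE.
apply: continuous_foldr_min => q; apply: continuousR_min; apply: continuous_room;
  apply: continuousR_M; try exact: continuousR_cst;
  by apply: continuous_normc; exact: continuous_mxE.
Qed.

(** The condition on a new mark [H]. Entries of [M true] outside the blocks are zero
and impose nothing, so the condition passes to block sums. *)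
Definition fits N (M : bool -> 'M[C]_N) (H : 'M[C]_N) :=
  diag01 H /\ forall p, re (H p p) <= cross_room (M true) (M false) p.

Lemma diag01_natural N t (n : 'I_t -> nat) (iota : forall k, 'I_(n k) -> 'I_N)
  (H : 'M[C]_N) (Hk : forall k, 'M[C]_(n k)) :
  layout iota -> block_diag iota H Hk -> (forall k, diag01 (Hk k)) -> diag01 H.
Proof.
move=> L [h1 h2] hk; split; last first.
  by apply: (layout_ind L) => k a; rewrite h1; case: (hk k) => _; exact.
apply: (layout_ind L) => k a; apply: (layout_ind L) => k' b.
have [e1|/eqP ne] := eqVneq k k'.
  case: _ / e1 b => b; rewrite !h1 (inj_eq (layout_inj L (k := k))).
  by case: (hk k) => -> _.
rewrite h2 //; case: eqP => // e2; case: ne.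
by case: L => _ _ inj; exact: inj _ _ _ _ e2.
Qed.

Lemma fits_natural : natural_rel fits.
Proof.
move=> N t n iota M Mk H Hk [L bd] bH hk.
split; first by apply: (diag01_natural L bH) => k; case: (hk k).
apply: (layout_ind L) => k a; rewrite bH.1.
case: (hk k) => dk /(_ a)/le_cross_room[r1 rE rM rM']; apply/le_cross_room; split=> //.
- by rewrite (bd false).1.
- apply: (layout_ind L) => k' b; have [e1|/eqP ne] := eqVneq k k'.
    by case: _ / e1 b => b; rewrite (bd true).1.
  by rewrite (bd true).2 // normc0 mul0r room0.
- apply: (layout_ind L) => k' b; have [e1|/eqP ne] := eqVneq k k'.
    by case: _ / e1 b => b; rewrite (bd true).1.
  by rewrite (bd true).2 ?normc0 ?mul0r ?room0 // => e; apply: ne.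
Qed.

(** Truncation to the interval between [0] and [cross_room] is a continuous retraction
onto the solutions. *)
Lemma fits_ext : extendable_rel (fun N (M : bool -> 'M[C]_N) => True) fits.
Proof.
move=> T Z _ _ _ N G G0 cG _ cG0 QG0.
pose h p y := Num.max 0 (Num.min (re (G0 y p p)) (cross_room (G true y) (G false y) p)).
exists (fun y => \matrix_(p, q) if p == q then (h p y)%:C else 0); split.
- apply: mx_continuous => p q; under eq_fun do rewrite mxE.
  case: (p == q); last exact: continuousC_cst.
  have c1 : continuous (fun y => re (G0 y p p)).
    by apply: continuous_comp_fun (@Re_continuous R); exact: continuous_mxE.
  have c2 := continuous_cross_room (p := p) (cG true) (cG false).
  have c3 := continuousR_min c1 c2.
  have c4 : continuous (h p).
    by apply: (continuousR_max (f := fun=> 0)) c3 => y; exact: cvg_cst.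
  exact: (continuous_real_complex c4).
- move=> y Zy; have [[d1 d2] r] := QG0 y Zy; apply/matrixP => p q; rewrite mxE [RHS]d1.
  case: eqP => // _; congr (_%:C); rewrite /h.
  have /andP[a b] := d2 p.
  by rewrite minEle (r p) maxEle a.
- move=> y; have hb p : 0 <= h p y <= cross_room (G true y) (G false y) p.
    by rewrite /h le_max lexx ge_max cross_room_ge0 ge_min lexx orbT.
  split; last by move=> p; rewrite mxE eqxx /=; case/andP: (hb p).
  split=> [p q|p]; rewrite !mxE ?eqxx //=.
  case/andP: (hb p) => -> /le_cross_room[]; by [].
Qed.

End SmallBump.

(** * Creating zero crosses *)

Section ZeroCrosses.
Variable R : realType.
Local Notation C := R[i].
Variable D : nat -> dsh_algebra R.
Variable phi : forall j, dsh_family (D j) -> dsh_family (D j.+1).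
Arguments phi : clear implicits.
Variables (A : cstarAlgType R) (mu : forall j, dsh_family (D j) -> A).
Arguments mu : clear implicits.
Hypothesis phi_diag : forall j, diagonal_hom (phi j).
Hypothesis A_lim : inductive_limit phi mu.
Variable j : nat.
Local Notation l := (dsh_last (D j)).
Local Notation X := (dsh_space (D j)).
Local Notation Y i := (@dsh_sub R (D j) i).
Local Notation n := (@dsh_size R (D j)).
Local Notation fam := (dsh_family (D j)).
Local Notation carrier := (@dsh_carrier R (D j)).
Local Notation re := (@complex.Re R).

(** The point belongs to the part of the spectrum that survives in the limit. *)
Definition alive (i : 'I_l.+1) (x : X i) := forall d, in_kernel mu d -> d i x = 0.

(** [d a] marks the indices of the [a]-th cross. The last condition prevents marks from
disappearing in the limit. *)
Definition zero_crosses (s : nat) (f : fam) (d : nat -> fam) :=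
  [/\ carrier f,
      forall a, (a < s)%N -> carrier (d a) /\ forall i x, diag01 (d a i x),
      forall a b, (a < s)%N -> (b < s)%N -> a <> b ->
        forall i x p, d a i x p p = 0 \/ d b i x p p = 0,
      forall a, (a < s)%N -> forall i x p, d a i x p p != 0 ->
        forall q, f i x p q = 0 /\ f i x q p = 0
    & forall a, (a < s)%N -> exists i x p, @alive i x /\ d a i x p p = 1].

Lemma not_near_invertible a : ~ near_invertible a ->
  exists2 e : R, 0 < e & forall b : A, near_invertible b -> e <= cnorm (a - b).
Proof.
move=> na; apply: contrapT => h; apply: na; apply: near_invertible_closed => e e0.
apply: contrapT => he; apply: h; exists e => // b nb; rewrite leNgt; apply/negP => ab.
by apply: he; exists b.
Qed.

Lemma invertible_near (a : A) : invertible a -> near_invertible a.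
Proof. by move=> ia e e0; exists a => //; rewrite subrr cnorm0. Qed.

Lemma mu_unit (U : fam) : unit_family U -> invertible (mu j U).
Proof.
move=> [Uc [U' [U'c UU' U'U]]]; exists (mu j U').
by rewrite -!(muM A_lim) // UU' U'U (mu1 phi_diag A_lim).
Qed.

Lemma mu_entries_le (h : fam) B eta : 0 <= eta -> (forall i : 'I_l.+1, (n i <= B)%N) ->
  carrier h -> (forall i x p q, normc (h i x p q) <= eta) ->
  cnorm (mu j h) <= B%:R ^+ 2 * eta.
Proof.
move=> eta0 nB hc hh; apply: (mu_norm_le phi_diag A_lim) => //.
  by rewrite mulr_ge0 // sqr_ge0.
by move=> i x; exact: opbound_entries.
Qed.

(** At each index at most one summand is nonzero. *)
Lemma diag01_sum (s : nat) (d : nat -> fam) i x :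
  (forall a, (a < s)%N -> diag01 (d a i x)) ->
  (forall a b, (a < s)%N -> (b < s)%N -> a <> b ->
        forall p, d a i x p p = 0 \/ d b i x p p = 0) ->
  diag01 (\sum_(a < s) d a i x) /\
  (forall a p, (a < s)%N -> d a i x p p != 0 ->
     (\sum_(a < s) d a i x) p p = d a i x p p).
Proof.
move=> dd orth; set S := \sum_(a < s) _.
have SE p q : S p q = \sum_(a < s) d a i x p q by rewrite /S summxE.
have Sa a p : (a < s)%N -> d a i x p p != 0 -> S p p = d a i x p p.
  move=> as_ dap; rewrite SE (bigD1 (Ordinal as_)) //= big1 ?addr0 // => b ba.
  have ab : a <> b by move=> e; case/eqP: ba; apply: val_inj.
  by case: (orth a b as_ (ltn_ord b) ab p) => [/eqP|//]; rewrite (negbTE dap).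
split=> //; split=> [p q|p].
  case: eqP => [<-|/eqP pq]; last by rewrite SE big1 // => a _; exact: diag01E (dd a (ltn_ord a)) pq.
  have [->//|Sp] := eqVneq (S p p) 0.
  have /sum_neq0[a dap] : \sum_(a < s) d a i x p p != 0 by rewrite -SE.
  by rewrite (Sa a p) //; exact: diag01_real (dd a (ltn_ord a)).
have [->//=|Sp] := eqVneq (S p p) 0; first by rewrite lexx ler01.
have /sum_neq0[a dap] : \sum_(a < s) d a i x p p != 0 by rewrite -SE.
by rewrite (Sa a p) //; case: (dd a (ltn_ord a)) => _; exact.
Qed.

Definition sat_fam (d : fam) : fam := fun i x => \matrix_(p, q) sat (d i x p q).
Definition trim_fam (d : fam) : fam := fun i x => \matrix_(p, q) trim (d i x p q).

Arguments sat_fam : clear implicits.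
Arguments trim_fam : clear implicits.

Lemma carrier_sat d : carrier d -> carrier (sat_fam d).
Proof.
move=> dc; apply: (@carrier_entrywise R (D j) unit (fun=> d) (fun z => sat (z tt))) => //.
  exact: sat0.
by move=> Z F cF; apply: continuous_sat; exact: cF.
Qed.

Lemma carrier_trim d : carrier d -> carrier (trim_fam d).
Proof.
move=> dc; apply: (@carrier_entrywise R (D j) unit (fun=> d) (fun z => trim (z tt))) => //.
  exact: trim0.
by move=> Z F cF; apply: continuous_trim; exact: cF.
Qed.

(** Let [E] be the sum of the marks. The element [g = f + kap E], for a small positive
[kap], still has a non-invertible image, hence a singular value at a surviving
point [x]. Its null vectors there are supported outside the crosses, since on the
crosses [g] is [kap E]. So the elimination of a row and a column takes place
outside the crosses; it is performed by invertible elements that are trivial where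
[e], the sum of the [sat (d a)], is [1]. The new mark [del] lives where the
eliminated row and column are small, which is why cutting [f1] by [1 - sat del] on
both sides is a small perturbation. *)
Lemma one_more_cross s f d : zero_crosses s f d -> ~ near_invertible (mu j f) ->
  exists f' d', zero_crosses s.+1 f' d' /\ ~ near_invertible (mu j f').
Proof.
move=> [fc dP orth zero live] nf.
have dc a (h : (a < s)%N) := (dP a h).1.
have dd a (h : (a < s)%N) := (dP a h).2.
pose E : fam := \sum_(a < s) d a.
have Ec : carrier E by apply: carrier_sum => a _; exact: dc.
have EE i x : E i x = \sum_(a < s) d a i x by rewrite /E sum_famE.
have Ed i x := diag01_sum (fun a h => dd a h i x) (fun a b ha hb ab => orth a b ha hb ab i x).
have [e0 e0_gt0 he0] := not_near_invertible nf.
(* This [kap] keeps the image of [f + kap E] within distance [e0] of [mu j f], and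
   [e0] bounds the distance from [mu j f] to the limits of invertible elements. *)
pose kap : R := e0 / (cnorm (mu j E) + 1).
have K0 : 0 < cnorm (mu j E) + 1 by rewrite ltr_wpDl // cnorm_ge0.
have kap0 : 0 < kap by rewrite divr_gt0.
have kapC : kap%:C != 0 :> C.
  by apply/eqP => h; have /eqP := @complexI R kap 0 h; rewrite gt_eqF.
pose g : fam := f + kap%:C *: E.
have gc : carrier g by apply: carrierD => //; exact: carrierZ.
have ng : ~ invertible (mu j g).
  move=> /invertible_near/he0; rewrite (muD A_lim) //; last exact: carrierZ.
  rewrite (muZ A_lim) // opprD addNKr cnormN cnormZ.
  have -> : normc kap%:C = kap by rewrite /= expr0n addr0 sqrtr_sqr gtr0_norm.
  rewrite leNgt /kap mulrAC ltr_pdivrMr // mulrDr mulr1 ltrDl e0_gt0 //.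
have [i [x [nY gx ax]]] := singular_surviving phi_diag A_lim gc ng.
pose free p := forall a, (a < s)%N -> d a i x p p = 0.
have gE : g i x = f i x + kap%:C *: E i x by [].
have EnF p : ~ free p -> E i x p p != 0 /\ forall q, f i x p q = 0 /\ f i x q p = 0.
  move=> nfp; have [a as_ dap] : exists2 a, (a < s)%N & d a i x p p != 0.
    apply: contrapT => h; apply: nfp => a as_; apply/eqP; apply: contrapT => /negP dap.
    by apply: h; exists a.
  have [_ Es] := Ed i x; split; first by rewrite EE (Es a p).
  exact: (zero a as_ i x p dap).
have EF p : free p -> E i x p p = 0.
  by move=> fp; rewrite EE summxE big1 // => a _; exact: fp.
have Edg a b : a != b -> E i x a b = 0.
  by move=> ab; rewrite EE; apply: diag01E ab; case: (Ed i x).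
have sgl : \det (g i x) = 0.
  by apply/eqP; move: gx; rewrite unitmxE unitfE negbK.
have [w w0 wg] : exists2 w : 'rV[C]_(n i), w != 0 & w *m g i x = 0.
  by apply/det0P; rewrite sgl.
have [v v0 gv] : exists2 v : 'cV[C]_(n i), v != 0 & g i x *m v = 0.
  have /det0P[v' v'0 v'g] : \det (g i x)^T == 0 by rewrite det_tr sgl.
  exists v'^T; first by rewrite -(inj_eq (@trmx_inj _ _ _)) trmxK trmx0.
  by rewrite -[g i x]trmxK -trmx_mul v'g trmx0.
have wE p : (w *m E i x) 0 p = w 0 p * E i x p p by
  rewrite mxE (bigD1 p) //= big1 ?addr0 // => r rp; rewrite Edg ?mulr0.
have vE p : (E i x *m v) p 0 = E i x p p * v p 0.
  by rewrite mxE (bigD1 p) //= big1 ?addr0 // => r rp; rewrite Edg ?mul0r // eq_sym.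
have wfree p : w 0 p != 0 -> free p.
  move=> wp; apply: contrapT => /EnF[Ep fp]; case/eqP: wp.
  have /matrixP/(_ 0 p) := wg; rewrite gE mulmxDr -scalemxAr.
  rewrite mxE [X in X + _]mxE big1 ?add0r => [|r _]; last by rewrite (fp r).2 mulr0.
  rewrite mxE wE mxE => /eqP; rewrite !mulf_eq0 (negbTE kapC) (negbTE Ep) orbF /=.
  by move/eqP.
have vfree p : v p 0 != 0 -> free p.
  move=> vp; apply: contrapT => /EnF[Ep fp]; case/eqP: vp.
  have /matrixP/(_ p 0) := gv; rewrite gE mulmxDl -scalemxAl.
  rewrite mxE [X in X + _]mxE big1 ?add0r => [|r _]; last by rewrite (fp r).1 mul0r.
  rewrite mxE vE mxE => /eqP; rewrite !mulf_eq0 (negbTE kapC) (negbTE Ep) /=.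
  by move/eqP.
have wf : w *m f i x = 0.
  have wE0 : w *m E i x = 0.
    apply/matrixP => z p; rewrite ord1 wE mxE.
    have [->|/wfree/EF ->] := eqVneq (w 0 p) 0; by rewrite ?mul0r ?mulr0.
  by move: wg; rewrite gE mulmxDr -scalemxAr wE0 scaler0 addr0.
have fv : f i x *m v = 0.
  have vE0 : E i x *m v = 0.
    apply/matrixP => p z; rewrite ord1 vE mxE.
    have [->|/vfree/EF ->] := eqVneq (v p 0) 0; by rewrite ?mul0r ?mulr0.
  by move: gv; rewrite gE mulmxDl -scalemxAl vE0 scaler0 addr0.
(* The element [e] is [1] on the supports of the new marks [trim (d a)], and [0]
   at [x] on the free indices: the lifted operations respect the former and are
   unrestricted on the latter. *)
pose e : fam := \sum_(a < s) sat_fam (d a).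
have ec : carrier e by apply: carrier_sum => a _; apply: carrier_sat; exact: dc.
have eE k y : e k y = \sum_(a < s) sat_fam (d a) k y by rewrite /e sum_famE.
have satE a k y p q : sat_fam (d a) k y p q = sat (d a k y p q) by rewrite mxE.
have sat_orth a b : (a < s)%N -> (b < s)%N -> a <> b ->
    forall k y p, sat_fam (d a) k y p p = 0 \/ sat_fam (d b) k y p p = 0.
  move=> ha hb ab k y p; rewrite !satE.
  by case: (orth a b ha hb ab k y p) => ->; rewrite sat0; [left|right].
have ed k y := diag01_sum (d := fun a => sat_fam (d a)) (fun a h => diag01_sat (dd a h k y))
   (fun a b ha hb ab => sat_orth a b ha hb ab k y).
have ed1 k y : diag01 (e k y) by rewrite eE; case: (ed k y).
have e_trim a k y p : (a < s)%N -> trim (d a k y p p) != 0 -> e k y p p = 1.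
  move=> as_ /trim_sat sp; have [_ es] := ed k y.
  by rewrite eE (es a p) // satE sp ?oner_eq0.
have e_free p : free p -> e i x p p = 0.
  by move=> fp; rewrite eE summxE big1 // => a _; rewrite satE fp // sat0.
have LT up (N : 'M[C]_(n i)) :
    (forall p q, N p q != 0 -> [/\ strict up p q, free p & free q]) ->
    liftable e x (1%:M + N).
  move=> hN; apply: (liftable_triangular (up := up)) => // p q /hN[st fp fq].
  by split=> //; exact: e_free.
have [u [u' [b [Lu Lu' fb cross]]]] := kill_row_col (@liftableM _ _ e i x) LT
   (@liftable1 _ _ e i x) v0 w0 fv wf vfree wfree.
case: Lu => U [UU Ut Ux]; case: Lu' => V [VV Vt Vx].
pose f1 : fam := U * f * V.
have f1c : carrier f1.
  apply: carrierM; last by case: VV.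
  by apply: carrierM => //; case: UU.
have nf1 : ~ near_invertible (mu j f1).
  rewrite /f1 (muM A_lim) ?(muM A_lim) //; try by [case: UU|case: VV|apply: carrierM => //; case: UU].
  by move/(near_invertibleM (mu_unit UU) (mu_unit VV)).
have f1E k y : f1 k y = U k y *m f k y *m V k y by [].
have f1z a k y p : (a < s)%N -> trim (d a k y p p) != 0 ->
    forall q, f1 k y p q = 0 /\ f1 k y q p = 0.
  move=> as_ tp q; have ep := e_trim a k y p as_ tp.
  have dp : d a k y p p != 0 by apply: contraNneq tp => ->; rewrite trim0.
  have fz := zero a as_ k y p dp.
  rewrite f1E; split.
    rewrite mxE big1 // => r _; rewrite mxE big1 ?mul0r // => r' _.
    rewrite (Ut k y p ep r').1; case: eqP => [<-|_]; last by rewrite mul0r.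
    by rewrite (fz r).1 mulr0.
  rewrite mxE big1 // => r _; rewrite (Vt k y p ep r).2; case: eqP => [->|_]; last by rewrite mulr0.
  by rewrite mulr1 mxE big1 // => r' _; rewrite (fz r').2 mulr0.
have [e1 e1_gt0 he1] := not_near_invertible nf1.
have [B hB] := size_bounded (D j).
pose eta : R := e1 / (B%:R ^+ 2 + 1).
have B0 : 0 < B%:R ^+ 2 + 1 :> R by rewrite ltr_wpDl // sqr_ge0.
have eta0 : 0 < eta by rewrite divr_gt0.
have Beta : B%:R ^+ 2 * eta < e1.
  by rewrite /eta mulrCA gtr_pMr // ltr_pdivrMr // mul1r ltrDl.
have [chi [cchi chi01 chi0 chi1]] := urysohn_point nY.
(* At [x] the row and the column [b] of [f1] are zero and [b] is free, so the room
   for the new mark is [1] there and [bump] can take the value [1]. *)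
pose cr y := cross_room eta (f1 i y) (e i y) b.
have ccr : continuous cr by apply: continuous_cross_room; exact: carrier_continuous.
have crx : cr x = 1.
  apply/eqP; rewrite eq_le; apply/andP; split.
    by have /le_cross_room[] := lexx (cr x).
  apply/le_cross_room; split=> // [|q|q]; rewrite ?e_free ?room0 //.
    by rewrite f1E Ux Vx (cross q).1 normc0 mul0r room0.
  by rewrite f1E Ux Vx (cross q).2 normc0 mul0r room0.
pose bump y : 'M[C]_(n i) := \matrix_(p, q) if (p == b) && (q == b) then (chi y * cr y)%:C else 0.
pose gg (c : bool) : fam := if c then f1 else e.
have ggc c : carrier (gg c) by case: c.
have Pg (k : 'I_l.+1) (y : X k) : (fun N (_ : bool -> 'M[C]_N) => True) _ (fun a => gg a k y) by [].
have Q0 N (M : bool -> 'M[C]_N) : fits eta M 0.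
  split; last by move=> p; rewrite mxE cross_room_ge0.
  by split=> [p q|p]; rewrite !mxE /= ?lexx ?ler01 //; case: eqP.
have cb : continuous bump.
  apply: mx_continuous => p q; under eq_fun do rewrite mxE.
  case: (_ && _); last exact: continuousC_cst.
  exact: continuous_real_complex (continuousR_M cchi ccr).
have bY y : Y i y -> bump y = 0.
  by move=> Yy; apply/matrixP => p q; rewrite !mxE chi0 // mul0r; case: ifP.
have cr_ge0 y : 0 <= cr y by exact: cross_room_ge0.
have cr_le1 y : cr y <= 1 by have /le_cross_room[] := lexx (cr y).
have Qb y : fits eta (fun a => gg a i y) (bump y).
  have bp p : re (bump y p p) = if p == b then chi y * cr y else 0.
    by rewrite mxE andbb; case: ifP.
  have /andP[c0 c1] := chi01 y.
  split; [split=> [p q|p]|move=> p]; rewrite ?bp.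
  - rewrite mxE; case: (p =P q) => [<-|/eqP pq]; first by rewrite andbb; case: ifP.
    by case: (p =P b) => [pb|//] /=; case: (q =P b) => // qb; rewrite pb qb eqxx in pq.
  - case: ifP => _; last by rewrite lexx ler01.
    by rewrite mulr_ge0 //=; apply: mulr_ile1.
  - case: (p =P b) => [->|_]; last exact: cross_room_ge0.
    by apply: ler_piMl.
have [del [delc delE delQ]] := carrier_ext_bump ggc Pg (@fits_natural R eta)
  (@fits_ext R eta) Q0 cb bY Qb.
have del01 k y : diag01 (del k y) by case: (delQ k y).
have delb : del i x b b = 1 by rewrite delE mxE eqxx /= chi1 crx mul1r.
have del_small k y p : 0 < re (del k y p p) ->
    [/\ re (e k y p p) < 1, forall q, normc (f1 k y p q) <= eta & forall q, normc (f1 k y q p) <= eta].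
  move=> del0; have [_ /(_ p)/(lt_le_trans del0) cr0] := delQ k y.
  have /le_cross_room[_ h1 h2 h3] := lexx (cross_room eta (gg true k y) (gg false k y) p).
  have lt_eta z : 0 < room (normc z / eta) -> normc z <= eta.
    by move/room_gt0; rewrite ltr_pdivrMr // mul1r => /ltW.
  split=> [|q|q]; first exact: room_gt0 (lt_le_trans cr0 h1).
    exact: lt_eta (lt_le_trans cr0 (h2 q)).
  exact: lt_eta (lt_le_trans cr0 (h3 q)).
pose e' := sat_fam del.
have e'c : carrier e' by exact: carrier_sat.
have e'd k y : diag01 (e' k y) by exact: diag01_sat.
pose f' : fam := (1 - e') * f1 * (1 - e').
have c1e : carrier (1 - e') by apply: carrierB => //; exact: carrier1.
have f'c : carrier f' by do 2?apply: carrierM.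
have f'E k y p q : f' k y p q = (1 - e' k y p p) * f1 k y p q * (1 - e' k y q q).
  by rewrite -cutoffE // => a c ac; exact: diag01E ac.
have e'_neq0 k y p : e' k y p p != 0 -> 0 < re (del k y p p).
  by rewrite /e' /sat_fam mxE => /sat_neq0.
have close k y p q : normc ((f1 - f') k y p q) <= eta.
  have -> : (f1 - f') k y p q = f1 k y p q * (1 - (1 - e' k y p p) * (1 - e' k y q q)).
    have -> : (f1 - f') k y p q = f1 k y p q - f' k y p q.
      by have E1 : (f1 - f') k y = f1 k y - f' k y by []; rewrite E1 !mxE.
    by rewrite f'E; ring.
  have small : normc (1 - (1 - e' k y p p) * (1 - e' k y q q)) <= 1.
    rewrite (diag01_real p (e'd k y)) (diag01_real q (e'd k y)).
    have [_ h] := e'd k y; have /andP[a0 a1] := h p; have /andP[c0 c1] := h q.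
    set r1 := re _ in a0 a1 *; set r2 := re _ in c0 c1 *.
    have -> : 1 - (1 - r1%:C) * (1 - r2%:C) = (1 - (1 - r1) * (1 - r2))%:C :> C.
      by rewrite !(rmorphB, rmorphM, rmorph1).
    have r0 : 0 <= (1 - r1) * (1 - r2) by apply: mulr_ge0; rewrite subr_ge0.
    have r1' : (1 - r1) * (1 - r2) <= 1 by apply: mulr_ile1; rewrite ?subr_ge0 // gerBl.
    by rewrite /= expr0n addr0 sqrtr_sqr ger0_norm ?subr_ge0 // gerBl.
  rewrite normcM.
  have [ep|/e'_neq0/del_small[_ hp _]] := eqVneq (e' k y p p) 0; last first.
    by apply: le_trans (ler_pM _ _ (hp q) small) _; rewrite ?mulr1 ?normc_ge0.
  have [eq_|/e'_neq0/del_small[_ _ hq]] := eqVneq (e' k y q q) 0; last first.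
    by apply: le_trans (ler_pM _ _ (hq p) small) _; rewrite ?mulr1 ?normc_ge0.
  by rewrite ep eq_ !subr0 mul1r subrr normc0 mulr0 ltW.
(* Trimming makes the marks smaller and orthogonal: [trim (d a)] is supported
   where [e] is [1], [trim del] where [e] is less than [1]. *)
pose d' a := if (a < s)%N then trim_fam (d a) else trim_fam del.
exists f', d'; split; last first.
  move=> /he1; rewrite -(muB A_lim) // => /(lt_le_trans Beta).
  rewrite ltNge => /negP; apply; apply: mu_entries_le => //; first exact: ltW.
  exact: carrierB.
have d'E a k y p : d' a k y p p = if (a < s)%N then trim (d a k y p p) else trim (del k y p p).
  by rewrite /d'; case: ifP => _; rewrite mxE.
have trim_e a k y p : (a < s)%N -> trim (d a k y p p) != 0 -> trim (del k y p p) = 0.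
  move=> as_ /(e_trim a k y p as_) ep; apply/eqP; apply: contraT => /trim_neq0/del_small[].
  by rewrite ep /= ltxx.
split=> //.
- move=> a; rewrite ltnS => as_; rewrite /d'; case: ifP => h.
    by split; [apply: carrier_trim; exact: dc|move=> k y; apply: diag01_trim; exact: dd].
  by split; [exact: carrier_trim|move=> k y; exact: diag01_trim].
- move=> a c as_ cs ac k y p; rewrite !d'E.
  have [ha|ha] := ltnP a s; have [hc|hc] := ltnP c s.
  + by case: (orth a c ha hc ac k y p) => ->; rewrite trim0; [left|right].
  + have [->|/(trim_e a k y p ha) ->] := eqVneq (trim (d a k y p p)) 0; by [left|right].
  + have [->|/(trim_e c k y p hc) ->] := eqVneq (trim (d c k y p p)) 0; by [right|left].
  + case: ac; rewrite ltnS in as_; rewrite ltnS in cs.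
    by transitivity s; apply: anti_leq; rewrite ?as_ ?cs ?ha ?hc.
- move=> a as_ k y p; rewrite d'E; case: ifP => ha; first move=> /(f1z a k y p ha) z q.
    by rewrite !f'E (z q).1 (z q).2 !mulr0 !mul0r.
  move=> /trim_sat sp q; have ep : e' k y p p = 1 by rewrite /e' /sat_fam mxE.
  by rewrite !f'E ep subrr !mul0r !mulr0.
- move=> a; rewrite ltnS leq_eqVlt => /orP[/eqP ->|as_].
    by exists i, x, b; split=> //; rewrite d'E ltnn delb trim1.
  have [k [y [p [al dp]]]] := live a as_.
  by exists k, y, p; split=> //; rewrite d'E as_ dp trim1.
Qed.

Lemma many_crosses s f : carrier f -> ~ near_invertible (mu j f) ->
  exists f' d', zero_crosses s f' d' /\ ~ near_invertible (mu j f').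
Proof.
move=> fc nf; elim: s => [|s [f' [d' [z nf']]]]; last exact: one_more_cross z nf'.
by exists f, (fun=> 0); split=> //; split.
Qed.

End ZeroCrosses.

(** * Rotations carrying a zero row through a matrix *)

Section Rotations.
Variable R : realType.
Local Notation C := R[i].
Implicit Types (t : nat -> R) (n a b p k m : nat) (tau x : R).

Definition elem n a b : 'M[C]_n := \matrix_(p, q) ((p == a :> nat) && (q == b :> nat))%:R.

(** A path of invertible matrices, built from shears so that it is polynomial in
[tau], from the identity to a quarter turn in the plane of the indices [a] and
[a.+1], which maps the basis vector [a] to the basis vector [a.+1]. *)
Definition rotation n a tau : 'M[C]_n :=
  (1%:M - tau%:C *: elem n a a.+1) *m (1%:M + tau%:C *: elem n a.+1 a)
    *m (1%:M - tau%:C *: elem n a a.+1).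

Definition clamp x : R := Num.min 1 (Num.max 0 x).

(** The progress of step [k] at time [x]. A step starts at time [k] and is completed at
time [k + 1 / 2], so that at most one step is in progress at any time. *)
Definition hop x k : R := clamp ((x - k%:R) *+ 2).

(** The first [k] of the steps that carry the index [p] towards [0], performed up to
time [x]. *)
Fixpoint hops n x p k : 'M[C]_n := match k with
  | 0 => 1%:M
  | k'.+1 => rotation n (p - k'.+1) (hop x k') *m hops n x p k'
  end.

(** All indices below [m] are carried towards [0], each one up to its own time [t p].
Those with [t p <= 0] do not move by themselves. *)
Fixpoint bubbles n t m : 'M[C]_n := match m with
  | 0 => 1%:M
  | m'.+1 => hops n (t m') m' m' *m bubbles n t m'
  end.

Lemma clamp_eq0 x : x <= 0 -> clamp x = 0.
Proof. by move=> x0; rewrite /clamp (max_idPl x0) minEle ler10. Qed.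

Lemma clamp_eq1 x : 1 <= x -> clamp x = 1.
Proof.
by move=> x1; rewrite /clamp (max_idPr _) ?(min_idPl x1) // (le_trans ler01).
Qed.

Lemma elem_mul0 n a b c d : b != c -> elem n a b *m elem n c d = 0.
Proof.
move=> bc; apply/matrixP => p q; rewrite !mxE big1 // => r _; rewrite !mxE.
have [rb|] := eqVneq (r : nat) b; last by rewrite andbF mul0r.
by rewrite rb (negbTE bc) /= mulr0.
Qed.

Lemma shear_unit n a b (c : C) : a != b -> 1%:M + c *: elem n a b \in unitmx.
Proof.
move=> ab; have /mulmx1_unit[] // :
  (1%:M + c *: elem n a b) *m (1%:M - c *: elem n a b) = 1%:M.
rewrite mulmxBr mulmx1 mulmxDl mul1mx -scalemxAl -scalemxAr elem_mul0 1?eq_sym //.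
by rewrite !scaler0 addr0 addrK.
Qed.

Lemma rot_unit n a tau : rotation n a tau \in unitmx.
Proof.
have aa : a != a.+1 by rewrite neq_ltn ltnSn.
have us c : 1%:M - c *: elem n a a.+1 \in unitmx by rewrite -scaleNr shear_unit.
have ut : 1%:M + tau%:C *: elem n a.+1 a \in unitmx by rewrite shear_unit // eq_sym.
by rewrite unitmx_mul us andbT unitmx_mul us ut.
Qed.

Lemma hops_unit n x p k : hops n x p k \in unitmx.
Proof. by elim: k => [|k IH] /=; rewrite ?unitmx1 // unitmx_mul rot_unit. Qed.

Lemma bubbles_unit n t m : bubbles n t m \in unitmx.
Proof. by elim: m => [|m IH] /=; rewrite ?unitmx1 // unitmx_mul hops_unit. Qed.

Lemma rotation0 n a : rotation n a 0 = 1%:M.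
Proof. by rewrite /rotation scale0r subr0 scale0r addr0 !mulmx1. Qed.

Lemma elemE n a b (M : 'M[C]_n) (r q : 'I_n) : (M *m elem n a b) r q =
  if q == b :> nat then \sum_(s < n | s == a :> nat) M r s else 0.
Proof.
rewrite mxE; case: (q =P b :> nat) => qb.
  rewrite [RHS]big_mkcond /=; apply: eq_bigr => s _; rewrite mxE qb eqxx andbT.
  by case: eqP; rewrite ?mulr1 ?mulr0.
by rewrite big1 // => s _; rewrite mxE; case: (q =P b :> nat) => // _; rewrite andbF mulr0.
Qed.

(** The column [a.+1] is excluded because the rightmost shear changes only that one. *)
Lemma rot_colE n a tau (r q : 'I_n) : q != a.+1 :> nat ->
  rotation n a tau r q = (r == q)%:R + tau%:C * (if q == a :> nat then
    \sum_(s < n | s == a.+1 :> nat) ((r == s)%:R - tau%:C * ((r == a :> nat) && (s == a.+1 :> nat))%:R)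
    else 0).
Proof.
move=> qa; rewrite /rotation; set S := elem n a a.+1; set T := elem n a.+1 a.
have subE (M N : 'M[C]_n) (c : C) (p p' : 'I_n) : (M - c *: N) p p' = M p p' - c * N p p'.
  by rewrite !mxE.
have addE (M N : 'M[C]_n) (c : C) (p p' : 'I_n) : (M + c *: N) p p' = M p p' + c * N p p'.
  by rewrite !mxE.
rewrite mulmxBr mulmx1 -scalemxAr subE elemE (negbTE qa) mulr0 subr0.
rewrite mulmxDr mulmx1 -scalemxAr addE elemE subE [S r q]mxE (negbTE qa) andbF mulr0 subr0.
rewrite [1%:M r q]mxE; congr (_ + _ * _); case: ifP => // _.
by apply: eq_bigr => s _; rewrite subE !mxE.
Qed.

Lemma rot_out n a tau (r q : 'I_n) : q != a.+1 :> nat -> q != a :> nat ->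
  rotation n a tau r q = (r == q)%:R.
Proof. by move=> q1 q2; rewrite rot_colE // (negbTE q2) mulr0 addr0. Qed.

Lemma rot_in n a tau (r q : 'I_n) : q = a :> nat -> (a.+1 < n)%N ->
  rotation n a tau r q != 0 ->
  (r == a :> nat) || (r == a.+1 :> nat) /\ (tau = 1 -> r = a.+1 :> nat).
Proof.
move=> qa an; have qa1 : q != a.+1 :> nat by rewrite qa neq_ltn ltnSn.
rewrite rot_colE // qa eqxx (big_pred1 (Ordinal an)) => [|s] //.
rewrite -!val_eqE /= eqxx andbT qa.
have [ra|ra] := eqVneq (r : nat) a.
  rewrite ra (ltn_eqF (ltnSn a)) /= sub0r mulr1 => h; split=> // t1.
  by move: h; rewrite t1 mulrN mulr1 subrr eqxx.
have [->|ra1] := eqVneq (r : nat) a.+1; first by rewrite orbT.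
by rewrite !mulr0n mulr0 subr0 mulr0 addr0 eqxx.
Qed.

Lemma eq_delta n (r q : 'I_n) : (r == q)%:R != 0 :> C -> r = q.
Proof. by have [//|_] := eqVneq r q; rewrite eqxx. Qed.

(** Before step [p - q.+1] the column [q] is untouched, and this step moves it to
[q.+1]; the later steps concern smaller indices only. A later step that has started
forces this one to be complete, hence no entry ever goes back up. *)
Lemma hops_lt n x p k (r q : 'I_n) : (k <= p < n)%N -> (q < p)%N ->
  hops n x p k r q != 0 ->
  ((q < p - k)%N -> r = q) /\
  ((p - k <= q)%N -> ((r == q :> nat) || (r == q.+1 :> nat)) /\
                    (hop x (p - q.+1) = 1 -> r = q.+1 :> nat)).
Proof.
elim: k r => [|k IH] r /andP[kp pn] qp /=.
  rewrite mxE subn0; have [-> _|_] := eqVneq r q; last by rewrite eqxx.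
  by split=> //; rewrite leqNgt qp.
set a := (p - k.+1)%N; have aE : (p - k = a.+1)%N by rewrite /a; lia.
have an : (a.+1 < n)%N by rewrite /a; lia.
have kpn : (k <= p < n)%N by rewrite (ltnW kp) pn.
move=> /mulmx_neq0[s hr /(IH s kpn qp)[h1 h2]].
rewrite aE in h1 h2.
have [qa|qa|qa] := ltngtP (q : nat) a.
- have sq : s = q by apply: h1; lia.
  rewrite sq rot_out ?neq_ltn in hr; try by rewrite ?qa ?(leqW qa).
  by rewrite (eq_delta hr); split=> //; lia.
- split; first by lia.
  move=> _; have [xk|xk] := leP x k%:R.
    have h0 : hop x k = 0 by apply: clamp_eq0; lra.
    rewrite h0 rotation0 mxE in hr; have rs : r = s by exact: eq_delta hr.
    by rewrite rs; apply: h2.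
  have h2' := h2 qa; have sq1 : s = q.+1 :> nat.
    apply: h2'.2; apply: clamp_eq1.
    have : (p - q.+1 < k)%N by lia.
    rewrite -(ler_nat R) -addn1 natrD; lra.
  rewrite rot_out in hr; try by rewrite sq1 /a; lia.
  have rs : r = s by exact: eq_delta hr.
  by rewrite rs sq1 eqxx orbT.
- have sq : s = q by apply: h1; lia.
  rewrite sq in hr; have [hr1 hr2] := rot_in qa an hr.
  split; first by lia.
  move=> _; rewrite qa; split=> // hx; apply: hr2; rewrite -hx; congr hop; lia.
Qed.

Lemma hops_gt n x p k (r q : 'I_n) : (k <= p)%N -> (p < q)%N ->
  hops n x p k r q = (r == q)%:R.
Proof.
elim: k r => [|k IH] r kp pq /=; first by rewrite mxE.
rewrite mxE (bigD1 q) //= big1 ?addr0 => [|s sq].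
  rewrite IH ?(ltnW kp) // eqxx mulr1 rot_out //; lia.
by rewrite IH ?(ltnW kp) // (negbTE sq) mulr0.
Qed.

Lemma hops_le0 n x p k : x <= 0 -> hops n x p k = 1%:M.
Proof.
move=> x0; elim: k => //= k ->; rewrite mulmx1 (_ : hop x k = 0) ?rotation0 //.
by apply: clamp_eq0; have := ler0n R k; lra.
Qed.

(** The number of indices above [q] that have completed their step past [q]. The margin
[1 / 2] makes this an open condition on [t] that holds at the maximal value
[t p = p]. *)
Definition passing t m (q : nat) : nat :=
  count (fun p => (q < p)%N && (p%:R - q%:R - 1 / 2 < t p)) (iota 0 m).

Lemma passingS t m q : passing t m.+1 q =
  (passing t m q + ((q < m)%N && (m%:R - q%:R - 1 / 2 < t m)%R))%N.
Proof. by rewrite /passing -[m.+1]addn1 iotaD count_cat /= addn0. Qed.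

(** Each passing index pushes the column [q] down by one. The second conclusion is the
induction invariant: as long as only indices below [m] have moved, the column stays
among them. *)
Lemma bubbles_col n t m (r q : 'I_n) : (m <= n)%N -> t q <= 0 ->
  bubbles n t m r q != 0 ->
  (q + passing t m q <= r)%N /\ ((r < m)%N \/ r = q).
Proof.
move=> mn tq; elim: m mn r => [|m IH] mn r /=.
  rewrite mxE /passing /=; have [-> _|_] := eqVneq r q; last by rewrite eqxx.
  by rewrite addn0; split=> //; right.
move=> /mulmx_neq0[s hr /(IH (ltnW mn) s)[h1 h2]].
rewrite passingS.
have [qm|qm|qm] := ltngtP (q : nat) m.
- have sm : (s < m)%N by case: h2 => // ->.
  have [_ []] := hops_lt (k := m) (p := m) (x := t m) (r := r) (q := s)
     (introT andP (conj (leqnn m) mn)) sm hr; first by rewrite subnn.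
  move=> hr1 hr2; split; last by left; case/orP: hr1 => /eqP ->; lia.
  case: (ltP (m%:R - q%:R - 1 / 2) (t m)) => tm; last first.
    by case/orP: hr1 => /eqP ->; lia.
  rewrite hr2 /=; first by lia.
  apply: clamp_eq1; rewrite natrB //.
  have : (q <= s)%N by lia.
  by rewrite -(ler_nat R) -(addn1 s) natrD; lra.
- have sq : s = q by case: h2 => // sm; lia.
  rewrite sq hops_gt // in hr.
  have rq : r = q by exact: eq_delta hr.
  by rewrite rq; split; [rewrite sq in h1; lia|right].
- have sq : s = q by case: h2 => // sm; apply: val_inj => /=; lia.
  rewrite -qm hops_le0 // mxE in hr.
  have rs : r = s by exact: eq_delta hr.
  by rewrite rs sq; split; [rewrite sq in h1; lia|right].
Qed.

End Rotations.

(** * Compatibility of the rotations with blocks *)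

Section RotationsNatural.
Variable R : realType.
Local Notation C := R[i].
Local Notation re := (@complex.Re R).
Local Notation im := (@complex.Im R).

Section Blocks.
Variables (N u : nat) (n : 'I_u -> nat) (iota : forall k, 'I_(n k) -> 'I_N).
Arguments iota : clear implicits.
Hypothesis L : layout iota.
Variable s : 'I_u -> nat.
Hypothesis sE : forall k a, iota k a = (s k + a)%N :> nat.

Lemma layout_pos k0 (a : nat) k (b : 'I_(n k)) : (a < n k0)%N ->
  (iota k b == (s k0 + a)%N :> nat) = (k == k0) && (b == a :> nat).
Proof.
move=> an; have -> : (s k0 + a)%N = iota k0 (Ordinal an) by rewrite sE.
have [e|ne] := eqVneq k k0.
  by case: _ / e an => an; rewrite !sE eqn_add2l.
by apply/eqP => /val_inj e; case: L => _ _ /(_ _ _ _ _ e) /eqP; rewrite (negbTE ne).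
Qed.

Lemma elem_block k0 (a b : nat) : (a < n k0)%N -> (b < n k0)%N ->
  block_diag iota (elem R N (s k0 + a) (s k0 + b))
    (fun k => if k == k0 then elem R (n k) a b else 0).
Proof.
move=> an bn; split=> [k p q|k k' p q ne]; rewrite mxE !layout_pos //.
  by case: (k == k0); rewrite !mxE.
have [e|_] := eqVneq k k0; last by [].
have [e'|_] := eqVneq k' k0; last by rewrite andbF.
by case: ne; rewrite e e'.
Qed.

Lemma block_diagB (M M' : 'M[C]_N) Mk Mk' : block_diag iota M Mk -> block_diag iota M' Mk' ->
  block_diag iota (M - M') (fun k => Mk k - Mk' k).
Proof.
move=> h1 h2; have := block_diagD h1 (block_diagZ (-1) h2).
by rewrite scaleN1r; congr block_diag; apply: functional_extensionality_dep => k;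
  rewrite scaleN1r.
Qed.

Lemma block_diag_congr (M : 'M[C]_N) Mk Mk' : (forall k, Mk k = Mk' k) ->
  block_diag iota M Mk -> block_diag iota M Mk'.
Proof. by move=> e; rewrite (functional_extensionality_dep e). Qed.

Lemma rot_block k0 (a : nat) (tau : R) : (a.+1 < n k0)%N ->
  block_diag iota (rotation N (s k0 + a) tau)
    (fun k => if k == k0 then rotation (n k) a tau else 1%:M).
Proof.
move=> an; have an' := ltnW an.
have b1 := elem_block an' an; have b2 := elem_block an an'; rewrite !addnS in b1 b2.
have b3 := block_diagB (block_diag1 R L) (block_diagZ tau%:C b1).
have b4 := block_diagD (block_diag1 R L) (block_diagZ tau%:C b2).
apply: block_diag_congr (block_diagM L (block_diagM L b3 b4) b3) => k /=.
by case: eqP => _ //; rewrite scaler0 subr0 addr0 !mulmx1.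
Qed.

(** As the time [x] is at most the position [a] of the index in its block, the steps
that would leave the block have not begun. *)
Lemma hops_block k0 (a : nat) (x : R) h : (a < n k0)%N -> x <= a%:R -> (h <= s k0 + a)%N ->
  block_diag iota (hops N x (s k0 + a) h)
    (fun k => if k == k0 then hops (n k) x a (minn h a) else 1%:M).
Proof.
move=> an xa; elim: h => [|h IH] hs /=.
  by apply: block_diag_congr (block_diag1 R L) => k; rewrite min0n; case: eqP.
have {IH} := IH (ltnW hs); have [ha|ha] := ltnP h a.
  have -> : (s k0 + a - h.+1 = s k0 + (a - h.+1))%N by lia.
  have an' : ((a - h.+1).+1 < n k0)%N by lia.
  move=> /(block_diagM L (rot_block (hop x h) an')); apply: block_diag_congr => k.
  rewrite (minn_idPl ha).
  by case: eqP => _ //; rewrite mulmx1.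
have -> : hop x h = 0.
  apply: clamp_eq0; have : (a%:R <= h%:R :> R) by rewrite ler_nat.
  lra.
rewrite rotation0 mul1mx; apply: block_diag_congr => k.
by rewrite (minn_idPr (leqW ha)).
Qed.

Lemma bubbles_block (t : nat -> R) (tk : forall k : 'I_u, nat -> R) m :
  (forall k (a : 'I_(n k)), t (s k + a)%N = tk k a /\ tk k a <= a%:R) -> (m <= N)%N ->
  block_diag iota (bubbles N t m) (fun k => bubbles (n k) (tk k) (minn (m - s k) (n k))).
Proof.
move=> ht; elim: m => [|m IH] mN /=.
  by apply: block_diag_congr (block_diag1 R L) => k; rewrite sub0n min0n.
have [_ cov inj] := L; have [k0 [a e]] := cov (Ordinal mN).
have mE : m = (s k0 + a)%N by rewrite -sE -e.
have [tm tka] := ht k0 a.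
have xa : t m <= a%:R by rewrite mE tm.
have hb := hops_block (ltn_ord a) xa (leqnn _); rewrite -mE in hb.
apply: block_diag_congr (block_diagM L hb (IH (ltnW mN))) => k.
case: eqP => [->|ne].
  have -> : (m.+1 - s k0 = a.+1)%N by rewrite mE; lia.
  have -> : (m - s k0 = a)%N by rewrite mE; lia.
  rewrite (minn_idPl (ltn_ord a)) (minn_idPl (ltnW (ltn_ord a))) /=.
  have am : (a <= m)%N by rewrite mE leq_addl.
  by rewrite (minn_idPr am) -tm -mE.
rewrite mul1mx; congr bubbles.
have [ms|sm] := ltnP m (s k).
  have e1 : (m.+1 - s k = 0)%N by lia.
  have e2 : (m - s k = 0)%N by lia.
  by rewrite e1 e2.
have [mn|nm] := ltnP (m - s k) (n k); last by rewrite !(minn_idPr _) //; lia.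
case: ne; apply/esym; apply: (inj _ _ a (Ordinal mn)); apply: val_inj.
by rewrite /= !sE /= -mE; lia.
Qed.

End Blocks.

(** The real parameters are stored on the diagonal of a complex matrix, real parts for
rows and imaginary parts for columns; extending both families then amounts to
extending one matrix. *)
Definition diag_nat (phi : C -> R) n (M : 'M[C]_n) (p : nat) : R :=
  if insub p is Some i then phi (M i i) else 0.

Lemma diag_natE phi n (M : 'M[C]_n) (p : 'I_n) : diag_nat phi M p = phi (M p p).
Proof. by rewrite /diag_nat valK. Qed.

Definition flip n (M : 'M[C]_n) : 'M[C]_n := \matrix_(p, q) M (rev_ord p) (rev_ord q).

Definition rowW n (M : 'M[C]_n) : 'M[C]_n := bubbles n (diag_nat re M) n.
(** Columns are carried in the opposite direction: this is [rowW] conjugated by the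
reversal of indices and transposed. *)
Definition colW n (M : 'M[C]_n) : 'M[C]_n := (flip (bubbles n (diag_nat im (flip M)) n))^T.

Lemma flipM n (M M' : 'M[C]_n) : flip (M *m M') = flip M *m flip M'.
Proof.
apply/matrixP => p q; rewrite !mxE (reindex_inj rev_ord_inj) /=.
by apply: eq_bigr => r _; rewrite !mxE.
Qed.

Lemma flip1 n : flip (1%:M : 'M[C]_n) = 1%:M.
Proof. by apply/matrixP => p q; rewrite !mxE (inj_eq rev_ord_inj). Qed.

Lemma flip_unit n (M : 'M[C]_n) : M \in unitmx -> flip M \in unitmx.
Proof.
by move=> u; case: (mulmx1_unit (_ : flip M *m flip (invmx M) = 1%:M)) => //;
   rewrite -flipM mulmxV // flip1.
Qed.

Lemma rowW_unit n (M : 'M[C]_n) : rowW M \in unitmx.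
Proof. exact: bubbles_unit. Qed.

Lemma colW_unit n (M : 'M[C]_n) : colW M \in unitmx.
Proof. by rewrite unitmx_tr flip_unit // bubbles_unit. Qed.

Definition passed (phi : C -> R) n (M : 'M[C]_n) (q : 'I_n) :=
  [set p : 'I_n | (q < p)%N && (p%:R - q%:R - 1 / 2 < phi (M p p))]%SET.

Definition passed_up (phi : C -> R) n (M : 'M[C]_n) (c : 'I_n) :=
  [set p : 'I_n | (p < c)%N && (c%:R - p%:R - 1 / 2 < phi (M p p))]%SET.

Lemma passing_card phi n (M : 'M[C]_n) (q : 'I_n) :
  passing (diag_nat phi M) n q = #|passed phi M q|.
Proof.
rewrite /passing -val_enum_ord -sum1_count big_map big_enum_cond /= -sum1_card.
by apply: eq_bigl => p; rewrite inE diag_natE.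
Qed.

Lemma rowW_supp n (M : 'M[C]_n) (r q : 'I_n) : re (M q q) <= 0 -> rowW M r q != 0 ->
  (q + #|passed re M q| <= r)%N.
Proof.
rewrite -passing_card -diag_natE => t0 h.
by case: (bubbles_col (leqnn n) t0 h).
Qed.

Lemma colW_supp n (M : 'M[C]_n) (c b : 'I_n) : im (M c c) <= 0 -> colW M c b != 0 ->
  (b + #|passed_up im M c| <= c)%N.
Proof.
move=> t0; rewrite /colW mxE [flip _ _ _]mxE => h.
have t0' : diag_nat im (flip M) (rev_ord c) <= 0 by rewrite diag_natE mxE rev_ordK.
have [] := bubbles_col (leqnn n) t0' h; rewrite passing_card => h1 _.
have -> : #|passed_up im M c| =
    #|passed im (flip M) (rev_ord c)|.
  rewrite -(card_imset _ rev_ord_inj); apply: eq_card => p.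
  rewrite -[p]rev_ordK; move: (rev_ord p) => p'.
  rewrite mem_imset; last exact: rev_ord_inj.
  rewrite !inE mxE rev_ordK /=; have pn := ltn_ord p'; have cn := ltn_ord c.
  have -> : (n - c.+1 < n - p'.+1)%N = (p' < c)%N by lia.
  congr (_ && (_ < _)).
  by rewrite !natrB // -(addn1 p') -(addn1 c) !natrD; ring.
have := ltn_ord b; have := ltn_ord c; move: h1 => /=; lia.
Qed.

Lemma rowW_natural N u (n : 'I_u -> nat) (iota : forall k, 'I_(n k) -> 'I_N)
    (M : 'M[C]_N) Mk : layout iota -> block_diag iota M Mk ->
  (forall k a, re (Mk k a a) <= a%:R) -> block_diag iota (rowW M) (fun k => rowW (Mk k)).
Proof.
move=> L [bd _] hk; have [[s sE] _ _] := L.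
have := bubbles_block L sE (t := diag_nat re M) (tk := fun k => diag_nat re (Mk k)) (m := N).
move=> /(_ _ (leqnn N)) h; apply: block_diag_congr (h _) => k.
  congr bubbles; case e : (n k) => [|m]; first by rewrite minn0.
  have km : (m < n k)%N by rewrite e.
  have := ltn_ord (iota k (Ordinal km)); rewrite sE /= => sm.
  by apply/minn_idPr; lia.
by move=> a; rewrite -sE !diag_natE bd.
Qed.

Lemma block_diag_tr N u (n : 'I_u -> nat) (iota : forall k, 'I_(n k) -> 'I_N)
  (M : 'M[C]_N) Mk : block_diag iota M Mk -> block_diag iota M^T (fun k => (Mk k)^T).
Proof.
move=> [h1 h2]; split=> [k a b|k k' a b ne]; rewrite !mxE ?h1 //.
by apply: h2 => e; apply: ne.
Qed.

Definition flip_layout N u (n : 'I_u -> nat) (iota : forall k, 'I_(n k) -> 'I_N) :=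
  fun k (a : 'I_(n k)) => rev_ord (iota k (rev_ord a)).

Lemma layout_flip N u (n : 'I_u -> nat) (iota : forall k, 'I_(n k) -> 'I_N) :
  layout iota -> layout (flip_layout iota).
Proof.
move=> [[s sE] cov inj]; split.
- exists (fun k => N - (s k + n k))%N => k a; rewrite /flip_layout /= sE /=.
  have := ltn_ord (iota k (Ordinal (_ : (n k).-1 < n k)%N)).
  have an := ltn_ord a; have kn : ((n k).-1 < n k)%N by rewrite prednK // (leq_ltn_trans _ an).
  have := ltn_ord (iota k (Ordinal kn)); rewrite sE /= => h _; lia.
- move=> p; have [k [a e]] := cov (rev_ord p); exists k, (rev_ord a).
  by rewrite /flip_layout rev_ordK -e rev_ordK.
- by move=> k k' a a' /rev_ord_inj/inj.
Qed.

Lemma block_diag_flip N u (n : 'I_u -> nat) (iota : forall k, 'I_(n k) -> 'I_N)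
    (M : 'M[C]_N) Mk : block_diag iota M Mk ->
  block_diag (flip_layout iota) (flip M) (fun k => flip (Mk k)).
Proof.
by move=> [h1 h2]; split=> [k a b|k k' a b ne]; rewrite !mxE !rev_ordK ?h1 // h2.
Qed.

Lemma colW_natural N u (n : 'I_u -> nat) (iota : forall k, 'I_(n k) -> 'I_N)
    (M : 'M[C]_N) Mk : layout iota -> block_diag iota M Mk ->
  (forall k (a : 'I_(n k)), im (Mk k a a) <= (n k - a.+1)%:R) ->
  block_diag iota (colW M) (fun k => colW (Mk k)).
Proof.
move=> L bd hk; apply: block_diag_tr.
have Lf := layout_flip L; have bf := block_diag_flip bd.
have h : block_diag (flip_layout iota) (bubbles N (diag_nat im (flip M)) N)
    (fun k => bubbles (n k) (diag_nat im (flip (Mk k))) (n k)).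
  have [[s sE] _ _] := Lf.
  have := bubbles_block Lf sE (t := diag_nat im (flip M))
    (tk := fun k => diag_nat im (flip (Mk k))) (m := N).
  move=> /(_ _ (leqnn N)) h; apply: block_diag_congr (h _) => k.
    congr bubbles; case e : (n k) => [|m]; first by rewrite minn0.
    have km : (m < n k)%N by rewrite e.
    have := ltn_ord (flip_layout iota (Ordinal km)); rewrite sE /= => sm.
    by apply/minn_idPr; lia.
  move=> a; rewrite -sE !diag_natE bf.1 mxE; split=> //.
  apply: le_trans (hk k (rev_ord a)) _; rewrite ler_nat /=.
  have := ltn_ord a; lia.
have := block_diag_flip h; rewrite (_ : flip_layout (flip_layout iota) = iota) //.
by apply: functional_extensionality_dep => k; apply: funext => a; rewrite /flip_layout !rev_ordK.
Qed.

Section WContinuous.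
Variable X : topologicalType.

Lemma continuous_bubbles n (t : X -> nat -> R) m :
  (forall p, continuous (fun x => t x p)) -> continuous (fun x => bubbles n (t x) m).
Proof.
move=> ct; elim: m => [|m IH] /=; first by move=> x; exact: cvg_cst.
apply: continuous_mulmx IH.
suff h k : continuous (fun x => hops n (t x m) m k) by exact: h.
elim: k => [|k IH] /=; first by move=> x; exact: cvg_cst.
apply: continuous_mulmx IH; apply: mx_continuous => p q.
have ch : continuous (fun x => (hop (t x m) k)%:C : C).
  apply: continuous_real_complex; apply: continuousR_min; first exact: continuousR_cst.
  apply: continuousR_max; first exact: continuousR_cst.
  have c1 : continuous (fun x => t x m - k%:R).
    exact: (continuousR_D (ct m) (@continuousR_cst R X (- k%:R))).
  exact: (continuousR_D c1 c1).
have c1 : continuous (fun _ : X => 1%:M : 'M[C]_n) by move=> x; exact: cvg_cst.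
have cE (c : C) a b : continuous (fun x => 1%:M + c *: ((hop (t x m) k)%:C *: elem R n a b)).
  apply: (continuous_addmx c1); apply: continuous_scalemx; first exact: continuousC_cst.
  by apply: (continuous_scalemx ch) => x; exact: cvg_cst.
pose a := (m - k.+1)%N.
have cS := cE (-1) a a.+1; have cT := cE 1 a.+1 a.
have crot : continuous (fun x => rotation n a (hop (t x m) k)).
  have -> : (fun x => rotation n a (hop (t x m) k)) = (fun x =>
      (1%:M + (-1) *: ((hop (t x m) k)%:C *: elem R n a a.+1)) *m
      (1%:M + 1 *: ((hop (t x m) k)%:C *: elem R n a.+1 a)) *m
      (1%:M + (-1) *: ((hop (t x m) k)%:C *: elem R n a a.+1))).
    by apply: funext => x; rewrite /rotation scaleN1r scale1r.
  exact: (continuous_mulmx (continuous_mulmx cS cT) cS).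
exact: (continuous_mxE (i := p) (j := q) crot).
Qed.

Lemma continuous_diag_nat (phi : C -> R) n (M : X -> 'M[C]_n) p : continuous phi ->
  continuous M -> continuous (fun x => diag_nat phi (M x) p).
Proof.
move=> cphi cM; rewrite /diag_nat; case: insub => [i|]; last exact: continuousR_cst.
by apply: continuous_comp_fun cphi; exact: continuous_mxE.
Qed.

Lemma continuous_flip n (M : X -> 'M[C]_n) : continuous M -> continuous (fun x => flip (M x)).
Proof.
move=> cM; apply: mx_continuous => p q; under eq_fun do rewrite mxE.
exact: continuous_mxE.
Qed.

Lemma continuous_rowW n (M : X -> 'M[C]_n) : continuous M -> continuous (fun x => rowW (M x)).
Proof.
move=> cM; apply: continuous_bubbles => p.
by apply: continuous_diag_nat => //; exact: Re_continuous.
Qed.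

Lemma continuous_colW n (M : X -> 'M[C]_n) : continuous M -> continuous (fun x => colW (M x)).
Proof.
move=> cM; apply: mx_continuous => p q; rewrite /colW; under eq_fun do rewrite mxE.
apply: continuous_mxE; apply: continuous_flip; apply: continuous_bubbles => r.
by apply: continuous_diag_nat; [exact: Im_continuous|exact: continuous_flip].
Qed.

End WContinuous.
End RotationsNatural.

(** * Choice of the rotation parameters *)

Section Steering.
Variable R : realType.
Local Notation C := R[i].
Local Notation re := (@complex.Re R).
Local Notation im := (@complex.Im R).

Section Soft.
Variable eta : R.
Hypothesis eta0 : 0 < eta.

(** Soft thresholding: continuous, and [0] on the numbers of modulus at most [eta]. *)
Definition soft (z : C) : C :=
  z * (Num.max 0 (normc z - eta) / Num.max eta (normc z))%:C.

Lemma soft0 : soft 0 = 0.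
Proof. by rewrite /soft mul0r. Qed.

Lemma soft_neq0 z : soft z != 0 -> eta <= normc z.
Proof.
apply: contraNT; rewrite -ltNge => h; rewrite /soft (_ : Num.max 0 _ = 0).
  by rewrite mul0r mulr0.
by apply/max_idPl; lra.
Qed.

Lemma soft_close z : normc (z - soft z) <= eta.
Proof.
rewrite /soft -{1}[z]mulr1 -mulrBr normcM.
have [h|h] := leP (normc z) eta.
  rewrite (_ : Num.max 0 _ = 0); last by apply/max_idPl; lra.
  by rewrite mul0r subr0 normc1 mulr1.
rewrite (max_idPr _) ?(max_idPr (ltW h)); last by lra.
have z0 : 0 < normc z by exact: lt_trans eta0 h.
have -> : 1 - ((normc z - eta) / normc z)%:C = (eta / normc z)%:C :> C.
  by rewrite -(rmorph1 (real_complex R)) -rmorphB; congr (_%:C); field; rewrite gt_eqF.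
rewrite /= expr0n addr0 sqrtr_sqr ger0_norm; last by rewrite divr_ge0 // ltW.
by rewrite mulrCA divff ?mulr1 // gt_eqF.
Qed.

Lemma continuous_soft (X : topologicalType) (f : X -> C) :
  continuous f -> continuous (fun x => soft (f x)).
Proof.
move=> cf; apply: (continuousC_M cf); apply: continuous_real_complex.
have cn := continuous_normc cf.
have ce : continuous (fun _ : X => eta) by exact: continuousR_cst.
have cN : continuous (fun x => Num.max 0 (normc (f x) - eta)).
  apply: continuousR_max; first exact: continuousR_cst.
  exact: (continuousR_D cn (continuousR_N ce)).
have cD := continuousR_max ce cn.
move=> x; apply: cvgM; first exact: cN.
apply: cvgV; last exact: cD.
by rewrite gt_eqF // lt_max eta0.
Qed.

End Soft.

Variables (eta K : R) (B Bq : nat).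
Hypothesis eta0 : 0 < eta.

(** The largest admissible parameter: it vanishes with [E p p], i.e. outside the
crosses, and it never exceeds [bound], the distance to the end of the matrix
towards which the index is carried. *)
Definition cap N (E : 'M[C]_N) (bound : nat) (p : 'I_N) : R :=
  Num.min bound%:R (K * re (E p p)).

(** Pushed down by the rows and to the left by the columns that pass it, every entry of
modulus at least [eta] ends strictly below the diagonal. The closed condition
[eta <= normc (M r c)] is what makes this property open in [M] and [H]. *)
Definition moved N (M H : 'M[C]_N) := forall r c : 'I_N, eta <= normc (M r c) ->
  (c < r + #|passed re H r| + #|passed_up im H c|)%N.

(** [M true] is the element to be made triangular and [M false] the sum of its marks. *)
Definition steers N (M : bool -> 'M[C]_N) (H : 'M[C]_N) :=
  [/\ forall p q, p != q -> H p q = 0,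
      forall p, 0 <= re (H p p) <= cap (M false) p p,
      forall p, 0 <= im (H p p) <= cap (M false) (N - p.+1) p
    & moved (M true) H].

(** There are [B] crosses in [M true], the lower bound on the marks allows the
parameters there to reach their maximal values, and [M true] has no entries [B] or
more places above the diagonal. *)
Definition steerable N (M : bool -> 'M[C]_N) :=
  [/\ (0 < B)%N /\ (N <= Bq)%N, forall p, 0 <= re (M false p p),
      forall p, M false p p != 0 -> forall q, M true p q = 0 /\ M true q p = 0,
      forall p q : 'I_N, M true p q != 0 -> (q < p + B)%N
    & exists pi : 'I_B -> 'I_N, injective pi /\
        forall a, M false (pi a) (pi a) != 0 /\ Bq%:R <= K * re (M false (pi a) (pi a))].

(** Distances to the ends of the matrix only grow when a block is placed in a larger
matrix, and so do the numbers of passing indices. *)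
Lemma steers_natural : natural_rel steers.
Proof.
move=> N t n iota M Mk H Hk [L bM] bH hk.
have [[s sE] _ _] := L; have [bH1 bH2] := bH.
have [bT1 bT2] := bM true; have [bF1 bF2] := bM false.
split.
- apply: (layout_ind L) => k a; apply: (layout_ind L) => k' b ne.
  have [e|/eqP nk] := eqVneq k k'; last exact: bH2.
  case: _ / e b ne => b ne; rewrite bH1; case: (hk k) => h _ _ _; apply: h.
  by apply: contra ne => /eqP ->.
- apply: (layout_ind L) => k a; rewrite bH1 /cap bF1.
  case: (hk k) => _ /(_ a)/andP[-> h] _ _ /=; apply: le_trans h _.
  by rewrite /cap le_min !ge_min lexx orbT andbT sE ler_nat leq_addl.
- apply: (layout_ind L) => k a; rewrite bH1 /cap bF1.
  case: (hk k) => _ _ /(_ a)/andP[-> h] _ /=; apply: le_trans h _.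
  rewrite /cap le_min !ge_min lexx orbT andbT sE ler_nat.
  have an := ltn_ord a; have kn : ((n k).-1 < n k)%N by rewrite prednK // (leq_ltn_trans _ an).
  have := ltn_ord (iota k (Ordinal kn)); rewrite sE /= => h'.
  apply/orP; left; lia.
- apply: (layout_ind L) => k a; apply: (layout_ind L) => k' b.
  have [e|/eqP nk] := eqVneq k k'; last by rewrite bT2 // normc0 leNgt eta0.
  case: _ / e b => b; rewrite bT1 => /(let: And4 _ _ _ h := hk k in h) h.
  have c1 : (#|passed re (Hk k) a| <= #|passed re H (iota k a)|)%N.
    rewrite -(card_imset _ (layout_inj L (k := k))); apply: subset_leq_card.
    apply/fintype.subsetP => _ /imsetP[p + ->]; rewrite !inE !sE bH1 ltn_add2l => /andP[-> h'].
    by rewrite /= !natrD; apply: le_lt_trans h'; lra.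
  have c2 : (#|passed_up im (Hk k) b| <= #|passed_up im H (iota k b)|)%N.
    rewrite -(card_imset _ (layout_inj L (k := k))); apply: subset_leq_card.
    apply/fintype.subsetP => _ /imsetP[p + ->]; rewrite !inE !sE bH1 ltn_add2l => /andP[-> h'].
    by rewrite /= !natrD; apply: le_lt_trans h'; lra.
  by rewrite !sE; lia.
Qed.

Lemma moved_mono N (M H H' : 'M[C]_N) : (forall p : 'I_N, re (H p p) <= re (H' p p)) ->
  (forall p : 'I_N, im (H p p) <= im (H' p p)) -> moved M H -> moved M H'.
Proof.
move=> hr hi mH r c /mH h; apply: leq_trans h _; rewrite -!addnA leq_add2l leq_add //;
  apply/subset_leq_card/fintype.subsetP => p; rewrite !inE => /andP[-> /=] /lt_le_trans; exact.
Qed.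

(** For [r <= c] each of the [B] crosses lies above [r] or below [c], hence passes the
entry [(r, c)]; and [c < r + B]. *)
Lemma moved_full N (M : bool -> 'M[C]_N) (H : 'M[C]_N) : steerable M ->
  (forall p : 'I_N, cap (M false) p p <= re (H p p)) ->
  (forall p : 'I_N, cap (M false) (N - p.+1) p <= im (H p p)) -> moved (M true) H.
Proof.
move=> [[B0 NB] _ zero band [pi [pi_inj hpi]]] hr hi r c hrc.
have M0 : M true r c != 0 by apply: contraTneq hrc => ->; rewrite normc0 -ltNge.
have [cr|rc] := ltnP c r; first by lia.
have ne a : pi a != r /\ pi a != c.
  have [p0 _] := hpi a; split; apply: contra M0 => /eqP e.
    by rewrite -e; have [-> _] := zero _ p0 c.
  by rewrite -e; have [_ ->] := zero _ p0 r.
have sub : (pi @: 'I_B \subset passed re H r :|: passed_up im H c)%SET.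
  apply/fintype.subsetP => _ /imsetP[a _ ->]; rewrite !inE.
  have [_ Ka] := hpi a; have [nr nc] := ne a.
  have capE b : (b <= N)%N -> cap (M false) b (pi a) = b%:R.
    move=> bN; rewrite /cap; apply/min_idPl; apply: le_trans Ka; rewrite ler_nat.
    exact: leq_trans bN NB.
  have [rp|pr] := ltnP r (pi a).
    apply/orP; left; apply: lt_le_trans (hr _); rewrite capE ?(ltnW (ltn_ord _)) //.
    by have := ler0n R r; lra.
  have pr' : (pi a < r)%N by rewrite ltn_neqAle pr andbT; exact: nr.
  apply/orP; right; rewrite (leq_trans pr' rc) /=.
  apply: lt_le_trans (hi _); rewrite capE ?leq_subr //.
  have pc : (pi a < c)%N by exact: leq_trans pr' rc.
  have cN := ltn_ord c.
  have : (c <= (N - (pi a).+1) + pi a)%N by lia.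
  by rewrite -(ler_nat R) natrD; lra.
have := subset_leq_card sub; rewrite card_imset // card_ord => BS.
have := leq_trans BS (leq_card_setU _ _); have := band _ _ M0; lia.
Qed.

Lemma near_moved (T : topologicalType) N (M H : T -> 'M[C]_N) y :
  continuous M -> continuous H -> moved (M y) (H y) ->
  \forall z \near y, moved (M z) (H z).
Proof.
move=> cM cH my.
have h1 (rc : 'I_N * 'I_N) : \forall z \near y,
    eta <= normc (M z rc.1 rc.2) -> eta <= normc (M y rc.1 rc.2).
  have [h|h] := leP eta (normc (M y rc.1 rc.2)); first by apply: nearW.
  have cn : continuous (fun z => normc (M z rc.1 rc.2)).
    by apply: continuous_normc; exact: continuous_mxE.
  apply: (@filterS _ (nbhs y) (nbhs_filter y) _ _ _ (cvgr_lt _ (cn y) _ h)).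
  by move=> z h2; rewrite leNgt h2.
have h2 (rp : 'I_N * 'I_N) (phi : C -> R) (b : R) : continuous phi -> \forall z \near y,
    b < phi (H y rp.2 rp.2) -> b < phi (H z rp.2 rp.2).
  move=> cphi; have [h|h] := ltP b (phi (H y rp.2 rp.2)); last first.
    by apply: nearW.
  have cn : continuous (fun z => phi (H z rp.2 rp.2)).
    by apply: continuous_comp_fun cphi; exact: continuous_mxE.
  apply: (@filterS _ (nbhs y) (nbhs_filter y) _ _ _ (cvgr_gt _ (cn y) _ h)).
  by move=> z h2 _.
have g1 := filter_forall (nbhs_filter y) h1.
have g2 := filter_forall (nbhs_filter y)
  (fun rp => h2 rp re (rp.2%:R - rp.1%:R - 1 / 2) (@Re_continuous R)).
have g3 := filter_forall (nbhs_filter y)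
  (fun rp => h2 rp im (rp.1%:R - rp.2%:R - 1 / 2) (@Im_continuous R)).
apply: filterS (filterI g1 (filterI g2 g3)) => z [z1 [z2 z3]] r c hz.
have := my r c (z1 (r, c) hz) => h; apply: leq_trans h _.
rewrite -!addnA leq_add2l leq_add //; apply/subset_leq_card/fintype.subsetP => p;
  rewrite !inE => /andP[-> /=].
  exact: (z2 (r, p)).
exact: (z3 (c, p)).
Qed.

Hypothesis K0 : 0 <= K.

(** The parameters are first truncated to the interval between [0] and their caps. The
truncated parameters still satisfy [moved] in a neighbourhood of [Z]; away from [Z] a
Urysohn function raises them to the caps, where [moved_full] applies. Raising
parameters does no harm, by [moved_mono]. *)
Lemma steers_ext : extendable_rel steerable steers.
Proof.
move=> T Z cT hT clZ N G G0 cG PG cG0 QG0.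
pose build (t u : 'I_N -> T -> R) y : 'M[C]_N :=
  \matrix_(p, q) if p == q then (t p y +i* u p y) else 0.
have cbuild t u : (forall p, continuous (t p)) -> (forall p, continuous (u p)) ->
    continuous (build t u).
  move=> ct cu; apply: mx_continuous => p q; rewrite /build; under eq_fun do rewrite mxE.
  by case: (p == q); [exact: continuous_complex|exact: continuousC_cst].
have reb t u y p : re (build t u y p p) = t p y by rewrite mxE eqxx.
have imb t u y p : im (build t u y p p) = u p y by rewrite mxE eqxx.
pose capr (p : 'I_N) (y : T) := cap (G false y) p p.
pose capi (p : 'I_N) (y : T) := cap (G false y) (N - p.+1) p.
have ccap b (p : 'I_N) : continuous (fun y => cap (G false y) b p).
  have cre : continuous (fun y => re (G false y p p)).
    exact: (continuous_comp_fun (continuous_mxE (i := p) (j := p) (cG false)) (@Re_continuous R)).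
  exact: (continuousR_min (@continuousR_cst R T b%:R)
    (continuousR_M (@continuousR_cst R T K) cre)).
have cap0 b (p : 'I_N) y : 0 <= cap (G false y) b p.
  by rewrite /cap le_min ler0n mulr_ge0 //; case: (PG y) => _ h _ _ _; exact: h.
pose t0 (p : 'I_N) (y : T) := Num.max 0 (Num.min (re (G0 y p p)) (capr p y)).
pose u0 (p : 'I_N) (y : T) := Num.max 0 (Num.min (im (G0 y p p)) (capi p y)).
have ct0 (p : 'I_N) : continuous (t0 p).
  have cr : continuous (fun y => re (G0 y p p)).
    exact: (continuous_comp_fun (continuous_mxE (i := p) (j := p) cG0) (@Re_continuous R)).
  exact: (continuousR_max (@continuousR_cst R T 0) (continuousR_min cr (ccap _ _))).
have cu0 (p : 'I_N) : continuous (u0 p).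
  have cr : continuous (fun y => im (G0 y p p)).
    exact: (continuous_comp_fun (continuous_mxE (i := p) (j := p) cG0) (@Im_continuous R)).
  exact: (continuousR_max (@continuousR_cst R T 0) (continuousR_min cr (ccap _ _))).
have b0Z y : Z y -> build t0 u0 y = G0 y.
  move=> Zy; have [dg hr hi _] := QG0 y Zy; apply/matrixP => p q; rewrite mxE.
  case: (p =P q) => [<-|/eqP pq]; last by rewrite dg.
  have /andP[r0 r1] := hr p; have /andP[i0 i1] := hi p.
  rewrite /t0 /u0 (min_idPl r1) (max_idPr r0) (min_idPl i1) (max_idPr i0).
  by case: (G0 y p p).
pose O := [set y | moved (G true y) (build t0 u0 y)].
have ZO : Z `<=` O°.
  move=> y Zy.
  have my : moved (G true y) (build t0 u0 y) by rewrite (b0Z y Zy); case: (QG0 y Zy).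
  exact: (near_moved (cG true) (cbuild t0 u0 ct0 cu0) my).
have [|chi [cchi chi01 chi0 chi1]] := @urysohn_closed R T cT hT Z clZ (~` O°)
    (open_closedC (@open_interior _ O)).
  by rewrite -subset0 => y [nO /ZO].
pose t (p : 'I_N) (y : T) := Num.max (t0 p y) (chi y * capr p y).
pose u (p : 'I_N) (y : T) := Num.max (u0 p y) (chi y * capi p y).
have ct (p : 'I_N) : continuous (t p) by exact: (continuousR_max (ct0 p) (continuousR_M cchi (ccap _ _))).
have cu (p : 'I_N) : continuous (u p) by exact: (continuousR_max (cu0 p) (continuousR_M cchi (ccap _ _))).
have t0_ge0 p y : 0 <= t0 p y by rewrite /t0 le_max lexx.
have u0_ge0 p y : 0 <= u0 p y by rewrite /u0 le_max lexx.
have t0_le p y : t0 p y <= capr p y by rewrite /t0 ge_max cap0 ge_min lexx orbT.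
have u0_le p y : u0 p y <= capi p y by rewrite /u0 ge_max cap0 ge_min lexx orbT.
have chi_le (p : 'I_N) b y : chi y * cap (G false y) b p <= cap (G false y) b p.
  by have /andP[c0 c1] := chi01 y; exact: ler_piMl.
exists (build t u); split.
- exact: cbuild.
- move=> y Zy; rewrite -b0Z //; apply/matrixP => p q; rewrite !mxE.
  case: eqP => // _; rewrite /t /u chi0 // !mul0r.
  by rewrite (max_idPl (t0_ge0 _ _)) (max_idPl (u0_ge0 _ _)).
move=> y; split.
- by move=> p q pq; rewrite mxE (negbTE pq).
- move=> p; rewrite reb /t le_max t0_ge0 ge_max t0_le; exact: chi_le.
- move=> p; rewrite imb /u le_max u0_ge0 ge_max u0_le; exact: chi_le.
have [Oy|nOy] := pselect (O° y).
  apply: (moved_mono (H := build t0 u0 y)).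
  - by move=> p; rewrite !reb /t le_max lexx.
  - by move=> p; rewrite !imb /u le_max lexx.
  exact: (interior_subset Oy).
apply: moved_full (PG y) _ _ => p.
  by rewrite reb /t le_max chi1 // mul1r lexx orbT.
by rewrite imb /u le_max chi1 // mul1r lexx orbT.
Qed.

End Steering.

(** * Passage to strictly lower triangular form *)

Section Lowering.
Variable R : realType.
Local Notation C := R[i].
Local Notation re := (@complex.Re R).
Local Notation im := (@complex.Im R).

Definition strictly_lower N (T : 'M[C]_N) := forall r c : 'I_N, T r c != 0 -> (c < r)%N.

Lemma strictly_lower_unit N (T : 'M[C]_N) (e : C) : strictly_lower T -> e != 0 ->
  T + e%:M \in unitmx.
Proof.
move=> lT e0; have tT : is_trig_mx (T + e%:M).
  apply/is_trig_mxP => r c rc; rewrite !mxE [_ == _](ltn_eqF rc) mulr0n addr0.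
  by apply/eqP; apply: contraT => /lT; rewrite ltnNge ltnW.
rewrite unitmxE (det_trig tT) unitfE; apply/prodf_neq0 => r _; rewrite !mxE eqxx mulr1n.
rewrite (_ : T r r = 0) ?add0r //; apply/eqP; apply: contraT => /lT.
by rewrite ltnn.
Qed.

Variables (eta K : R) (B Bq : nat).

(** The properties of the marks [inl a], of the element [inr true] and of its softened
form [inr false] that are transported to a later stage. The fourth one expresses
that nonzero entries lie in blocks of size at most [B]. *)
Definition cross_pattern N (M : nat + bool -> 'M[C]_N) :=
  [/\ forall a, diag01 (M (inl a)),
      forall a b, a <> b -> forall p, M (inl a) p p = 0 \/ M (inl b) p p = 0,
      forall a p, M (inl a) p p != 0 ->
        forall q, M (inr true) p q = 0 /\ M (inr true) q p = 0,
      forall p q : 'I_N, M (inr true) p q != 0 -> (q < p + B)%N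
    & forall p q, M (inr false) p q != 0 -> eta <= normc (M (inr true) p q)].

Lemma cross_pattern_natural : natural_pred cross_pattern.
Proof.
move=> N t n iota M Mk _ _ [L bd] hk; have [[s sE] _ _] := L.
have b1 a := (bd a).1; have b2 a := (bd a).2.
split.
- by move=> a; apply: (diag01_natural L (bd _)) => k; case: (hk k).
- move=> a b ab; apply: (layout_ind L) => k p; rewrite !b1.
  by case: (hk k) => _ h _ _ _; exact: h.
- move=> a; apply: (layout_ind L) => k p; rewrite b1 => hp.
  apply: (layout_ind L) => k' q; have [e|/eqP nk] := eqVneq k k'.
    by case: _ / e q => q; rewrite !b1; case: (hk k) => _ _ h _ _; exact: h hp _.
  by rewrite !b2 // => e; apply: nk.
- apply: (layout_ind L) => k p; apply: (layout_ind L) => k' q.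
  have [e|/eqP nk] := eqVneq k k'; last by rewrite b2 // eqxx.
  case: _ / e q => q; rewrite !b1 => h; case: (hk k) => _ _ _ /(_ p q h) hb _.
  by rewrite !sE; lia.
apply: (layout_ind L) => k p; apply: (layout_ind L) => k' q.
have [e|/eqP nk] := eqVneq k k'; last by rewrite b2 // eqxx.
by case: _ / e q => q; rewrite !b1; case: (hk k) => _ _ _ _; exact.
Qed.

Hypothesis eta0 : 0 < eta.

(** A nonzero entry [(r, c)] of the product comes from an entry [(q, b)] of [F] of
modulus at least [eta] in [M true]. Its row and its column are not in a cross, so
they do not move by themselves and are pushed by the passing crosses. *)
Lemma steers_lower N (M : bool -> 'M[C]_N) (F H : 'M[C]_N) :
  steerable K B Bq M -> steers eta K M H -> (forall p q, F p q != 0 -> eta <= normc (M true p q)) ->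
  strictly_lower (rowW H *m F *m colW H).
Proof.
move=> [_ _ zero _ _] [_ hr hi mv] hF r c.
move=> /mulmx_neq0[b /mulmx_neq0[q rq /hF Fqb] cb].
have Mqb : M true q b != 0 by apply: contraTneq Fqb => ->; rewrite normc0 -ltNge.
have Eq : M false q q = 0.
  by apply/eqP; apply: contraT => /zero/(_ b)[e _]; rewrite e eqxx in Mqb.
have Eb : M false b b = 0.
  by apply/eqP; apply: contraT => /zero/(_ q)[_ e]; rewrite e eqxx in Mqb.
have hq0 : re (H q q) <= 0.
  have /andP[_ h] := hr q; apply: le_trans h _.
  by rewrite /cap Eq mulr0 ge_min lexx orbT.
have hb0 : im (H b b) <= 0.
  have /andP[_ h] := hi b; apply: le_trans h _.
  by rewrite /cap Eb mulr0 ge_min lexx orbT.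
have h1 := rowW_supp hq0 rq; have h2 := colW_supp hb0 cb.
have := mv _ _ Fqb; lia.
Qed.

End Lowering.

Section LowerFamily.
Variable R : realType.
Local Notation C := R[i].
Local Notation re := (@complex.Re R).
Local Notation im := (@complex.Im R).
Variable D : dsh_algebra R.
Local Notation l := (dsh_last D).
Local Notation X := (dsh_space D).
Local Notation n := (@dsh_size R D).
Local Notation fam := (dsh_family D).
Local Notation carrier := (@dsh_carrier R D).

Lemma uniform_bound (T : finType) (P : T -> R -> Prop) :
  (forall t K K', K <= K' -> P t K -> P t K') -> (forall t, exists K, P t K) ->
  exists2 K, 0 <= K & forall t, P t K.
Proof.
move=> mono /choice[k hk]; exists (\sum_t `|k t|); first exact: sumr_ge0.
move=> t; apply: mono (hk t); apply: le_trans (ler_norm _) _.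
by rewrite (bigD1 t) //= lerDl sumr_ge0.
Qed.

(** The trace of a nowhere zero mark is bounded below by compactness, and some diagonal
entry is at least the mean. *)
Lemma large_entry (d : fam) (b : nat) (i : 'I_l.+1) : carrier d -> (n i <= b)%N ->
  (forall x, diag01 (d i x)) -> (forall x, d i x != 0) ->
  exists K, forall x, exists p, d i x p p != 0 /\ b%:R <= K * re (d i x p p).
Proof.
move=> dc nb dd dn.
have ci : compact [set: X i] by apply: dsh_compact; rewrite -ltnS ltn_ord.
pose S x := \sum_(p < n i) re (d i x p p).
have re0 x p : 0 <= re (d i x p p) by case: (dd x) => _ /(_ p)/andP[].
have S0 x : 0 < S x.
  rewrite lt_neqAle sumr_ge0 // andbT eq_sym; apply: contra (dn x) => /eqP e.
  apply/eqP/matrixP => p q; case: (dd x) => -> _; rewrite mxE; case: eqP => // _.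
  by rewrite (psumr_eq0P (P := xpredT) (fun p _ => re0 x p) e) //.
have cS : continuous S.
  apply: continuousR_sum => p.
  exact: (continuous_comp_fun (continuous_mxE (i := p) (j := p) (carrier_continuous dc))
    (@Re_continuous R)).
have cV : continuous (fun x => b%:R ^+ 2 * (S x)^-1).
  apply: (continuousR_M (@continuousR_cst R (X i) (b%:R ^+ 2))) => x.
  by apply: cvgV; [rewrite gt_eqF|exact: cS].
have [K hK] := continuous_bounded ci cV; exists K => x.
have [p hp] : exists p, S x <= (n i)%:R * re (d i x p p).
  apply: contrapT => h; have : S x < S x; last by rewrite ltxx.
  have ni : (0 < n i)%N by apply: dsh_size_gt0; rewrite -ltnS.
  have n0 : 0 < (n i)%:R :> R by rewrite ltr0n.
  have lt p : re (d i x p p) < S x / (n i)%:R.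
    rewrite ltr_pdivlMr // mulrC ltNge; apply/negP => hp; apply: h; by exists p.
  have : S x < \sum_(p < n i) (S x / (n i)%:R).
    apply: ltr_sum; first by apply/hasP; exists (Ordinal ni); rewrite ?mem_index_enum.
    by move=> p _.
  by rewrite sumr_const card_ord -(mulr_natr (S x / _)) divfK // gt_eqF.
have rp : 0 < re (d i x p p).
  rewrite lt_neqAle re0 andbT; apply: contraTneq hp => <-.
  by rewrite mulr0 -ltNge.
exists p; split.
  by apply: contraTneq rp => ->; rewrite ltxx.
have nR : (n i)%:R <= b%:R :> R by rewrite ler_nat.
have Sb : S x <= b%:R * re (d i x p p) by apply: le_trans hp _; rewrite ler_wpM2r.
apply: (@le_trans _ _ (b%:R ^+ 2 * (S x)^-1 * re (d i x p p))); last first.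
  by rewrite ler_wpM2r // ltW.
rewrite mulrAC ler_pdivlMr // expr2 -mulrA ler_wpM2l ?ler0n //.
Qed.

Variables (eta : R) (B : nat).
Hypotheses (eta0 : 0 < eta) (B0 : (0 < B)%N).

Lemma lower_conjugate (g : nat + bool -> fam) : (forall a, carrier (g a)) ->
  (forall i x, cross_pattern eta B (fun a => g a i x)) ->
  (forall a, (a < B)%N -> forall i x, g (inl a) i x != 0) ->
  exists U V, [/\ unit_family U, unit_family V
    & forall i x, strictly_lower ((U * g (inr false) * V) i x)].
Proof.
move=> gc gX gn.
have gd a i x : diag01 (g (inl a) i x) by case: (gX i x).
have [Bq nB] := size_bounded D.
have [K K0 hK] : exists2 K, 0 <= K & forall t : 'I_B * 'I_l.+1, forall x, exists p,
    g (inl (t.1 : nat)) t.2 x p p != 0 /\ Bq%:R <= K * re (g (inl (t.1 : nat)) t.2 x p p).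
  apply: uniform_bound => [t K K' KK' h x|t].
    have [p [p0 hp]] := h x; exists p; split=> //; apply: le_trans hp _.
    by rewrite ler_wpM2r //; case: (gd t.1 t.2 x) => _ /(_ p)/andP[].
  by apply: large_entry => // x; exact: gn.
pose E : fam := \sum_(a < B) g (inl (a : nat)).
have Ec : carrier E by apply: carrier_sum.
pose G b := if b then g (inr true) else E.
have Gc b : carrier (G b) by case: b; [exact: gc|exact: Ec].
have Eix i x : E i x = \sum_(a < B) g (inl (a : nat)) i x by rewrite /E sum_famE.
have orth a b (i : 'I_l.+1) (x : X i) (p : 'I_(n i)) : a <> b -> g (inl a) i x p p = 0 \/ g (inl b) i x p p = 0.
  by move=> ab; case: (gX i x) => _ h _ _ _; exact: h.
have [Edd EE] : (forall i x, diag01 (E i x)) /\ (forall (i : 'I_l.+1) (x : X i) a (p : 'I_(n i)), (a < B)%N ->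
    g (inl a) i x p p != 0 -> E i x p p = g (inl a) i x p p).
  have h (i : 'I_l.+1) (x : X i) := @diag01_sum R (fun=> D) 0 B (fun a => g (inl a)) i x
    (fun a _ => gd a i x) (fun a b _ _ ab p => orth a b i x p ab).
  by split=> i x; rewrite Eix; case: (h i x) => // _ h2 a p; exact: h2.
have GP (i : 'I_l.+1) x : steerable K B Bq (fun b => G b i x).
  have [_ _ zero band _] := gX i x; rewrite /G /=; split=> //.
  - by move=> p; have [_ h] := Edd i x; have /andP[h0 _] := h p; exact: h0.
  - by move=> p; rewrite (Eix i x) summxE => /sum_neq0[a ha]; exact: zero ha.
  have /choice[pi hpi] : forall a : 'I_B, exists p : 'I_(n i), g (inl (a : nat)) i x p p != 0 /\
      Bq%:R <= K * re (g (inl (a : nat)) i x p p) by move=> a; exact: (hK (a, i)).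
  exists pi; split=> [a b e|a].
    apply: contrapT => ab; have [a0 _] := hpi a; have [b0 _] := hpi b.
    have nab : (a : nat) <> b by move=> e'; apply: ab; exact: val_inj.
    case: (orth a b i x (pi a) nab) => e'; first by rewrite e' eqxx in a0.
    by rewrite e in e'; rewrite e' eqxx in b0.
  by have [a0 ha] := hpi a; rewrite (EE i x a) //.
have [h [hc hS]] := carrier_ext Gc GP (steers_natural eta0)
  (steers_ext (B := B) (Bq := Bq) eta0 K0).
pose U : fam := fun i x => rowW (h i x).
pose V : fam := fun i x => colW (h i x).
have Hc (_ : unit) : carrier h by [].
pose small N (M : unit -> 'M[C]_N) := (forall p, re (M tt p p) <= p%:R) /\
  (forall p : 'I_N, im (M tt p p) <= (N - p.+1)%:R).
have hsmall (i : 'I_l.+1) x : small _ (fun=> h i x).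
  have [_ hr hi _] := hS i x; split=> p.
    by have /andP[_ hp] := hr p; apply: le_trans hp _; rewrite /cap ge_min lexx.
  by have /andP[_ hp] := hi p; apply: le_trans hp _; rewrite /cap ge_min lexx.
have Uc : carrier U.
  apply: (@carrier_nat R D unit (fun=> h) small (fun N M => rowW (M tt))) => //.
    move=> N t m iota M Mk [L bd] _ sk; apply: (rowW_natural L (bd tt)) => k a.
    by case: (sk k) => s _; exact: s.
  move=> i; exact: (continuous_rowW (carrier_continuous hc)).
have Vc : carrier V.
  apply: (@carrier_nat R D unit (fun=> h) small (fun N M => colW (M tt))) => //.
    move=> N t m iota M Mk [L bd] _ sk; apply: (colW_natural L (bd tt)) => k a.
    by case: (sk k) => _ s; exact: s.
  move=> i; exact: (continuous_colW (carrier_continuous hc)).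
exists U, V; split.
- by split=> //; apply: carrier_inv => // i x; exact: rowW_unit.
- by split=> //; apply: carrier_inv => // i x; exact: colW_unit.
move=> i x; have [_ _ _ _ thr] := gX i x.
exact: (steers_lower eta0 (GP i x) (hS i x) thr).
Qed.

End LowerFamily.

(** * Stable rank one *)

Section StableRankOne.
Variable R : realType.
Local Notation C := R[i].
Variable D : nat -> dsh_algebra R.
Variable phi : forall j, dsh_family (D j) -> dsh_family (D j.+1).
Arguments phi : clear implicits.
Variables (A : cstarAlgType R) (mu : forall j, dsh_family (D j) -> A).
Arguments mu : clear implicits.
Hypothesis phi_diag : forall j, diagonal_hom (phi j).
Hypothesis A_lim : inductive_limit phi mu.
Hypothesis A_simple : simple_cstar A.

(** A strictly lower triangular matrix becomes invertible by adding any nonzero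
scalar. *)
Lemma lower_near_invertible q (T : dsh_family (D q)) : dsh_carrier T ->
  (forall i x, strictly_lower (T i x)) -> near_invertible (mu q T).
Proof.
move=> Tc lT e e0; pose c : R := e / (cnorm (1 : A) + 1).
have n0 : 0 < cnorm (1 : A) + 1 by rewrite ltr_wpDl // cnorm_ge0.
have c0 : 0 < c by rewrite divr_gt0.
have oc := carrier1 (D q); have occ : dsh_carrier (c%:C *: (1 : dsh_family (D q))) by exact: carrierZ.
exists (mu q (T + c%:C *: (1 : dsh_family (D q)))).
  apply: (mu_unit phi_diag A_lim); split; first exact: carrierD.
  apply: carrier_inv; first exact: carrierD.
  move=> i x; have -> : (T + c%:C *: (1 : dsh_family (D q))) i x = T i x + (c%:C)%:M.
    by rewrite -scalemx1.
  apply: strictly_lower_unit => //.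
  by apply/eqP => /(congr1 (@complex.Re R)) /= c00; rewrite c00 ltxx in c0.
rewrite (muD A_lim) // opprD addrA subrr sub0r cnormN (muZ A_lim) // (mu1 phi_diag A_lim).
rewrite cnormZ; have -> : normc c%:C = c by rewrite /= expr0n addr0 sqrtr_sqr gtr0_norm.
by rewrite /c mulrAC ltr_pdivrMr // ltr_pM2l // ltrDl.
Qed.

Definition soft_fam j (eta : R) (f : dsh_family (D j)) : dsh_family (D j) :=
  fun i x => \matrix_(p, q) soft eta (f i x p q).

Lemma carrier_soft j eta (f : dsh_family (D j)) : 0 < eta -> dsh_carrier f ->
  dsh_carrier (soft_fam eta f).
Proof.
move=> eta0 fc.
apply: (@carrier_entrywise R (D j) unit (fun=> f) (fun z => soft eta (z tt))) => //.
  exact: soft0.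
by move=> Z F cF; apply: (continuous_soft eta0); exact: cF.
Qed.

(** By simplicity there is a stage at which none of the marks vanishes anywhere; there
[lower_conjugate] applies. *)
Lemma zero_crosses_near_invertible j B f (d : nat -> dsh_family (D j)) (eta : R) : 0 < eta ->
  (0 < B)%N -> (forall i : 'I_(dsh_last (D j)).+1, (dsh_size (D j) i <= B)%N) ->
  zero_crosses mu B f d ->
  near_invertible (mu j (soft_fam eta f)).
Proof.
move=> eta0 B0 nB [fc dP orth zero live]; have f1c := carrier_soft eta0 fc.
set f1 := soft_fam eta f in f1c *.
pose d' a := if (a < B)%N then d a else 0.
have d'E a : (a < B)%N -> d' a = d a by rewrite /d' => ->.
have d'c a : dsh_carrier (d' a).
  by rewrite /d'; case: ifP => [/dP[]//|_]; exact: carrier0.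
have /choice[K hK] : forall a : 'I_B, exists K, exists s, [/\ coherent phi j s, s j = d a
    & forall q, (K <= q)%N -> (j <= q)%N /\ forall i x, s q i x != 0].
  move=> a; have [s [cs sj]] := coherent_ex phi (d a).
  have dac : dsh_carrier (d a) by case: (dP a (ltn_ord a)).
  have nz : mu j (s j) != 0.
    apply/eqP; rewrite sj => ma; have [i [x [p [al dp]]]] := live a (ltn_ord a).
    have := al (d a) (conj dac ma) => e; rewrite e mxE in dp.
    by move/eqP: dp; rewrite eq_sym oner_eq0.
  rewrite -sj in dac.
  by have [K hK] := full_everywhere phi_diag A_lim A_simple cs dac nz; exists K, s.
pose q := (j + \sum_a K a)%N.
have jq : (j <= q)%N by exact: leq_addr.
have [Phi [tP mP cP]] := stage_map phi_diag A_lim jq.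
pose g (a : nat + bool) : dsh_family (D j) :=
  match a with inl a => d' a | inr b => if b then f else f1 end.
have gc a : dsh_carrier (g a) by case: a => [a|[]] //=.
have gX i x : cross_pattern eta B (fun a => g a i x).
  split=> /=.
  - move=> a; rewrite /d'; case: ifP => [/dP[_]|_]; first exact.
    split=> p; rewrite ?mxE /= ?lexx ?ler01 //.
    by move=> r; rewrite !mxE /=; case: eqP.
  - move=> a b ab p; rewrite /d'.
    case: ifP => [aB|_]; last by left; rewrite mxE.
    case: ifP => [bB|_]; last by right; rewrite mxE.
    exact: orth.
  - move=> a p; rewrite /d'; case: ifP => [aB|_]; last by rewrite mxE eqxx.
    exact: zero.
  - by move=> p r _; apply: leq_trans (ltn_ord r) _; apply: leq_trans (nB i) _; exact: leq_addl.
  by move=> p r; rewrite mxE; exact: soft_neq0.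
have Gc a : dsh_carrier (Phi (g a)) by exact: (transfer_carrier tP).
have GX := transfer_pred tP gc (@cross_pattern_natural R eta B) gX.
have Gn a : (a < B)%N -> forall i x, Phi (g (inl a)) i x != 0.
  move=> aB i x; rewrite /= d'E //; have [s [cs sj hs]] := hK (Ordinal aB).
  have := hs q; rewrite -sj cP // => -[|_]; last exact.
  by rewrite /q (bigD1 (Ordinal aB)) //= addnCA leq_addr.
have [U [V [uU uV lT]]] := lower_conjugate eta0 B0 Gc GX Gn.
have [Uc _] := uU; have [Vc _] := uV.
rewrite -(mP f1 f1c); apply: (near_invertibleM (mu_unit phi_diag A_lim uU)
  (mu_unit phi_diag A_lim uV)).
have Fc : dsh_carrier (Phi f1) by exact: (Gc (inr false)).
have UFc := carrierM Uc Fc.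
rewrite -(muM A_lim) // -(muM A_lim) //.
by apply: lower_near_invertible; [exact: carrierM|exact: lT].
Qed.

(** Softening the entries moves the image by less than its distance to the limits of
invertible elements, which contradicts [zero_crosses_near_invertible]. *)
Lemma stage_near_invertible j (f : dsh_family (D j)) : dsh_carrier f ->
  near_invertible (mu j f).
Proof.
move=> fc; apply: contrapT => nf; have [B nB] := size_bounded (D j).
have nB1 (i : 'I_(dsh_last (D j)).+1) : (dsh_size (D j) i <= B.+1)%N := leqW (nB i).
have [f0 [d [zc nf0]]] := many_crosses phi_diag A_lim B.+1 fc nf.
have [e e0 he] := not_near_invertible nf0.
pose eta := e / (B%:R ^+ 2 + 1).
have B1 : 0 < B%:R ^+ 2 + 1 :> R by rewrite ltr_wpDl // sqr_ge0.
have eta0 : 0 < eta by rewrite divr_gt0.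
have := he _ (zero_crosses_near_invertible eta0 (ltn0Sn _) nB1 zc).
have f0c : dsh_carrier f0 by case: zc.
have f1c := carrier_soft eta0 f0c; set f1 := soft_fam eta f0 in f1c *.
apply/negP; rewrite -ltNge -(muB A_lim) //.
apply: (@le_lt_trans _ _ (B%:R ^+ 2 * eta)).
  apply: (mu_entries_le phi_diag A_lim (ltW eta0) nB); first exact: carrierB.
  move=> i x p q; have -> : (f0 - f1) i x p q = f0 i x p q - soft eta (f0 i x p q).
    have -> : (f0 - f1) i x = f0 i x - f1 i x by [].
    by rewrite !mxE.
  exact: soft_close.
by rewrite /eta mulrCA gtr_pMr // ltr_pdivrMr // mul1r ltrDl.
Qed.

Lemma inductive_limit_stable_rank_one : stable_rank_one A.
Proof.
move=> a; apply: near_invertible_closed => e e0.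
have [j [f fc af]] := mu_dense A_lim a e0.
by exists (mu j f) => //; exact: stage_near_invertible.
Qed.

End StableRankOne.

Theorem theorem5p1 (R : realType) (D : nat -> dsh_algebra R)
    (phi : forall j, dsh_family (D j) -> dsh_family (D j.+1))
    (A : cstarAlgType R) (mu : forall j, dsh_family (D j) -> A)
    (phi_diag : forall j, diagonal_hom (phi j))
    (A_lim : inductive_limit phi mu)
    (A_simple : simple_cstar A) :
  stable_rank_one A.
Proof. exact: inductive_limit_stable_rank_one phi_diag A_lim A_simple. Qed.
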